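(* Let $m,\lambda\in\mathscr{M}$ and let $\varepsilon_n\downarrow0$ be a decreasing sequence of positive numbers. For each $n$ let $I_n=(-\varepsilon_n,\varepsilon_n)$, let $\gamma_n$ be a positive, finite, fully supported measure on $I_n$ charging no singleton, put $\lambda_n:=T_{\varepsilon_n}^{\#}\lambda+\gamma_n$, and let $(\mathcal{E}^n,\mathcal{F}^n)$ be the Dirichlet form on $L^2(\mathbb{R},m)$ \[ \mathcal{F}^n=\Big\{f\in L^2(\mathbb{R},m):f\ll\lambda_n,\ \int_{\mathbb{R}}\Big(\frac{df}{d\lambda_n}\Big)^2d\lambda_n<\infty,\ f(\pm\infty)=0\text{ if }\lambda_n(\mathbb{G}_\pm)<\infty\Big\}, \] \[ \mathcal{E}^n(f,g)=\frac12\int_{\mathbb{R}}\frac{df}{d\lambda_n}\frac{dg}{d\lambda_n}d\lambda_n . \] Set $m^*(n):=\sup_{x\in\mathbb{R}}m([x,x+\varepsilon_n])$, $\lambda^*(n):=\sup_{x\in\mathbb{R}}\lambda([x,x+\varepsilon_n])$ and $\bar\gamma(n):=\gamma_n(I_n)$. Assume \[ \bar\gamma(n)m^*(n)+\lambda^*(n)m^*(n)\to0\quad\text{as }n\to\infty, \] and that $\bar\gamma:=\lim_{n\to\infty}\bar\gamma(n)$ $(\le\infty)$ exists. Then: (1) If $\bar\gamma=\infty$, $(\mathcal{E}^n,\mathcal{F}^n)$ converges in the sense of Mosco to the Dirichlet form $(\mathcal{E},\mathcal{F})$ of the two-sided reflecting diffusion on $\mathbb{G}$. (2) If $0<\bar\gamma<\infty$,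 $(\mathcal{E}^n,\mathcal{F}^n)$ converges in the sense of Mosco to the Dirichlet form $(\mathcal{E}^{\mathrm s},\mathcal{F}^{\mathrm s})$ with parameter $\kappa=2/\bar\gamma$. (3) If $\bar\gamma=0$, $(\mathcal{E}^n,\mathcal{F}^n)$ converges in the sense of Mosco to the Dirichlet form $(\mathcal{E}^{\mathrm i},\mathcal{F}^{\mathrm i})$. Here $(\mathcal{E},\mathcal{F})$, $(\mathcal{E}^{\mathrm s},\mathcal{F}^{\mathrm s})$, $(\mathcal{E}^{\mathrm i},\mathcal{F}^{\mathrm i})$ are the forms built from $m$ and $\lambda$ defined in the context.
   Context: $\mathbb{G}=\mathbb{G}_-\cup\mathbb{G}_+$ with $\mathbb{G}_-=(-\infty,0-]$, $\mathbb{G}_+=[0+,\infty)$, a disjoint union ($0+\ne0-$). $\mathscr{M}$ is the set of fully supported positive Radon measures $\nu$ on $\mathbb{G}$ with $\nu(\{x\})=0$ for all $x\in\mathbb{G}$; such $\nu$ is also regarded as a measure on $\mathbb{R}$ (same symbol), and $L^2(\mathbb{G},m)=L^2(\mathbb{R},m)=:H$; also $\lambda_n(\mathbb{G}_\pm)$ means the mass of the corresponding closed half-line. For a function $f$ (measure $\nu$) on $\mathbb{G}$, $f_\pm=f|_{\mathbb{G}_\pm}$, $\nu_\pm=\nu|_{\mathbb{G}_\pm}$. Statements with $\pm$ are read once with $+$ and once with $-$. For an atomless fully supported Radon measure $\lambda$ on an interval with (continuous strictly increasing) distribution function $\mathtt{s}$, $f\ll\lambda$ means $f=g\circ\mathtt{s}$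 for some absolutely continuous function $g$, and $\frac{df}{d\lambda}:=g'\circ\mathtt{s}$. $f(\pm\infty):=\lim_{x\to\pm\infty}f(x)$. $T_\beta:\mathbb{G}\to(-\infty,-\beta]\cup[\beta,\infty)$, $T_\beta(x)=x+\beta$ for $x\in\mathbb{G}_+$, $x-\beta$ for $x\in\mathbb{G}_-$; $T_\beta^{\#}\lambda$ is the image measure of $\lambda$ under $T_\beta$. Limit forms: on $L^2(\mathbb{G}_\pm,m_\pm)$, \[ \mathcal{F}^\pm=\Big\{f\in L^2(\mathbb{G}_\pm,m_\pm):f\ll\lambda_\pm,\int_{\mathbb{G}_\pm}\Big(\frac{df}{d\lambda_\pm}\Big)^2d\lambda_\pm<\infty,\ f(\pm\infty)=0\text{ if }\lambda_\pm(\mathbb{G}_\pm)<\infty\Big\},\quad \mathcal{E}^\pm(f,g)=\frac12\int_{\mathbb{G}_\pm}\frac{df}{d\lambda_\pm}\frac{dg}{d\lambda_\pm}d\lambda_\pm ; \] $\mathcal{F}=\{f\in L^2(\mathbb{G},m):f_+\in\mathcal{F}^+,f_-\in\mathcal{F}^-\}$, $\mathcal{E}(f,g)=\mathcal{E}^+(f_+,g_+)+\mathcal{E}^-(f_-,g_-)$; $\mathcal{F}^{\mathrm s}=\mathcal{F}$, $\mathcal{E}^{\mathrm s}(f,g)=\mathcal{E}(f,g)+\frac{\kappa}{4}(f(0+)-f(0-))(g(0+)-g(0-))$; \[ \mathcal{F}^{\mathrm i}=\Big\{f\in L^2(\mathbb{R},m):f\ll\lambda,\int_{\mathbb{R}}\Big(\frac{df}{d\lambda}\Big)^2d\lambda<\infty,\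 f(\pm\infty)=0\text{ if }\lambda_\pm(\mathbb{G}_\pm)<\infty\Big\},\quad\mathcal{E}^{\mathrm i}(f,g)=\frac12\int_{\mathbb{R}}\frac{df}{d\lambda}\frac{dg}{d\lambda}d\lambda . \] Mosco convergence on $H$: extend closed forms by $+\infty$ (on the diagonal) outside their domains. $(\mathcal{A}^n)$ converges to $\mathcal{A}$ in the sense of Mosco if (i) whenever $u_n\to u$ weakly in $H$, $\mathcal{A}(u,u)\le\liminf_n\mathcal{A}^n(u_n,u_n)$; (ii) for every $u\in H$ there are $u_n\to u$ strongly in $H$ with $\mathcal{A}(u,u)\ge\limsup_n\mathcal{A}^n(u_n,u_n)$. *)

(* Defs.v *)
From HB Require Import structures.
From mathcomp Require Import all_boot all_order all_algebra.
From mathcomp Require Import all_classical all_reals all_analysis.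
From mathcomp Require Import measurable_realfun.

Set Implicit Arguments.
Unset Strict Implicit.
Unset Printing Implicit Defensive.
Import Order.TTheory GRing.Theory Num.Theory.
Import numFieldNormedType.Exports.
Local Open Scope classical_set_scope.
Local Open Scope ring_scope.

(* The state space is the disjoint union of the closed half-lines
   G- = ]-oo, 0-] and G+ = [0+, +oo[.  The measures considered on it do not
   charge points, so they are the same thing as measures on R; they are
   represented by the latter.  A function on it is represented by its two
   restrictions, to G- and to G+, which may differ at 0. *)

Section measures.
Context {R : realType}.
Local Notation borelR := (measurableTypeR R).

Definition Gneg : set R := `]-oo, 0]%classic.
Definition Gpos : set R := `[0, +oo[%classic.

(* On R, a Borel measure that is finite on compact sets is Radon: regularity is
   automatic. *)
Definition scrM (nu : {measure set borelR -> \bar R}) : Prop :=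
  [/\ forall K : set R, compact K -> (nu K < +oo)%E,
      forall U : set R, open U -> U !=set0 -> (0 < nu U)%E
    & forall x : R, nu [set x] = 0%E].

(* A measure on the open set I is represented by its extension by 0 to R. *)
Definition finite_full_atomless_on (I : set R)
    (nu : {measure set borelR -> \bar R}) : Prop :=
  [/\ nu (~` I) = 0%E,
      (nu I < +oo)%E,
      forall U : set R, open U -> U `<=` I -> U !=set0 -> (0 < nu U)%E
    & forall x : R, nu [set x] = 0%E].

(* T_b sends 0+ to b and 0- to -b; the value taken at the single real 0 is
   irrelevant for the image of an atomless measure. *)
Definition Tshift (b : R) : borelR -> borelR :=
  fun x : R => if 0 <= x then x + b else x - b.

Lemma measurable_Tshift (b : R) :
  measurable_fun [set: borelR] (Tshift b).
Proof.
rewrite /Tshift; apply: measurable_fun_ifT => /=.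
- apply: (measurable_fun_bool true); rewrite setTI.
  rewrite (_ : _ @^-1` _ = `[0, +oo[%classic); first exact: measurable_itv.
  by apply/seteqP; split => x /=; rewrite in_itv /= andbT.
- exact: measurable_funD.
- exact: measurable_funB.
Qed.

HB.instance Definition _ (b : R) :=
  isMeasurableFun.Build _ _ borelR borelR (Tshift b) (measurable_Tshift b).

Definition Timage (b : R) (nu : {measure set borelR -> \bar R}) :
    set borelR -> \bar R :=
  pushforward nu (Tshift b).

Section Timage_measure.
Variables (b : R) (nu : {measure set borelR -> \bar R}).

Let Timage0 : Timage b nu set0 = 0%E.
Proof. exact: measure0. Qed.

Let Timage_ge0 A : (0 <= Timage b nu A)%E.
Proof. exact: measure_ge0. Qed.

Let Timage_sigma_additive : semi_sigma_additive (Timage b nu).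
Proof. exact: measure_semi_sigma_additive. Qed.

HB.instance Definition _ := isMeasure.Build _ _ _ (Timage b nu)
  Timage0 Timage_ge0 Timage_sigma_additive.

End Timage_measure.

Definition regularized (b : R) (lam gam : {measure set borelR -> \bar R}) :
    {measure set borelR -> \bar R} :=
  measure_add (Timage b lam) gam.

(* m^*(n) and lambda^*(n), with b for epsilon_n *)
Definition max_mass (b : R) (nu : {measure set borelR -> \bar R}) : \bar R :=
  ereal_sup [set nu `[x, x + b]%classic | x in [set: R]].

(* A distribution function of nu, normalized to vanish at 0; restricted to G+
   or G- it is a distribution function of the restriction of nu. *)
Definition scale (nu : {measure set borelR -> \bar R}) (x : R) : R :=
  if 0 <= x then fine (nu `[0, x]%classic) else - fine (nu `[x, 0]%classic).

End measures.

Section derivative_wrt_measure.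
Context {R : realType}.
Local Notation borelR := (measurableTypeR R).
Implicit Types (nu : {measure set borelR -> \bar R}) (I : set R) (f g : R -> R).

(* J is meant to be an interval. *)
Definition absolutely_continuous (J : set R) g : Prop :=
  forall e : R, 0 < e -> exists2 d : R, 0 < d &
    forall (n : nat) (a b : nat -> R),
      (forall i, (i < n)%N -> [/\ a i <= b i, J (a i) & J (b i)]) ->
      trivIset `I_n (fun i => `]a i, b i[%classic) ->
      \sum_(i < n) (b i - a i) < d ->
      \sum_(i < n) `|g (b i) - g (a i)| < e.

Definition factors nu I f g : Prop :=
  absolutely_continuous (scale nu @` I) g /\
  forall x, I x -> f x = g (scale nu x).

(* f << nu on the interval I *)
Definition ac_wrt nu I f : Prop := exists g, factors nu I f g.

(* df/dnu on I; g is determined by f on the interval [scale nu @` I].  Where g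
   is not differentiable, a nu-null set, the value is a default one. *)
Definition dwrt nu I f (x : R) : R :=
  derive1 (get (factors nu I f) : R -> R) (scale nu x).

End derivative_wrt_measure.

(* A symmetric bilinear form on its domain. *)
Record bform (R V : Type) := BForm {
  form_dom : set V ;
  form_val : V -> V -> R }.

Definition form_ext (R : realType) (V : Type) (A : bform R V) (u : V) :
    \bar R :=
  if u \in form_dom A then (form_val A u u)%:E else +oo%E.

Section L2.
Context {R : realType}.
Local Notation borelR := (measurableTypeR R).
Variable m : {measure set borelR -> \bar R}.

(* Elements are square-integrable functions; everything below is invariant under
   equality m-almost everywhere. *)
Definition L2 := LfunType m (lee1n 2).

Definition strong_cvg (u_ : nat -> L2) (u : L2) : Prop :=
  ('N[m]_2%:E[EFin \o (u_ n - u)%R])%E @[n --> \oo] --> 0%E.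

Definition weak_cvg (u_ : nat -> L2) (u : L2) : Prop :=
  forall v : L2,
    \int[m]_x (u_ n x * v x) @[n --> \oo] --> \int[m]_x (u x * v x).

Definition Mosco (A_ : nat -> bform R L2) (A : bform R L2) : Prop :=
  (forall (u_ : nat -> L2) (u : L2), weak_cvg u_ u ->
     (form_ext A u <= limn_einf (fun n => form_ext (A_ n) (u_ n)))%E) /\
  (forall u : L2, exists2 u_ : nat -> L2, strong_cvg u_ u &
     (limn_esup (fun n => form_ext (A_ n) (u_ n)) <= form_ext A u)%E).

End L2.

Section forms.
Context {R : realType}.
Local Notation borelR := (measurableTypeR R).
Variable m : {measure set borelR -> \bar R}.
Implicit Types (nu : {measure set borelR -> \bar R}) (I : set R) (u v : L2 m).

(* f is a representative on I, absolutely continuous with respect to nu, of the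
   class of u. *)
Definition ac_version nu I u (f : R -> R) : Prop :=
  {ae m, forall x, I x -> u x = f x} /\ ac_wrt nu I f.

Definition version nu I u : R -> R := get (ac_version nu I u).

Definition finite_energy nu I (f : R -> R) : Prop :=
  (\int[nu]_(x in I) (dwrt nu I f x ^+ 2)%:E < +oo)%E.

Definition energy nu I (f g : R -> R) : R :=
  2^-1 * \int[nu]_(x in I) (dwrt nu I f x * dwrt nu I g x).

Definition vanishes_at_pinfty nu (f : R -> R) : Prop :=
  (nu Gpos < +oo)%E -> f x @[x --> +oo] --> (0 : R).

Definition vanishes_at_ninfty nu (f : R -> R) : Prop :=
  (nu Gneg < +oo)%E -> f x @[x --> -oo] --> (0 : R).

(* (E^i, F^i) for nu = lambda, and (E^n, F^n) for nu = lambda_n *)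
Definition form_line nu : bform R (L2 m) := BForm
  [set u | exists f, [/\ ac_version nu setT u f, finite_energy nu setT f,
                         vanishes_at_pinfty nu f & vanishes_at_ninfty nu f]]
  (fun u v => energy nu setT (version nu setT u) (version nu setT v)).

(* (E^+, F^+) and (E^-, F^-), evaluated at the restrictions of u and v to G+
   and G- *)
Definition form_pos nu : bform R (L2 m) := BForm
  [set u | exists f, [/\ ac_version nu Gpos u f, finite_energy nu Gpos f
                       & vanishes_at_pinfty nu f]]
  (fun u v => energy nu Gpos (version nu Gpos u) (version nu Gpos v)).

Definition form_neg nu : bform R (L2 m) := BForm
  [set u | exists f, [/\ ac_version nu Gneg u f, finite_energy nu Gneg f
                       & vanishes_at_ninfty nu f]]
  (fun u v => energy nu Gneg (version nu Gneg u) (version nu Gneg v)).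

(* (E, F) *)
Definition form_two_sided nu : bform R (L2 m) := BForm
  (form_dom (form_pos nu) `&` form_dom (form_neg nu))
  (fun u v => form_val (form_pos nu) u v + form_val (form_neg nu) u v).

(* u(0+) - u(0-) *)
Definition jump nu u : R := version nu Gpos u 0 - version nu Gneg u 0.

(* (E^s, F^s) *)
Definition form_snapping nu (kappa : R) : bform R (L2 m) := BForm
  (form_dom (form_two_sided nu))
  (fun u v => form_val (form_two_sided nu) u v
              + kappa / 4 * (jump nu u * jump nu v)).

End forms.

(* Main.v *)
Require Import Defs.
From HB Require Import structures.
From mathcomp Require Import all_boot all_order all_algebra.
From mathcomp Require Import all_classical all_reals all_analysis.
From mathcomp Require Import measurable_realfun ring lra zify.

Set Implicit Arguments.
Unset Strict Implicit.
Unset Printing Implicit Defensive.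
Import Order.TTheory GRing.Theory Num.Theory.
Import numFieldNormedType.Exports.
Local Open Scope classical_set_scope.
Local Open Scope ring_scope.


(** Apart from the jump term of the snapping form, all the forms at hand are sums
   of energies (1/2) int (df/dnu)^2 dnu, where nu is an atomless measure of full
   support, and the proof rests on a description of such an energy by increments
   of f alone.  Let s be the distribution function of nu.  The integral of
   (df/dnu)^2 over an interval is at most C if and only if
     sum_i (f(b_i) - f(a_i))^2 / (s(b_i) - s(a_i)) <= C
   for all finite families of disjoint intervals ]a_i, b_i[ in it
   ([energy_bounded]).  If f is absolutely continuous, it is the integral of its
   derivative ([ac_density]), and the Cauchy-Schwarz inequality gives
     (f(y) - f(x))^2 <= (s(y) - s(x)) (Q(y) - Q(x)),
   where Q(x) is the integral of (df/dnu)^2 to the left of x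
   ([factors_controlled]); summation over the family yields the bound.  In the
   other direction, the bound on the sums gives the absolute continuity
   ([energy_bounded_factors]), and Fatou's lemma, applied to the squared slopes
   over dyadic intervals, gives the bound on the integral
   ([energy_bounded_integral]).

   Lower bound.  Let u_n tend weakly to u, with energies below c along a
   subsequence.  Moved to the two half-lines by the inverse of T_eps, the
   functions are equicontinuous with respect to lambda, so that the convergence
   of their averages over short intervals makes them converge at every point;
   the limits Fp and Fm agree with u almost everywhere ([bounded_energy_limit]).
   The sums above pass to the limit.  The gap I_n takes its own share of the
   energy, at least (f_n(eps_n) - f_n(- eps_n))^2 / (2 gamma_n(I_n)).  In the
   limit this share is the term (kappa / 4) (Fp(0) - Fm(0))^2 with kappa = 2 /
   gammabar if gammabar is positive and finite, it can be ignored if gammabar is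
   infinite, and it forces Fp(0) = Fm(0) if gammabar = 0.  The conditions at
   infinity survive because the tails are uniformly small ([tail_vanish]).

   Upper bound.  Given u with branches fp and fm, the branches are moved apart by
   T_eps and joined by a function that is affine in the scale ([bridge]); the
   energy of the result exceeds that of the branches by
   (fp(0) - fm(0))^2 / (2 gamma_n(I_n)).  Its distance to u in L^2 is controlled
   by the differences fp(x - eps) - fp(x), whose squares are at most
   lambda^*(n) (Q(x) - Q(x - eps)).  After cutting the half-line into cells of
   length eps, each of mass at most m^*(n), the increments of Q add up to a
   bounded quantity, and the square of the distance is O(lambda^*(n) m^*(n))
   ([shift_estimate_pos], [recovery_step]). *)

(** * Absolute continuity and families of intervals *)

Section absolute_continuity.
Context {R : realType}.
Implicit Types (g : R -> R) (l : seq (R * R)).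

(** The pairs in [l] are the endpoints of intervals contained in [[a, b]],
   listed from left to right, which may touch but do not overlap. *)
Definition subintervals (a b : R) l :=
  all (fun p => (a <= p.1) && (p.1 <= p.2) && (p.2 <= b)) l &&
  pairwise (fun p q => p.2 <= q.1) l.

Lemma subintervals_cat a b l1 l2 :
  subintervals a b (l1 ++ l2) =
  [&& subintervals a b l1, subintervals a b l2 &
      all (fun p => all (fun q => p.2 <= q.1) l2) l1].
Proof.
rewrite /subintervals all_cat pairwise_cat.
rewrite /allrel -!andbA; do ?bool_congr.
Qed.

Lemma subintervals_sub a b a' b' l : a' <= a -> b <= b' ->
  subintervals a b l -> subintervals a' b' l.
Proof.
move=> aa bb /andP[/allP h1 h2]; apply/andP; split=> //.
apply/allP => p /h1 /andP[/andP[h3 h4] h5].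
by rewrite h4 (le_trans aa)// (le_trans h5).
Qed.

Lemma ac_subintervals J g : absolutely_continuous J g ->
  forall e : R, 0 < e -> exists2 d : R, 0 < d & forall a b l,
    `[a, b]%classic `<=` J -> subintervals a b l ->
    \sum_(p <- l) (p.2 - p.1) < d ->
    \sum_(p <- l) `|g p.2 - g p.1| < e.
Proof.
move=> gac e /gac[d d0 gd]; exists d => // a b l abJ /andP[/allP hl hp].
rewrite !(big_nth (0, 0)) !big_mkord => ld.
apply: (gd (size l) (fun i => (nth (0, 0) l i).1) (fun i => (nth (0, 0) l i).2)) => //.
- move=> i /(mem_nth (0, 0))/hl /andP[/andP[h1 h2] h3]; split => //.
    by apply: abJ; rewrite /= in_itv/= h1 (le_trans h2).
  by apply: abJ; rewrite /= in_itv/= h3 (le_trans h1).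
- have H i j x : (i < j < size l)%N ->
      (`](nth (0, 0) l i).1, (nth (0, 0) l i).2[%classic `&`
       `](nth (0, 0) l j).1, (nth (0, 0) l j).2[%classic) x -> False.
    move=> /andP[ij jl]; have /= h : (nth (0, 0) l i).2 <= (nth (0, 0) l j).1.
      by move/pairwiseP : hp => /(_ (0, 0) i j); rewrite !inE (ltn_trans ij jl); exact.
    rewrite /= !in_itv/= => -[/andP[_ a2] /andP[b1 _]].
    by have := lt_trans a2 (le_lt_trans h b1); rewrite ltxx.
  move=> i j /= il jl [x xij]; apply/eqP/negPn/negP.
  rewrite neq_ltn => /orP[ij|ji].
    by apply: (H i j x) => //; rewrite ij.
  by apply: (H j i x) => //; [rewrite ji|rewrite setIC].
Qed.

(** A number below the total variation on [[a, b]] is exceeded by the variation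
   along some partition of [[a, b]]. *)
Lemma total_variation_subintervals a b g (c : R) : a <= b ->
  (c%:E < total_variation a b g)%E ->
  exists l, [/\ subintervals a b l, \sum_(p <- l) (p.2 - p.1) = b - a &
    c < \sum_(p <- l) `|g p.2 - g p.1|].
Proof.
move=> ab /ereal_sup_gt[_ [_ [s abs <-] <-]]; rewrite lte_fin variation_zip// => cs.
exists (zip (a :: s) s); split; last first.
- suff -> : \sum_(p <- zip (a :: s) s) `|g p.2 - g p.1| =
           \sum_(p <- zip s (a :: s)) `|g p.1 - g p.2| by [].
  move: (a :: s) => s'; elim: s s' {abs cs} => [|x s ih] [|y s'];
    by rewrite ?big_nil//= !big_cons/= ih.
- move: abs {cs}; elim: s a ab => [|x s ih] a ab.
    by move=> /itv_partition_nil ->; rewrite big_nil subrr.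
  move=> abs; rewrite /= big_cons/= ih; first by rewrite addrC subrKA.
    by move/itv_partition_cons : abs => /itv_partition_le.
  exact: itv_partition_cons abs.
- move: abs {cs}; elim: s a ab => [//|x s ih] a ab abs.
  have ax : a <= x by case: abs => /= /andP[/ltW].
  have xb : x <= b by move/itv_partition_cons : abs => /itv_partition_le.
  rewrite /= -cat1s subintervals_cat; apply/and3P; split.
  + by rewrite /subintervals /= lexx ax xb.
  + apply: (subintervals_sub ax (lexx b)); apply: ih => //.
    exact: itv_partition_cons abs.
  + rewrite /= andbT; apply/allP => p.
    have /andP[/allP h _] := ih _ xb (itv_partition_cons abs).
    by move=> /h /andP[/andP[]].
Qed.

(** Each interval of [l] is cut so finely that the increments of [g] account for
   its total variation on it, with an error of at most [t]. *)
Lemma subintervals_refine g (t : R) a b l :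
  (forall p, p \in l -> (total_variation p.1 p.2 g < +oo)%E) ->
  0 < t -> subintervals a b l ->
  exists l', [/\ subintervals a b l',
    \sum_(p <- l') (p.2 - p.1) = \sum_(p <- l) (p.2 - p.1) &
    \sum_(p <- l) fine (total_variation p.1 p.2 g) <=
    \sum_(p <- l') `|g p.2 - g p.1| + t * (size l)%:R].
Proof.
move=> + t0; elim: l a => [|p l ih] a TVfin abl.
  by exists [::]; split=> //; rewrite !big_nil add0r mulr0.
have /andP[/andP[/andP[ap pp] pb] pl] : (a <= p.1) && (p.1 <= p.2) && (p.2 <= b) &&
    all (fun q => p.2 <= q.1) l.
  by move: abl; rewrite /subintervals/= => /andP[/andP[-> _] /andP[-> _]].
have [||l' [l'1 l'2 l'3]] := ih p.2.
- by move=> q ql; apply: TVfin; rewrite inE ql orbT.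
- move: abl; rewrite /subintervals/= => /andP[/andP[_ abl] /andP[_ ->]]; rewrite andbT.
  apply/allP => q ql; move/allP : abl => /(_ q ql)/andP[/andP[_ ->] ->].
  by rewrite (allP pl).
have TVf : total_variation p.1 p.2 g \is a fin_num.
  by rewrite ge0_fin_numE ?total_variation_ge0// TVfin// mem_head.
have [|l0 [l01 l02 l03]] := @total_variation_subintervals p.1 p.2 g
  (fine (total_variation p.1 p.2 g) - t) pp.
- by rewrite EFinB fineK// lteBlDr// lteDl.
exists (l0 ++ l'); split.
- rewrite subintervals_cat (subintervals_sub ap pb l01)/=.
  rewrite (subintervals_sub (le_trans ap pp) (lexx b) l'1)/=.
  apply/allP => q ql0; apply/allP => r rl'.
  move: l01 => /andP[/allP/(_ _ ql0)/andP[_ h1] _].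
  move: l'1 => /andP[/allP/(_ _ rl')/andP[/andP[h2 _] _] _].
  exact: le_trans h1 h2.
- by rewrite big_cat big_cons/= l'2 l02.
- rewrite big_cat big_cons/= -natr1 mulrDr mulr1.
  by move: l03 l'3; lra.
Qed.

End absolute_continuity.

(** * Lebesgue-Stieltjes measures of absolutely continuous functions *)

Section dyadic_cells.
Context {R : realType}.

(** The endpoints of the dyadic intervals of length [2 ^- n], numbered from
   the left end of [[- n, n]]. *)
Definition dyadic (n k : nat) : R := k%:R / 2 ^+ n - n%:R.

Lemma dyadicS n k : dyadic n k.+1 = dyadic n k + 2 ^- n.
Proof. by rewrite /dyadic -natr1 mulrDl mul1r; ring. Qed.

Lemma lt_dyadicS n k : dyadic n k < dyadic n k.+1.
Proof. by rewrite dyadicS ltrDl invr_gt0 exprn_gt0. Qed.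

Lemma dyadic0 n : dyadic n 0 = - n%:R.
Proof. by rewrite /dyadic mul0r sub0r. Qed.

Lemma dyadic_mid n : dyadic n (n * 2 ^ n) = 0.
Proof. by rewrite /dyadic natrM natrX mulfK ?subrr// expf_neq0. Qed.

Lemma dyadic_last n : dyadic n (2 * n * 2 ^ n) = n%:R.
Proof.
by rewrite /dyadic natrM natrX mulfK ?expf_neq0// natrM; ring.
Qed.

Lemma le_dyadic n i j : (i <= j)%N -> dyadic n i <= dyadic n j.
Proof. by move=> ij; rewrite lerB// ler_pM// ?ler_nat// invr_ge0 exprn_ge0. Qed.

Lemma cell_oc (c : nat -> R) i j x : (i <= j)%N -> c i < x -> x <= c j ->
  exists k, [/\ (i <= k < j)%N, c k < x & x <= c k.+1].
Proof.
move=> ij ci; elim: j ij => [|j ih].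
  by rewrite leqn0 => /eqP <- /(lt_le_trans ci); rewrite ltxx.
rewrite leq_eqVlt => /predU1P[<- /(lt_le_trans ci)|ij xj]; first by rewrite ltxx.
have [xcj|cjx] := leP x (c j); last by exists j; rewrite -ltnS ij ltnSn.
have [k [/andP[ik kj] ? ?]] := ih ij xcj.
by exists k; rewrite ik ltnS (ltnW kj).
Qed.

Lemma cell_co (c : nat -> R) i j x : (i <= j)%N -> c i <= x -> x < c j ->
  exists k, [/\ (i <= k < j)%N, c k <= x & x < c k.+1].
Proof.
move=> ij ci; elim: j ij => [|j ih].
  by rewrite leqn0 => /eqP <- /(le_lt_trans ci); rewrite ltxx.
rewrite leq_eqVlt => /predU1P[<- /(le_lt_trans ci)|ij xj]; first by rewrite ltxx.
have [xcj|cjx] := ltP x (c j); last by exists j; rewrite -ltnS ij ltnSn.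
have [k [/andP[ik kj] ? ?]] := ih ij xcj.
by exists k; rewrite ik ltnS (ltnW kj).
Qed.

Lemma dyadic_small (e : R) : 0 < e -> exists N, forall n, (N <= n)%N -> 2 ^- n < e.
Proof.
move=> e0; have : (2^-1 : R) ^+ n @[n --> \oo] --> 0.
  by apply: cvg_expr; rewrite ger0_norm// invf_lt1// ltr1n.
move=> /cvgrPdist_lt/(_ _ e0)[N _ HN]; exists N => n /HN /=.
by rewrite sub0r normrN ger0_norm ?exprn_ge0// exprVn.
Qed.

End dyadic_cells.

Section measure_subintervals.
Context {R : realType}.
Variable mu : {measure set (measurableTypeR R) -> \bar R}.
Local Notation U l := (\big[setU/set0]_(p <- l) `]p.1, p.2]%classic : set R).

Lemma measurable_subintervals (l : seq (R * R)) :
  measurable (U l : set (measurableTypeR R)).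
Proof. by apply: bigsetU_measurable => p _; exact: measurable_itv. Qed.

Lemma mem_bigsetU_seq (T I : eqType) (l : seq I) (F : I -> set T) x :
  (\big[setU/set0]_(p <- l) F p) x <-> exists2 p, p \in l & F p x.
Proof.
elim: l => [|p l ih]; first by rewrite big_nil; split => // -[].
rewrite big_cons; split => [[Fx|/ih[q ql Fq]]|[q]].
- by exists p => //; rewrite mem_head.
- by exists q => //; rewrite inE ql orbT.
- by rewrite inE => /predU1P[->|ql Fq]; [left|right; apply/ih; exists q].
Qed.

Lemma measure_subintervals a b (l : seq (R * R)) : subintervals a b l ->
  mu (U l) = (\sum_(p <- l) mu `]p.1, p.2]%classic)%E.
Proof.
elim: l a => [|p l ih] a abl; first by rewrite !big_nil measure0.
rewrite !big_cons measureU//; last 2 first.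
- exact: measurable_subintervals.
- apply/seteqP; split => // x [] /= xp /mem_bigsetU_seq[q ql].
  move: xp abl; rewrite /subintervals/= !in_itv/=.
  move=> /andP[_ xp] /andP[_ /andP[/allP/(_ _ ql) pq _]] /andP[qx _].
  by have := lt_le_trans (le_lt_trans pq qx) xp; rewrite ltxx.
congr (_ + _)%E; apply: (ih a).
by move: abl; rewrite /subintervals/= => /andP[/andP[_ ->] /andP[_ ->]].
Qed.

End measure_subintervals.

Section stieltjes_absolutely_continuous.
Context {R : realType}.
Variable F : cumulative R R.
Hypothesis Fac : forall e : R, 0 < e -> exists2 d : R, 0 < d & forall a b l,
  subintervals a b l -> \sum_(p <- l) (p.2 - p.1) < d ->
  \sum_(p <- l) (F p.2 - F p.1) <= e.
Local Notation muF := (lebesgue_stieltjes_measure F).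
Local Notation leb := (@lebesgue_measure R).

Lemma stieltjes_itvoc (x y : R) : x <= y ->
  muF `]x, y]%classic = (F y - F x)%:E.
Proof.
move=> xy; rewrite /lebesgue_stieltjes_measure /measure_extension/=.
by rewrite measurable_mu_extE/=; [rewrite wlength_itv_bnd|exact: is_ocitv].
Qed.

(** An open set is the increasing limit of finite unions of dyadic intervals, to
   which the absolute continuity of [F] applies. *)
Lemma stieltjes_open_small (e : R) : 0 < e -> exists2 d : R, 0 < d &
  forall U : set R, open U -> (leb U < d%:E)%E -> (muF U <= e%:E)%E.
Proof.
move=> /Fac[d d0 Fd]; exists d => // U oU Ud.
pose l n : seq (R * R) := [seq (dyadic n k, dyadic n k.+1) |
   k <- iota 0 (2 * n * 2 ^ n) & asbool (`]dyadic n k, dyadic n k.+1]%classic `<=` U)].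
pose V n : set R := \big[setU/set0]_(p <- l n) `]p.1, p.2]%classic.
have lS n : subintervals (- n%:R) n%:R (l n).
  apply/andP; split.
    apply/allP => _ /mapP[k + ->]/=; rewrite mem_filter mem_iota/= => /andP[_ kn].
    by rewrite -dyadic0 -dyadic_last !le_dyadic.
  rewrite pairwise_map; apply: pairwise_filter.
  apply: (@sub_pairwise _ ltn) => [x y /= xy|]; first exact: le_dyadic.
  by rewrite -sorted_pairwise ?iota_ltn_sorted//; exact: ltn_trans.
have mV n : measurable (V n : set (measurableTypeR R)).
  exact: measurable_subintervals.
have VU n : V n `<=` U.
  move=> x /mem_bigsetU_seq[_ /mapP[k + ->]] /=.
  by rewrite mem_filter => /andP[/asboolP kU _] /kU.
have Ve n : (muF (V n) <= e%:E)%E.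
  rewrite (@measure_subintervals _ _ _ _ _ (lS n)).
  have lE p : p \in l n -> p.1 <= p.2.
    by have /andP[/allP h _] := lS n => /h /andP[/andP[]].
  rewrite (eq_big_seq (fun p => (F p.2 - F p.1)%:E)); last first.
    by move=> p /lE; exact: stieltjes_itvoc.
  rewrite sumEFin lee_fin; apply: Fd (lS n) _.
  rewrite -lte_fin; apply: le_lt_trans Ud.
  apply: (@le_trans _ _ (leb (V n))); last first.
    apply: le_measure; rewrite ?inE; [exact: mV|exact: open_measurable|exact: VU].
  rewrite [leRHS](@measure_subintervals _ _ _ _ _ (lS n)) -sumEFin.
  rewrite big_seq [leRHS]big_seq lee_sum// => p pl.
  rewrite [leRHS]lebesgue_measure_itv/= lte_fin; case: ltP => //.
  by rewrite lee_fin subr_le0.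
(* W N collects the points that belong to V n for every n >= N. *)
pose W N := \bigcap_(n in [set k | (N <= k)%N]) V n.
have mW N : measurable (W N : set (measurableTypeR R)).
  by apply: bigcap_measurable => //; exists N => /=.
have W_nd : nondecreasing_seq W.
  move=> i j ij; apply/subsetPset => x Wx n /= jn; apply: Wx => /=.
  exact: leq_trans jn.
have UW : U `<=` \bigcup_N W N.
  move=> x Ux; have /nbhs_ballP[r /= r0 rU] : nbhs x U by exact: open_nbhs_nbhs.
  have [N1 HN1] := dyadic_small r0.
  pose N := maxn N1 (Num.bound `|x|).
  exists N => // n /= Nn.
  have xn : `|x| < n%:R.
    apply: (lt_le_trans (archi_boundP _)) => //.
    by rewrite ler_nat (leq_trans _ Nn)// /N leq_maxr.
  have [||k [/andP[_ kn] kx xk]] := @cell_oc R (dyadic n) 0 (2 * n * 2 ^ n) x (leq0n _).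
  - by rewrite dyadic0; move: xn; rewrite ltr_norml => /andP[].
  - by rewrite dyadic_last; move: xn; rewrite ltr_norml => /andP[_ /ltW].
  apply/mem_bigsetU_seq; exists (dyadic n k, dyadic n k.+1).
    apply/mapP; exists k => //; rewrite mem_filter mem_iota/= add0n kn andbT.
    apply/asboolP => y /=; rewrite in_itv/= => /andP[ky yk]; apply: rU.
    have := HN1 n (leq_trans (leq_maxl _ _) Nn).
    move: xk yk; rewrite dyadicS /ball/= => xk yk h.
    by rewrite ltr_norml; apply/andP; split; lra.
  by rewrite /= in_itv/= kx xk.
apply: (@le_trans _ _ (muF (\bigcup_N W N))).
  apply: le_measure => //; rewrite ?inE; first exact: open_measurable.
  exact: bigcup_measurable.
have cvgW := nondecreasing_cvg_mu (mu := muF) mW (bigcup_measurable (fun k _ => mW k)) W_nd.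
rewrite -(cvg_lim _ cvgW)//; apply: lime_le; first by apply/cvg_ex; eexists; exact: cvgW.
apply: nearW => n; apply: le_trans (Ve n); apply: le_measure; rewrite ?inE//.
by move=> x; apply => /=.
Qed.

Lemma stieltjes_dominated : muF `<< leb.
Proof.
apply/null_content_dominatesP => N mN N0; apply/eqP.
rewrite eq_le measure_ge0 andbT; apply/lee_addgt0Pr => e e0; rewrite add0e.
have [d d0 Fd] := stieltjes_open_small e0.
have N0y : (leb N < +oo)%E by rewrite [ltLHS]N0.
have [U [oU NU UNd]] := lebesgue_regularity_outer mN N0y d0.
apply: (@le_trans _ _ (muF U)).
  by apply: le_measure; rewrite ?inE//; exact: open_measurable.
apply: Fd => //; rewrite -(setDUK NU) measureU//; last 2 first.
- by apply: measurableD => //; exact: open_measurable.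
- by rewrite setDE setICA setICr setI0.
by rewrite [X in (X + _)%E]N0 add0e.
Qed.

End stieltjes_absolutely_continuous.

(** * The density of an absolutely continuous function *)

Section stieltjes_density.
Context {R : realType}.
Variables (F : R -> R) (a b : R).
Hypothesis Fnd : {homo F : x y / x <= y}.
Hypothesis Fa : forall x, x <= a -> F x = F a.
Hypothesis Fb : forall x, b <= x -> F x = F b.
Hypothesis Fac : forall e : R, 0 < e -> exists2 d : R, 0 < d & forall a b l,
  subintervals a b l -> \sum_(p <- l) (p.2 - p.1) < d ->
  \sum_(p <- l) (F p.2 - F p.1) <= e.
Local Notation leb := (@lebesgue_measure R).

Let F_rc : right_continuous F.
Proof.
move=> x; apply/cvgrPdist_le => e /Fac[d d0 Fd]; near=> y.
have xy : x < y by near: y; exact: nbhs_right_gt.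
rewrite distrC ger0_norm ?subr_ge0 ?(Fnd (ltW xy))//.
have := Fd x y [:: (x, y)]; rewrite !big_seq1/=; apply.
  by rewrite /subintervals/= !lexx (ltW xy).
by rewrite ltrBlDl; near: y; apply: nbhs_right_lt; rewrite ltrDl.
Unshelve. all: by end_near. Qed.

HB.instance Definition _ := isCumulative.Build R _ R F Fnd F_rc.

(** The density is the Radon-Nikodym derivative, with respect to the Lebesgue
   measure, of the Stieltjes measure of [F]. *)
Lemma stieltjes_density : exists h : R -> R,
  leb.-integrable setT (EFin \o h) /\
  forall x, F x = F a + \int[leb]_(t in `]-oo, x]) h t.
Proof.
pose muF := lebesgue_stieltjes_measure (F : cumulative R R).
have mab : measurable (`]a, b]%classic : set (measurableTypeR R)).
  exact: measurable_itv.
have fab : (muF `]a, b]%classic < +oo)%E.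
  have [ab|ba] := leP a b; first by rewrite /muF stieltjes_itvoc// ltry.
  by rewrite set_itv_ge ?bnd_simp -?leNgt ?ltW// /muF measure0 ltry.
pose nu : {finite_measure set (measurableTypeR R) -> \bar R} := mfrestr mab fab.
have nuleb : nu `<< leb.
  apply/null_content_dominatesP => A mA A0.
  have /null_content_dominatesP/(_ A mA A0) := stieltjes_dominated Fac.
  by apply: subset_measure0; [exact: measurableI| |exact: subIsetl].
have [f [f0 ffin fint fE]] := radon_nikodym_sigma_finite nuleb.
exists (fine \o f); split.
  by apply: eq_integrable fint => // x _ /=; rewrite fineK.
move=> x; rewrite /Rintegral; under eq_integral do rewrite /= fineK//.
rewrite -fE; last exact: measurable_itv.
rewrite /nu/= /mfrestr /mrestr.
have [xa|ax] := leP x a.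
  rewrite (_ : _ `&` _ = set0) ?measure0 ?addr0 ?Fa//.
  apply/seteqP; split => // t []; rewrite /= !in_itv/= => tx /andP[ta _].
  by have := lt_le_trans ta (le_trans tx xa); rewrite ltxx.
have [ba|ab] := leP b a.
  rewrite (@set_itv_ge _ _ (BRight a)) ?bnd_simp -?leNgt// setI0 measure0 addr0.
  by rewrite Fb ?(Fb ba)// (le_trans ba)// ltW.
rewrite (_ : _ `&` _ = `]a, Num.min x b]%classic); last first.
  by apply/seteqP; split => t /=; rewrite !in_itv/= le_min; [move=> [-> /andP[-> ->]]|
    move=> /and3P[-> -> ->]].
rewrite stieltjes_itvoc ?le_min ?(ltW ax) ?(ltW ab)//= subrKC /Num.min.
by case: ltP => // /Fb ->.
Qed.

End stieltjes_density.

Section density_of_absolutely_continuous.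
Context {R : realType}.
Local Notation leb := (@lebesgue_measure R).

Lemma density_derivable (G h : R -> R) (c : R) :
  leb.-integrable setT (EFin \o h) ->
  (forall x, G x = c + \int[leb]_(t in `]-oo, x]) h t) ->
  {ae leb, forall x, derivable G x 1 /\ derive1 G x = h x}.
Proof.
move=> hint GE.
have hloc : locally_integrable setT h.
  by apply: open_integrable_locally => //; exact: openT.
have hy y : leb.-integrable `]-oo, y]%classic (EFin \o h).
  by apply: integrableS hint => //; exact: measurable_itv.
have := FTC1Ny hy hloc.
apply: filterS; first exact: (ae_filter_ringOfSetsType leb).
move=> x /= [dH Hx].
have -> : G = cst c + (fun x => \int[leb]_(t in `]-oo, x]) h t).
  by apply/funext => y; rewrite GE.
have dc : derivable (cst c : R -> R) x 1 by exact: derivable_cst.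
split; first exact: derivableD dc dH.
rewrite derive1E (deriveD dc dH) derive_cst add0r.
by rewrite -Hx derive1E.
Qed.

Lemma density_increment (G h : R -> R) (c : R) :
  leb.-integrable setT (EFin \o h) ->
  (forall x, G x = c + \int[leb]_(t in `]-oo, x]) h t) ->
  forall x y, x <= y -> G y - G x = \int[leb]_(t in `]x, y]) h t.
Proof.
move=> hint GE x y xy; rewrite !GE opprD addrACA subrr add0r.
apply: (@Rintegral_itvB _ _ (BInfty _ true) (BRight y)) => //.
by apply: integrableS hint => //; exact: measurable_itv.
Qed.

(** The point of [[a, b]] closest to [x]. *)
Definition clamp (a b x : R) := Num.max a (Num.min x b).

Lemma clamp_itv a b x : a <= b -> a <= clamp a b x <= b.
Proof. by move=> ab; rewrite /clamp le_max lexx/= ge_max ab ge_min lexx orbT. Qed.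

Lemma clamp_id a b x : a <= x <= b -> clamp a b x = x.
Proof. by move=> /andP[ax xb]; rewrite /clamp min_l// max_r. Qed.

Lemma clamp_le a b x : a <= b -> x <= a -> clamp a b x = a.
Proof. by move=> ab xa; rewrite /clamp min_l ?(le_trans xa)// max_l. Qed.

Lemma clamp_ge a b x : a <= b -> b <= x -> clamp a b x = b.
Proof. by move=> ab xa; rewrite /clamp min_r// max_r. Qed.

Lemma clamp_homo a b : {homo clamp a b : x y / x <= y}.
Proof.
move=> x y xy; rewrite /clamp ge_max !le_max lexx/= le_min !ge_min lexx !orbT andbT.
by rewrite xy orbT.
Qed.

Lemma clamp_increment a b x y : a <= b -> x <= y -> clamp a b y - clamp a b x <= y - x.
Proof.
move=> ab xy; rewrite /clamp lerBlDr ge_max; apply/andP; split.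
  have : a <= Num.max a (Num.min x b) by rewrite le_max lexx.
  by move: (Num.max _ _) => z ?; lra.
have : Num.min x b <= Num.max a (Num.min x b) by rewrite le_max lexx orbT.
have : Num.min y b <= y by rewrite ge_min lexx.
have : Num.min y b <= b by rewrite ge_min lexx orbT.
move: (Num.max _ _) (Num.min y b) => z w.
by case: (leP x b) => *; lra.
Qed.

(** The traces of the intervals of [l] on [[a, b]]; an interval outside it is sent
   to one of its endpoints. *)
Definition clamp_seq a b (l : seq (R * R)) :=
  [seq (clamp a b p.1, clamp a b p.2) | p <- l].

Lemma clamp_subintervals a b a' b' l : a <= b -> subintervals a' b' l ->
  subintervals a b (clamp_seq a b l).
Proof.
move=> ab /andP[/allP l1 l2]; apply/andP; split.
  apply/allP => _ /mapP[p /l1/andP[/andP[_ pp] _] ->]/=.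
  have /andP[-> _] := clamp_itv p.1 ab.
  by have /andP[_ ->] := clamp_itv p.2 ab; rewrite clamp_homo.
rewrite pairwise_map; apply: sub_pairwise l2 => p q /= pq.
exact: clamp_homo.
Qed.

Lemma clamp_seq_len a b a' b' l : a <= b -> subintervals a' b' l ->
  \sum_(p <- clamp_seq a b l) (p.2 - p.1) <= \sum_(p <- l) (p.2 - p.1).
Proof.
move=> ab /andP[/allP l1 _]; rewrite big_map big_seq [leRHS]big_seq.
apply: ler_sum => p /l1 /andP[/andP[_ pp] _].
exact: clamp_increment.
Qed.

Section on_segment.
Variables (J : set R) (g : R -> R) (a b : R).
Hypotheses (gac : absolutely_continuous J g) (ab : a < b).
Hypothesis abJ : `[a, b]%classic `<=` J.
Local Notation TV := total_variation.

Let TV_small (e : R) : 0 < e -> exists2 d : R, 0 < d & forall x y,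
  a <= x -> x <= y -> y <= b -> y - x < d -> (TV x y g <= e%:E)%E.
Proof.
move=> e0; have [d d0 gd] := ac_subintervals gac e0; exists d => // x y ax xy yb yxd.
rewrite leNgt; apply/negP => /(total_variation_subintervals xy)[l [l1 l2 l3]].
suff : \sum_(p <- l) `|g p.2 - g p.1| < e by rewrite ltNge (ltW l3).
apply: (gd a b) => //; last by rewrite l2.
exact: subintervals_sub l1.
Qed.

Let TV_fin x y : a <= x -> x <= y -> y <= b -> TV x y g \is a fin_num.
Proof.
move=> ax xy yb; rewrite ge0_fin_numE ?total_variation_ge0//.
have [d d0 gd] := TV_small ltr01.
have [n yn] : exists n : nat, y - x <= n%:R * (d / 2).
  exists (Num.bound ((y - x) / (d / 2))).
  rewrite -ler_pdivrMr ?divr_gt0// ltW// archi_boundP//.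
  by rewrite divr_ge0 ?subr_ge0// divr_ge0// ltW.
elim: n y xy yb yn => [|n ih] y xy yb yn.
  rewrite (_ : y = x); last by apply/eqP; rewrite eq_le xy andbT -subr_le0 -[leRHS](mul0r (d/2)).
  by rewrite total_variationxx ltry.
have [yxd|dyx] := ltP (y - x) d.
  by rewrite (le_lt_trans (gd _ _ ax xy yb yxd)) ?ltry.
rewrite (@total_variationD _ _ _ (y - d / 2)); [|lra|lra].
rewrite lte_add_pinfty//.
  rewrite -natr1 in yn.
  apply: ih; [lra|lra|]. lra.
by rewrite (le_lt_trans (gd _ _ _ _ _ _)) ?ltry//; lra.
Qed.

(** The variation of [g] from [a]. *)
Let V x := fine (TV a x g).

Let VB x y : a <= x -> x <= y -> y <= b -> V y - V x = fine (TV x y g).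
Proof.
move=> ax xy yb; rewrite /V (total_variationD g ax xy) fineD ?TV_fin//.
- by rewrite addrC addKr.
- exact: le_trans yb.
Qed.

Let V_ge x y : a <= x -> x <= y -> y <= b -> `|g y - g x| <= V y - V x.
Proof.
move=> ax xy yb; rewrite VB// -lee_fin fineK ?TV_fin//.
exact: total_variation_ge.
Qed.

Let V_ac (e : R) : 0 < e -> exists2 d : R, 0 < d & forall a' b' l,
  subintervals a' b' l -> \sum_(p <- l) (p.2 - p.1) < d ->
  \sum_(p <- l) (V (clamp a b p.2) - V (clamp a b p.1)) <= e.
Proof.
move=> e0; have e20 : 0 < e / 2 by rewrite divr_gt0.
have [d d0 gd] := ac_subintervals gac e20; exists d => // a' b' l ll ld.
have l1 := clamp_subintervals (ltW ab) ll.
have l1d := le_lt_trans (clamp_seq_len (ltW ab) ll) ld.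
set l' := clamp_seq a b l in l1 l1d.
have /andP[/allP l'in _] := l1.
pose t := e / 2 / (size l').+1%:R.
have [|||l2 [l21 l22 l23]] := @subintervals_refine _ g t a b l'.
- move=> p /l'in/andP[/andP[h1 h2] h3].
  by rewrite -ge0_fin_numE ?total_variation_ge0// TV_fin.
- by rewrite divr_gt0.
- exact: l1.
have tl : t * (size l')%:R <= e / 2.
  by rewrite /t -mulrA ler_piMr ?(ltW e20)// mulrC ler_pdivrMr// mul1r ler_nat.
have : \sum_(p <- l2) `|g p.2 - g p.1| < e / 2.
  by apply: gd l21 _ => //; rewrite l22.
suff -> : \sum_(p <- l) (V (clamp a b p.2) - V (clamp a b p.1)) =
          \sum_(p <- l') fine (TV p.1 p.2 g) by lra.
rewrite [RHS]big_map big_seq [RHS]big_seq; apply: eq_bigr => p pl /=.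
have /andP[/allP/(_ p pl)/andP[/andP[_ pp] _] _] := ll.
have /andP[h1 _] := clamp_itv p.1 (ltW ab).
have /andP[_ h2] := clamp_itv p.2 (ltW ab).
by rewrite VB// clamp_homo.
Qed.

(** The fundamental theorem of calculus for absolutely continuous functions:
   [g] is the difference of the nondecreasing functions [V] and [V - g], which
   are absolutely continuous with [g]. *)
Lemma ac_density : exists h : R -> R,
  [/\ leb.-integrable setT (EFin \o h),
   forall x y, a <= x -> x <= y -> y <= b ->
     g y - g x = \int[leb]_(t in `]x, y]) h t &
   {ae leb, forall x, a < x < b -> derivable g x 1 /\ derive1 g x = h x}].
Proof.
have abW := ltW ab.
have Vin x : a <= clamp a b x <= b by exact: clamp_itv.
have clp x y : x <= y -> clamp a b x <= clamp a b y by exact: clamp_homo.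
have V_geC x y : x <= y -> `|g (clamp a b y) - g (clamp a b x)| <=
    V (clamp a b y) - V (clamp a b x).
  by move=> xy; apply: V_ge; [case/andP: (Vin x)|exact: clp|case/andP: (Vin y)].
pose F1 x := V (clamp a b x); pose F2 x := V (clamp a b x) - g (clamp a b x).
have [|||h1 [h1i h1E]] := @stieltjes_density R F1 a b _ _ _ V_ac.
- by move=> x y /V_geC xy; rewrite /F1 -subr_ge0; exact: le_trans xy.
- by move=> x xa; rewrite /F1 !clamp_le.
- by move=> x xb; rewrite /F1 !clamp_ge.
have [||||h2 [h2i h2E]] := @stieltjes_density R F2 a b.
- move=> x y /V_geC; rewrite /F2 ler_norml => /andP[_].
  by move: (V _) (V _) (g _) (g _) => *; lra.
- by move=> x xa; rewrite /F2 !clamp_le.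
- by move=> x xb; rewrite /F2 !clamp_ge.
- move=> e e0; have e20 : 0 < e / 2 by rewrite divr_gt0.
  have [d1 d10 Vd] := V_ac e20; have [d2 d20 gd] := ac_subintervals gac e20.
  exists (Num.min d1 d2) => [|a' b' l ll]; first by rewrite lt_min d10.
  rewrite lt_min => /andP[ld1 ld2].
  have := Vd _ _ _ ll ld1.
  have := gd _ _ _ abJ (clamp_subintervals abW ll)
    (le_lt_trans (clamp_seq_len abW ll) ld2).
  rewrite big_map/= => H1 H2.
  rewrite [leRHS]splitr; apply: le_trans (lerD H2 (ltW H1)).
  rewrite -big_split/= ler_sum// => p _; rewrite /F2.
  have := ler_norm (g (clamp a b p.1) - g (clamp a b p.2)); rewrite distrC.
  by move: (V _) (V _) (g _) (g _) => *; lra.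
pose h x := h1 x - h2 x.
have hint : leb.-integrable setT (EFin \o h).
  have -> : EFin \o h = ((EFin \o h1) \- (EFin \o h2))%E by apply/funext.
  by apply: integrableB => //; exact: measurableT.
pose G x := g (clamp a b x).
have GE x : G x = (F1 a - F2 a) + \int[leb]_(t in `]-oo, x]) h t.
  rewrite RintegralB//; [|by apply: integrableS h1i => //; exact: measurable_itv|
    by apply: integrableS h2i => //; exact: measurable_itv].
  have := h1E x; have := h2E x; rewrite {1}/F1 {1}/F2 /G.
  by move: (V _) (g _) => ? ?; lra.
exists h; split => //.
- move=> x y ax xy yb; rewrite -(density_increment hint GE)//.
  by rewrite /G !clamp_id// ?ax ?yb ?andbT ?(le_trans ax)// (le_trans xy).
- have := density_derivable hint GE.
  apply: filterS; first exact: (ae_filter_ringOfSetsType leb).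
  move=> x [dG Gx] /andP[ax xb].
  have Gg : {near x, G =1 g}.
    near=> y; rewrite /G clamp_id//; apply/andP; split; apply/ltW.
      by near: y; exact: lt_nbhsr.
    by near: y; exact: lt_nbhsl.
  split; first exact: near_eq_derivable Gg dG.
  by rewrite -Gx !derive1E; apply/esym/near_eq_derive.
Unshelve. all: by end_near. Qed.

End on_segment.
End density_of_absolutely_continuous.

(** * The distribution function of an atomless measure of full support *)

Section scale_theory.
Context {R : realType}.
Variable nu : {measure set (measurableTypeR R) -> \bar R}.
Hypothesis hnu : scrM nu.
Local Notation s := (scale nu).

Lemma scrM_segment x y : (nu `[x, y]%classic < +oo)%E.
Proof. by case: hnu => h _ _; apply: h; exact: segment_compact. Qed.

Lemma scrM_set1 x : nu [set x] = 0%E.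
Proof. by case: hnu. Qed.

Lemma scrM_itvcc x y : nu `[x, y]%classic = nu `]x, y]%classic.
Proof.
have [xy|yx] := leP x y; last first.
  by rewrite !set_itv_ge// bnd_simp -?ltNge// -leNgt ltW.
rewrite -(@setU1itv _ _ _ x false) ?bnd_simp//.
rewrite measureU//.
- by rewrite [X in (X + _)%E = _]scrM_set1 add0e.
- by apply/seteqP; split => // t [/= ->]; rewrite /= in_itv/= ltxx.
Qed.

Lemma scrM_itvoo x y : nu `]x, y[%classic = nu `]x, y]%classic.
Proof.
have [xy|yx] := ltP x y; last first.
  by rewrite !set_itv_ge// bnd_simp -leNgt.
rewrite -(@setUitv1 _ _ _ y true) ?bnd_simp//.
rewrite measureU//.
- by rewrite [X in _ = (_ + X)%E]scrM_set1 adde0.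
- by apply/seteqP; split => // t [/=] /[swap] ->; rewrite /= in_itv/= ltxx andbF.
Qed.

(** The mass of an interval; atomlessness makes its endpoints irrelevant. *)
Let M x y := fine (nu `]x, y]%classic).

Let M_fin x y : nu `]x, y]%classic \is a fin_num.
Proof. by rewrite -scrM_itvcc ge0_fin_numE ?scrM_segment. Qed.

Let M_add x y z : x <= y -> y <= z -> M x z = M x y + M y z.
Proof.
move=> xy yz; rewrite /M -fineD ?M_fin//.
rewrite -measureU//.
- congr (fine (nu _)); apply/seteqP; split => t /=; rewrite !in_itv/=.
    by move=> /andP[xt tz]; case: (leP t y) => ty; [left|right]; rewrite ?xt ?tz.
  move=> [/andP[-> /le_trans ->]//|/andP[yt ->]].
  by rewrite (le_lt_trans xy yt).
- apply/seteqP; split => // t []; rewrite /= !in_itv/= => /andP[_ ty] /andP[yt _].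
  by have := le_lt_trans ty yt; rewrite ltxx.
Qed.

Let scaleE x : s x = if 0 <= x then M 0 x else - M x 0.
Proof. by rewrite /scale /M !scrM_itvcc. Qed.

Lemma scale_itvoc x y : x <= y -> nu `]x, y]%classic = (s y - s x)%:E.
Proof.
move=> xy; rewrite -[LHS]fineK ?M_fin// -/(M x y) !scaleE; congr EFin.
case: (leP 0 x) => x0; case: (leP 0 y) => y0.
- by rewrite (M_add x0 xy); ring.
- by have := lt_le_trans y0 (le_trans x0 xy); rewrite ltxx.
- by rewrite (M_add (ltW x0) y0); ring.
- by rewrite (M_add xy (ltW y0)); ring.
Qed.

Lemma scale_itvcc x y : x <= y -> nu `[x, y]%classic = (s y - s x)%:E.
Proof. by move=> xy; rewrite scrM_itvcc scale_itvoc. Qed.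

Lemma scale_itvoo x y : x <= y -> nu `]x, y[%classic = (s y - s x)%:E.
Proof. by move=> xy; rewrite scrM_itvoo scale_itvoc. Qed.

Lemma scale0 : s 0 = 0.
Proof. by rewrite /scale lexx set_itv1 scrM_set1. Qed.

Lemma lt_scale x y : x < y -> s x < s y.
Proof.
move=> xy; rewrite -subr_gt0 -lte_fin -scale_itvoo ?ltW//.
case: hnu => _ + _; apply; first exact: interval_open.
by exists ((x + y) / 2); rewrite /= in_itv/= !midf_lt.
Qed.

Lemma le_scale x y : x <= y -> s x <= s y.
Proof. by rewrite le_eqVlt => /predU1P[->//|/lt_scale/ltW]. Qed.

Lemma scale_inj : injective s.
Proof.
move=> x y; case: (ltgtP x y) => // /lt_scale h e; move: h;
  by rewrite e ltxx.
Qed.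

Lemma continuous_scale : continuous s.
Proof.
suff H (x : R) : s z @[z --> x] --> s x by exact: H.
have [k [k0 kni ksmall]] : exists k : nat -> R, [/\ forall n, 0 < k n,
    forall i j, (i <= j)%N -> k j <= k i & forall e : R, 0 < e -> exists n, k n <= e].
  exists (fun n => n.+1%:R^-1); split => [n|i j ij|e e0].
  - by rewrite invr_gt0.
  - by rewrite lef_pV2 ?posrE// ler_nat.
  - exists (Num.bound e^-1); rewrite -[leRHS]invrK lef_pV2 ?posrE ?invr_gt0//.
    apply: (le_trans (ltW (archi_boundP _))); first by rewrite invr_ge0 ltW.
    by rewrite ler_nat.
pose A n : set R := `[x - k n, x + k n]%classic.
have mA n : measurable (A n : set (measurableTypeR R)) by exact: measurable_itv.
have AE : \bigcap_n A n = [set x].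
  apply/seteqP; split => [y Ay /=|y -> n _ /=]; last first.
    by rewrite /A /= in_itv/= gerDl oppr_le0 lerDl ltW//= k0.
  apply/eqP; rewrite -subr_eq0 -normr_le0; apply/ler_addgt0Pr => e e0; rewrite add0r.
  have [n ne] := ksmall _ e0; apply: le_trans ne.
  by have := Ay n I; rewrite /A /= in_itv/= ler_distl.
have cA : nu (A n) @[n --> \oo] --> 0%E.
  rewrite -(scrM_set1 x) -AE; apply: nonincreasing_cvg_mu => //.
  - by rewrite scrM_segment.
  - exact: bigcap_measurable.
  - move=> i j ij; apply/subsetPset => y; rewrite /A /= !in_itv/= => /andP[h1 h2].
    by have := kni _ _ ij; move=> h; apply/andP; split; lra.
apply/cvgrPdist_le => e e0.
have /fine_cvgP[_ /cvgrPdist_le/(_ _ e0)[N _ HN]] := cA.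
have sN : s (x + k N) - s (x - k N) <= e.
  have : `|0 - fine (nu (A N))| <= e := HN N (leqnn N).
  rewrite sub0r normrN => /(le_trans (ler_norm _)); rewrite /A scale_itvcc//.
  by rewrite (@le_trans _ _ x) ?gerDl ?lerDl ?oppr_le0 ?ltW.
near=> y.
have xy : `|x - y| <= k N.
  by near: y; apply: cvgr_dist_le => //; exact: cvg_id.
have : s (x - k N) <= s y by apply: le_scale; move: xy; rewrite ler_norml; lra.
have : s y <= s (x + k N) by apply: le_scale; move: xy; rewrite ler_norml; lra.
have : s (x - k N) <= s x by apply: le_scale; rewrite gerDl oppr_le0 ltW.
have : s x <= s (x + k N) by apply: le_scale; rewrite lerDl ltW.
by rewrite ler_norml => *; apply/andP; split; lra.
Unshelve. all: by end_near. Qed.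

Lemma scale_IVT x y t : x <= y -> s x <= t <= s y -> exists2 z, x <= z <= y & s z = t.
Proof.
move=> xy /andP[xt ty].
have [||z] := @IVT R s x y t xy; first exact/continuous_subspaceT/continuous_scale.
  by rewrite ge_min xt le_max ty orbT.
by rewrite in_itv/= => ? ?; exists z.
Qed.

End scale_theory.

(** * Integrals without measurability, and the change of variables by the scale *)

Section integral_without_measurability.
Context d (T : measurableType d) (R : realType).
Variable mu : {measure set T -> \bar R}.
Implicit Types (f g : T -> \bar R) (D E : set T).
Local Open Scope ereal_scope.
Import HBNNSimple.

(** Monotonicity needs no measurability, the integral of a nonnegative function
   being the supremum of the integrals of the simple functions below it. *)
Lemma ge0_le_lower_integral D f g : (forall x, D x -> 0 <= f x) ->
  (forall x, D x -> f x <= g x) ->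
  \int[mu]_(x in D) f x <= \int[mu]_(x in D) g x.
Proof.
move=> f0 fg; have g0 x : D x -> 0 <= g x.
  by move=> Dx; exact: le_trans (f0 _ Dx) (fg _ Dx).
rewrite !ge0_integralE//; apply: ereal_sup_le => _ [h /= hf <-].
exists h => //= x.
apply: (le_trans (hf x)); rewrite /patch; case: ifPn => // /set_mem Dx.
exact: fg.
Qed.

Lemma ereal_sup_addl (A B : set \bar R) c : A !=set0 -> B !=set0 ->
  (forall x, A x -> 0 <= x) -> (forall x, B x -> 0 <= x) ->
  (forall x y, A x -> B y -> x + y <= c) -> ereal_sup A + ereal_sup B <= c.
Proof.
move=> [x0 Ax0] [y0 By0] A0 B0 ABc.
have := le_trans (adde_ge0 (A0 _ Ax0) (B0 _ By0)) (ABc _ _ Ax0 By0).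
case: c ABc => [c| |]//; last by move=> *; rewrite leey.
move=> ABc c0.
have Af x : A x -> x \is a fin_num.
  move=> Ax; rewrite ge0_fin_numE ?A0//.
  by rewrite (le_lt_trans _ (ltry c))// (le_trans _ (ABc _ _ Ax By0))// leeDl// B0.
have supB x : A x -> ereal_sup B <= c%:E - x.
  by move=> Ax; apply: ge_ereal_sup => y By; rewrite leeBrDl ?Af//; exact: ABc.
have supBf : ereal_sup B \is a fin_num.
  rewrite ge0_fin_numE; last first.
    by rewrite (le_trans (B0 _ By0))// ereal_sup_ubound.
  by rewrite (le_lt_trans (supB _ Ax0))// lte_add_pinfty ?ltry// ltey_eq fin_numN Af.
rewrite -leeBrDr//; apply: ge_ereal_sup => x Ax.
by rewrite leeBrDr// addeC -leeBrDr ?Af// supB.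
Qed.

(** For the same reason the integral is superadditive with respect to the domain
   of integration. *)
Lemma ge0_integral_superadditive D E f : D `&` E = set0 ->
  (forall x, D x \/ E x -> 0 <= f x) ->
  \int[mu]_(x in D) f x + \int[mu]_(x in E) f x <=
  \int[mu]_(x in D `|` E) f x.
Proof.
move=> DE0 f0.
rewrite !ge0_integralE//; [|by move=> x Dx; apply: f0; auto..].
have ne (F : set T) : (forall x, F x -> 0 <= f x) ->
    [set sintegral mu h | h in
      [set h : {nnsfun T >-> R} | forall x, (h x)%:E <= (f \_ F) x]] !=set0.
  move=> F0; exists (sintegral mu (nnsfun0 : {nnsfun T >-> R})), nnsfun0 => //= x.
  by rewrite /patch; case: ifPn => // /set_mem/F0.
apply: ereal_sup_addl.
- by apply: ne => x Dx; apply: f0; left.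
- by apply: ne => x Dx; apply: f0; right.
- by move=> _ [h _ <-]; exact: sintegral_ge0.
- by move=> _ [h _ <-]; exact: sintegral_ge0.
move=> _ _ [h /= hD <-] [k /= kE <-].
rewrite -sintegralD; apply: ereal_sup_ubound.
exists (h \+ k)%R => //= x; move: (hD x) (kE x); rewrite /patch in_setU.
case: ifPn => [/set_mem Dx|_]; case: ifPn => [/set_mem Ex|_] /=.
- by move: (conj Dx Ex); rewrite -[_ /\ _]/((D `&` E) x) DE0.
- move=> h1 h2; rewrite EFinD -[leRHS]adde0; exact: leeD.
- move=> h1 h2; rewrite EFinD -[leRHS]add0e; exact: leeD.
- move=> h1 h2; rewrite EFinD -[leRHS]adde0; exact: leeD.
Qed.

End integral_without_measurability.

Section scale_pushforward.
Context {R : realType}.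
Variable nu : {measure set (measurableTypeR R) -> \bar R}.
Hypothesis hnu : scrM nu.
Local Notation s := (scale nu).
Local Notation leb := (@lebesgue_measure R).

Lemma measurable_scale : measurable_fun [set: measurableTypeR R]
  (s : measurableTypeR R -> measurableTypeR R).
Proof. by move=> mT Y mY; exact: (continuous_measurable_fun (continuous_scale hnu) mT mY). Qed.

Let push : {measure set (measurableTypeR R) -> \bar R}.
Proof.
pose p : {measure set (measurableTypeR R) -> \bar R} :=
  pushforward nu (s : measurableTypeR R -> measurableTypeR R).
exact: (p measurable_scale).
Defined.

(** The scale maps [nu] to the Lebesgue measure. *)
Lemma scale_preimage x y (A : set (measurableTypeR R)) : x <= y -> measurable A ->
  A `<=` `]s x, s y]%classic -> nu (s @^-1` A) = leb A.
Proof.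
move=> xy mA AD.
have mD : measurable (`]s x, s y]%classic : set (measurableTypeR R)).
  exact: measurable_itv.
(* The image of nu and the Lebesgue measure agree on the intervals between s x
   and s y only; rho, which is the Lebesgue measure elsewhere, agrees with it on
   all intervals. *)
pose rho := measure_add (mrestr push mD) (mrestr leb (measurableC mD)).
have key c d : s x <= c -> d <= s y -> push `]c, d]%classic = leb `]c, d]%classic.
  move=> xc dy; have [cd|dc] := leP c d; last first.
    by rewrite set_itv_ge ?bnd_simp -?leNgt ?ltW// /push !measure0.
  have [p /andP[xp py] sp] : exists2 z, x <= z <= y & s z = c.
    by apply: (scale_IVT hnu) => //; rewrite xc (le_trans cd).
  have [q /andP[xq qy] sq] : exists2 z, x <= z <= y & s z = d.
    by apply: (scale_IVT hnu) => //; rewrite dy (le_trans xc).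
  have pq : p <= q.
    by rewrite leNgt; apply/negP => /(lt_scale hnu); rewrite sp sq ltNge cd.
  have sE u v : (s u <= s v) = (u <= v).
    apply/idP/idP; last exact: (le_scale hnu).
    by apply: contra_leT; rewrite -ltNge => /(lt_scale hnu).
  have sL u v : (s u < s v) = (u < v) by rewrite !ltNge sE.
  transitivity (nu `]p, q]%classic).
    rewrite /push/= /pushforward/=; congr (nu _); apply/seteqP; split => t /=;
      by rewrite !in_itv/= -sp -sq sE sL.
  rewrite (scale_itvoc hnu)// [RHS]lebesgue_measure_itv/= lte_fin sp sq.
  case: ltP => // dc; rewrite (_ : c = d) ?subrr//.
  by apply/eqP; rewrite eq_le cd.
have rhoE : forall B, measurable B -> leb B = rho B.
  apply: lebesgue_measure_unique => _ [[c d] _ <-].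
  have mcd : measurable (`]c, d]%classic : set (measurableTypeR R)).
    exact: measurable_itv.
  rewrite /rho [RHS]measure_addE /mrestr.
  rewrite (measureDI _ mcd mD) addeC setDE; congr (_ + _).
  have cdE : `]c, d]%classic `&` `]s x, s y]%classic =
            `]Num.max c (s x), Num.min d (s y)]%classic.
    apply/seteqP; split => t; rewrite /= !in_itv/= gt_max le_min.
      by move=> [/andP[-> ->] /andP[-> ->]].
    by move=> /andP[/andP[-> ->] /andP[-> ->]].
  rewrite cdE -[RHS]/(push (`]c, d]%classic `&` `]s x, s y]%classic)) cdE.
  by rewrite key// ?le_max ?ge_min lexx orbT.
rewrite [RHS]rhoE// [RHS]measure_addE.
rewrite -[X in _ = (X + _)%E]/(nu (s @^-1` (A `&` `]s x, s y]%classic))).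
rewrite -[X in _ = (_ + X)%E]/(leb (A `&` ~` `]s x, s y]%classic)).
rewrite (setIidl AD) (_ : A `&` _ = set0) ?measure0 ?adde0//.
by apply/seteqP; split => // t [/AD].
Qed.

Lemma scale_integral x y (phi : R -> \bar R) : x <= y ->
  measurable_fun [set: measurableTypeR R] (phi : measurableTypeR R -> \bar R) ->
  (forall t, (0 <= phi t)%E) ->
  (\int[nu]_(z in `]x, y]) phi (s z) = \int[leb]_(t in `]s x, s y]) phi t)%E.
Proof.
move=> xy mphi phi0.
have mD : measurable (`]s x, s y]%classic : set (measurableTypeR R)).
  exact: measurable_itv.
rewrite [RHS](@eq_measure_integral _ _ _ _ push); last first.
  by move=> A mA AD; apply/esym; exact: (scale_preimage xy mA AD).
rewrite [RHS](@ge0_integral_pushforward _ _ _ _ _ _ measurable_scale)//; last first.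
  exact: measurable_funTS.
rewrite (_ : s @^-1` _ = `]x, y]%classic)//.
have sE u v : (s u <= s v) = (u <= v).
  apply/idP/idP; last exact: (le_scale hnu).
  by apply: contra_leT; rewrite -ltNge => /(lt_scale hnu).
have sL u v : (s u < s v) = (u < v) by rewrite !ltNge sE.
by apply/seteqP; split => t; rewrite /= !in_itv/= sE sL.
Qed.

End scale_pushforward.

(** * From absolute continuity to increments *)

Section energy_control.
Context {R : realType}.
Local Notation leb := (@lebesgue_measure R).

(** The Cauchy-Schwarz inequality for [h] and 1, from the integral of the square
   of [h - c], where [c] is the mean of [h]. *)
Lemma sqr_Rintegral_le (h : R -> R) (a b : R) : a < b ->
  leb.-integrable setT (EFin \o h) ->
  (((\int[leb]_(t in `]a, b]) h t) ^+ 2)%:E <=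
   (b - a)%:E * \int[leb]_(t in `]a, b]) (h t ^+ 2)%:E)%E.
Proof.
move=> ab hint; have ba0 : 0 < b - a by rewrite subr_gt0.
have mD : measurable (`]a, b]%classic : set (measurableTypeR R)).
  exact: measurable_itv.
have hD : leb.-integrable `]a, b]%classic (EFin \o h) by exact: integrableS hint.
have mh : measurable_fun (`]a, b]%classic : set (measurableTypeR R))
    (h : measurableTypeR R -> R).
  by case/integrableP : hD => /measurable_EFinP.
have h2_ge0 : (0 <= \int[leb]_(t in `]a, b]) (h t ^+ 2)%:E)%E.
  by apply: integral_ge0 => t _; rewrite lee_fin sqr_ge0.
have [h2y|] := eqVneq (\int[leb]_(t in `]a, b]) (h t ^+ 2)%:E)%E +oo%E.
  by rewrite h2y gt0_muley ?leey// lte_fin.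
rewrite -ltey => h2fin.
have h2int : leb.-integrable `]a, b]%classic (EFin \o (fun t => h t ^+ 2)).
  apply/integrableP; split.
    by apply/measurable_EFinP; exact: measurable_funX.
  by under eq_integral do rewrite /= ger0_norm ?sqr_ge0//.
have lebD : leb `]a, b]%classic = (b - a)%:E.
  by rewrite lebesgue_measure_itv/= lte_fin ab.
set I := \int[leb]_(t in `]a, b]) h t.
pose c := I / (b - a).
have cint (k : R) : leb.-integrable `]a, b]%classic (EFin \o cst k).
  apply/integrableP; split; first exact/measurable_EFinP/measurable_cst.
  by rewrite /= integral_cst// [X in (_ * X)%E]lebD ltry.
have chint : leb.-integrable `]a, b]%classic (EFin \o (fun t => (2 * c) * h t)).
  have -> : EFin \o (fun t => (2 * c) * h t) = (fun t => (2 * c)%R%:E * (EFin \o h) t)%E.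
    by apply/funext => t /=; rewrite EFinM.
  exact: integrableZl.
have kint : leb.-integrable `]a, b]%classic
    (EFin \o (fun t => (2 * c) * h t - cst (c ^+ 2) t)).
  have -> : EFin \o (fun t => (2 * c) * h t - cst (c ^+ 2) t) =
    ((EFin \o (fun t => (2 * c) * h t)%R) \- (EFin \o cst (c ^+ 2)%R))%E.
    by apply/funext.
  exact: integrableB.
have kE : \int[leb]_(t in `]a, b]) ((2 * c) * h t - cst (c ^+ 2) t) = I ^+ 2 / (b - a).
  rewrite RintegralB// RintegralZl// Rintegral_cst// -/I [X in fine X]lebD/= /c.
  by field; rewrite gt_eqF.
have : \int[leb]_(t in `]a, b]) ((2 * c) * h t - cst (c ^+ 2) t) <=
       \int[leb]_(t in `]a, b]) (h t ^+ 2).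
  apply: le_Rintegral => // t _ /=.
  by rewrite -subr_ge0 (_ : _ - _ = (h t - c) ^+ 2) ?sqr_ge0//; ring.
rewrite kE ler_pdivrMr// mulrC => le2.
rewrite -[X in (_ * X)%E]fineK; last by rewrite ge0_fin_numE.
by rewrite -EFinM lee_fin.
Qed.

Section control.
Variable nu : {measure set (measurableTypeR R) -> \bar R}.
Hypothesis hnu : scrM nu.
Local Notation s := (scale nu).

Lemma scale_segment_image (I : set R) x y : is_interval I -> I x -> I y -> x <= y ->
  `[s x, s y]%classic `<=` s @` I.
Proof.
move=> Iitv Ix Iy xy t; rewrite /= in_itv/= => st.
have [z xzy sz] := scale_IVT hnu xy st.
by exists z => //; apply: (Iitv x y).
Qed.

(** The inequality |f(y) - f(x)|^2 <= nu(]x, y]) \int_]x, y] (df/dnu)^2 dnu. *)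
Lemma factors_increment_le (I : set R) f g x y : is_interval I ->
  factors nu I f g -> I x -> I y -> x < y ->
  (((f y - f x) ^+ 2)%:E <=
   (s y - s x)%:E * \int[nu]_(z in `]x, y]) (derive1 g (s z) ^+ 2)%:E)%E.
Proof.
move=> Iitv [gac fg] Ix Iy xy; rewrite !fg//.
have sxy := lt_scale hnu xy.
have [h [hint hE hder]] :=
  ac_density gac sxy (scale_segment_image Iitv Ix Iy (ltW xy)).
rewrite (hE _ _ (lexx _) (ltW sxy) (lexx _)).
apply: (le_trans (sqr_Rintegral_le sxy hint)).
rewrite lee_pmul2l// ?lte_fin ?subr_gt0//.
have [N [mN N0 HN]] := hder.
(* Outside the null set N the derivative of g is the measurable function h; phi
   is a measurable minorant of the integrand that loses no mass. *)
pose B : set (measurableTypeR R) := `]s x, s y[%classic `\` N.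
have mB : measurable B by apply: measurableD => //; exact: measurable_itv.
have mh : measurable_fun [set: measurableTypeR R] (h : measurableTypeR R -> R).
  by case/integrableP : hint => /measurable_EFinP.
pose phi t : \bar R := ((fun t => (h t ^+ 2)%:E) \_ B) t.
have mphi : measurable_fun [set: measurableTypeR R] (phi : measurableTypeR R -> \bar R).
  apply: (iffLR (measurable_restrictT (fun t : measurableTypeR R => (h t ^+ 2)%:E) mB)).
  apply: measurable_funTS.
  by apply/measurable_EFinP; exact: measurable_funX.
have phi0 t : (0 <= phi t)%E.
  by rewrite /phi /patch; case: ifP => // _; rewrite lee_fin sqr_ge0.
apply: (@le_trans _ _ (\int[nu]_(z in `]x, y]) phi (s z))%E); last first.
  apply: ge0_le_lower_integral => // z _; rewrite /phi /patch.
  case: ifPn => [/set_mem[zxy Nz]|_]; last by rewrite lee_fin sqr_ge0.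
  have [_ ->] : derivable g (s z) 1 /\ derive1 g (s z) = h (s z).
    apply: contrapT => nd; apply: Nz; apply: HN => /= H; apply: nd; apply: H.
    by move: zxy; rewrite /= in_itv.
  exact: lexx.
rewrite (scale_integral hnu (ltW xy) mphi phi0).
rewrite le_eqVlt; apply/orP; left; apply/eqP.
apply: ae_eq_integral => //.
- by apply: measurable_funTS; apply/measurable_EFinP; exact: measurable_funX.
- exact: measurable_funTS.
- exists (N `|` [set s y]); split.
  + by apply: measurableU => //; exact: measurable_set1.
  + apply/eqP; rewrite eq_le measure_ge0 andbT.
    apply: (le_trans (measureU2 _ _ _)) => //.
    by rewrite [X in (X + _)%E]N0 [X in (_ + X)%E]lebesgue_measure_set1 adde0.
  + move=> t /= nt; apply: contrapT => /not_orP[Nt ty]; apply: nt.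
    rewrite in_itv/= => /andP[xt tsy]; rewrite /phi /patch mem_set//.
    split => //=; rewrite in_itv/= xt/= lt_neqAle tsy andbT.
    exact/eqP.
Qed.

(** The increments of [f] on [I] obey the Cauchy-Schwarz inequality with respect
   to those of [s] and [Q]; the typical [Q] is the integral of the square of
   df/dnu over the part of [I] to the left of a point. *)
Definition controlled (I : set R) (f Q : R -> R) := forall x y, I x -> I y -> x <= y ->
  (f y - f x) ^+ 2 <= (s y - s x) * (Q y - Q x).

(** The integrand is not known to be measurable, so that [Q] is only
   superadditive; this is the direction that is used. *)
Lemma factors_controlled (I : set R) f g : is_interval I -> factors nu I f g ->
  (\int[nu]_(z in I) (derive1 g (s z) ^+ 2)%:E < +oo)%E ->
  exists2 Q : R -> R, controlled I f Q & forall x, I x ->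
    0 <= Q x <= fine (\int[nu]_(z in I) (derive1 g (s z) ^+ 2)%:E).
Proof.
move=> Iitv fg Efin; set E := (\int[nu]_(z in I) _)%E in Efin *.
pose q (D : set R) := (\int[nu]_(z in D) (derive1 g (s z) ^+ 2)%:E)%E.
have q0 D : (0 <= q D)%E by apply: integral_ge0 => z _; rewrite lee_fin sqr_ge0.
have qU D D' : D `&` D' = set0 -> (q D + q D' <= q (D `|` D'))%E.
  move=> DD'; apply: ge0_integral_superadditive => // x _.
  by rewrite lee_fin sqr_ge0.
pose J x := I `&` `]-oo, x]%classic.
have JE x : I = J x `|` (I `&` `]x, +oo[%classic).
  rewrite /J -setIUr (_ : _ `|` _ = setT) ?setIT//.
  by rewrite -subTset => t _ /=; rewrite !in_itv/= andbT; case: leP; [left|right].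
have JD x : J x `&` (I `&` `]x, +oo[%classic) = set0.
  apply/seteqP; split => // t [[_ /=]] + [_ /=]; rewrite !in_itv/= andbT.
  by move=> tx /(le_lt_trans tx); rewrite ltxx.
have qE x : (q (J x) <= E)%E.
  rewrite /E -/(q I) (JE x); apply: le_trans (qU _ _ (JD x)); first exact: leeDl.
have qf x : q (J x) \is a fin_num by rewrite ge0_fin_numE// (le_lt_trans (qE x)).
have Ef : E \is a fin_num by rewrite ge0_fin_numE//; exact: (q0 I).
exists (fun x => fine (q (J x))) => [x y Ix Iy|x Ix]; last first.
  by rewrite fine_ge0//= fine_le.
rewrite le_eqVlt => /predU1P[->|xy]; first by rewrite !subrr expr0n mul0r.
rewrite -lee_fin; apply: (le_trans (factors_increment_le Iitv fg Ix Iy xy)).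
have Jxy : J y = J x `|` `]x, y]%classic.
  apply/seteqP; split => t; rewrite /J /= !in_itv/=.
    by move=> [It ty]; case: (leP t x) => xt; [left|right; rewrite ty].
  move=> [[It tx]|/andP[xt ty]]; first by split => //; exact: le_trans tx (ltW xy).
  by split => //; apply: (Iitv x y) => //; rewrite ty (ltW xt).
have Dxy : J x `&` `]x, y]%classic = set0.
  apply/seteqP; split => // t [[_ /=]]; rewrite !in_itv/= => tx /andP[xt _].
  by have := le_lt_trans tx xt; rewrite ltxx.
rewrite EFinM lee_pmul2l// ?lte_fin ?subr_gt0 ?(lt_scale hnu)//.
by rewrite EFinB !fineK// leeBrDl// Jxy; exact: qU.
Qed.

End control.
End energy_control.

(** * From increments to absolute continuity *)

Section limn_einf_esup.
Context {R : realType}.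
Implicit Types (u : (\bar R)^nat) (l : \bar R).
Local Open Scope ereal_scope.

Lemma limn_einf_ge u l N : (forall n, (N <= n)%N -> l <= u n) -> l <= limn_einf u.
Proof.
move=> ul; rewrite limn_einf_lim; apply: lime_ge; first exact: is_cvg_einfs.
exists N => // n /= Nn; apply: le_ereal_inf_tmp => _ [k /= nk <-].
exact: ul (leq_trans Nn nk).
Qed.

Lemma limn_einf_le u l : (forall N, exists2 n, (N <= n)%N & u n <= l) -> limn_einf u <= l.
Proof.
move=> ul; rewrite limn_einf_lim; apply: lime_le; first exact: is_cvg_einfs.
apply: nearW => N; have [n Nn un] := ul N; apply: le_trans un.
by apply: ereal_inf_lbound; exists n.
Qed.

Lemma limn_esup_le u l N : (forall n, (N <= n)%N -> u n <= l) -> limn_esup u <= l.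
Proof.
move=> ul; rewrite -leeN2 -limn_einfN; apply: (@limn_einf_ge _ _ N) => n Nn /=.
by rewrite leeN2 ul.
Qed.

Lemma limn_einf_lt u l : limn_einf u < l -> forall N, exists2 n, (N <= n)%N & u n < l.
Proof.
move=> ul N; apply: contrapT => H; move: ul; rewrite ltNge; apply/negP; rewrite negbK.
apply: (@limn_einf_ge _ _ N) => n Nn; rewrite leNgt; apply/negP => un.
by apply: H; exists n.
Qed.

End limn_einf_esup.

Section difference_quotients.
Context {R : realType}.

(** Where a function is not derivable its derivative has the default value 0. *)
Lemma derive1_default (g : R -> R) t : ~ derivable g t 1 -> derive1 g t = 0.
Proof. by move=> nd; rewrite derive1E /derive dvgP. Qed.

(** At a point of differentiability, the slopes over intervals that contain the
   point tend to the derivative. *)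
Lemma derive1_straddle (g : R -> R) (t : R) : derivable g t 1 ->
  forall e : R, 0 < e -> exists2 d : R, 0 < d & forall p q,
    p <= t -> t <= q -> p < q -> t - p < d -> q - t < d ->
    `|(g q - g p) / (q - p) - derive1 g t| <= e.
Proof.
move=> dg e e0.
have : h^-1 *: (g (h + t) - g t) @[h --> 0^'] --> derive1 g t.
  have -> : (fun h : R => h^-1 *: (g (h + t) - g t)) =
            (fun h : R => h^-1 *: (g (h *: 1 + t) - g t)).
    by apply/funext => h; rewrite [h *: 1]mulr1.
  by rewrite derive1E; exact: dg.
move=> /cvgrPdist_le/(_ _ e0)[d /= d0 Hd]; exists d => // p q pt tq pq tpd qtd.
have H h : `|h| < d -> `|g (h + t) - g t - derive1 g t * h| <= e * `|h|.
  move=> hd; have [->|h0] := eqVneq h 0.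
    by rewrite add0r subrr mulr0 subr0 normr0 mulr0.
  have Hh : `|derive1 g t - h^-1 * (g (h + t) - g t)| <= e.
    by apply: Hd => //=; rewrite sub0r normrN.
  rewrite (_ : _ - _ = - ((derive1 g t - h^-1 * (g (h + t) - g t)) * h)); last by field.
  by rewrite normrN normrM ler_wpM2r.
have q0 : 0 < q - p by rewrite subr_gt0.
have -> : (g q - g p) / (q - p) - derive1 g t =
  ((g q - g t - derive1 g t * (q - t)) - (g p - g t - derive1 g t * (p - t))) / (q - p).
  by field; rewrite gt_eqF.
rewrite normrM normfV (gtr0_norm q0) ler_pdivrMr//.
have Hq : `|g q - g t - derive1 g t * (q - t)| <= e * (q - t).
  have := H (q - t); rewrite subrK ger0_norm ?subr_ge0//; exact.
have Hp : `|g p - g t - derive1 g t * (p - t)| <= e * (t - p).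
  by have := H (p - t); rewrite subrK distrC ger0_norm ?subr_ge0//; exact.
apply: (le_trans (ler_normB _ _)); apply: (le_trans (lerD Hq Hp)).
by rewrite -mulrDr subrKA.
Qed.

End difference_quotients.

Section bounded_energy.
Context {R : realType}.
Variable nu : {measure set (measurableTypeR R) -> \bar R}.
Hypothesis hnu : scrM nu.
Local Notation s := (scale nu).

(** A bound on the integral over the interval [I] of the square of df/dnu, in
   terms of increments only, so that it passes to pointwise limits.  Degenerate
   intervals contribute 0 to the sum, as 0 / 0 = 0. *)
Definition energy_bounded (I : set R) (f : R -> R) (C : R) : Prop :=
  forall (n : nat) (a b : nat -> R),
    (forall i, (i < n)%N -> [/\ a i <= b i, I (a i) & I (b i)]) ->
    trivIset `I_n (fun i => `]a i, b i[%classic) ->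
    \sum_(i < n) (f (b i) - f (a i)) ^+ 2 / (s (b i) - s (a i)) <= C.

Lemma energy_bounded_ge0 I f C : energy_bounded I f C -> 0 <= C.
Proof.
move=> /(_ 0 (fun=> 0) (fun=> 0)); rewrite big_ord0; apply => //.
Qed.

(** [f] factors through a right inverse [pre] of the scale on [I]. *)
Lemma energy_bounded_factors I f C : energy_bounded I f C -> ac_wrt nu I f.
Proof.
move=> IfC; have C0 := energy_bounded_ge0 IfC.
pose pre t := xget 0 [set x | I x /\ s x = t].
have preE t : (s @` I) t -> I (pre t) /\ s (pre t) = t.
  by move=> [x Ix sx]; rewrite /pre; case: xgetP => [y _ //|/(_ x)[]].
exists (f \o pre); split; last first.
  move=> x Ix /=; have [Ip sp] : I (pre (s x)) /\ s (pre (s x)) = s x.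
    by apply: preE; exists x.
  by rewrite (scale_inj hnu sp).
move=> e e0; pose th := e / (2 * (C + 1)).
have C1 : 0 < 2 * (C + 1) by rewrite mulr_gt0// ltr_wpDl.
have th0 : 0 < th by rewrite divr_gt0.
exists (2 * th * e) => [|n A B AB tAB ABd]; first by apply: mulr_gt0 => //; apply: mulr_gt0.
pose a i := if (i < n)%N then pre (A i) else 0.
pose b i := if (i < n)%N then pre (B i) else 0.
have abI i : (i < n)%N -> [/\ a i <= b i, I (a i) & I (b i)].
  move=> i_n; have [ABi /preE[Ia sa] /preE[Ib sb]] := AB i i_n.
  rewrite /a /b i_n; split => //.
  by rewrite leNgt; apply/negP => /(lt_scale hnu); rewrite sa sb ltNge ABi.
have sab i : (i < n)%N -> s (a i) = A i /\ s (b i) = B i.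
  by move=> i_n; have [_ /preE[_ sa] /preE[_ sb]] := AB i i_n; rewrite /a /b i_n.
have tab : trivIset `I_n (fun i => `]a i, b i[%classic).
  move=> i j i_n j_n [x [xi xj]]; apply: (tAB i j) => //; exists (s x).
  have [sai sbi] := sab i i_n; have [saj sbj] := sab j j_n.
  move: xi xj; rewrite /= !in_itv/= -sai -sbi -saj -sbj.
  by move=> /andP[h1 h2] /andP[h3 h4]; split; rewrite !(lt_scale hnu).
have {}IfC := IfC n a b abI tab.
(* With D = |f (b i) - f (a i)| and S = s (b i) - s (a i), the inequality of
   the arithmetic and geometric means reads D <= th * (D ^+ 2 / S) + S / (4 * th). *)
apply: (@le_lt_trans _ _ (\sum_(i < n) (th * ((f (b i) - f (a i)) ^+ 2 / (s (b i) - s (a i)))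
    + (4 * th)^-1 * (B i - A i)))).
  apply: ler_sum => i _ /=.
  have [sai sbi] := sab i (ltn_ord i); have [abi Iai Ibi] := abI i (ltn_ord i).
  have -> : pre (B i) = b i by rewrite /b ltn_ord.
  have -> : pre (A i) = a i by rewrite /a ltn_ord.
  rewrite -sai -sbi.
  move: abi; rewrite le_eqVlt => /predU1P[->|/(lt_scale hnu)].
    by rewrite !subrr normr0 expr0n mul0r !mulr0 addr0.
  rewrite -subr_gt0 -[in X in th * X]real_normK ?num_real//.
  set D := `|_|; set S := s _ - s _ => S0.
  rewrite -subr_ge0 (_ : _ - _ = (2 * th * D - S) ^+ 2 / (4 * th * S)).
    apply: divr_ge0; first exact: sqr_ge0.
    by apply: mulr_ge0; [apply: mulr_ge0 => //|]; exact: ltW.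
  by field; rewrite !gt_eqF.
rewrite big_split/= -!mulr_sumr.
have h1 : th * (\sum_(i < n) (f (b i) - f (a i)) ^+ 2 / (s (b i) - s (a i))) <= e / 2.
  apply: (@le_trans _ _ (th * (C + 1))).
    by rewrite ler_pM2l// (le_trans IfC)// lerDl.
  by rewrite /th le_eqVlt; apply/orP; left; apply/eqP; field; rewrite gt_eqF// ltr_wpDl.
have h2 : (4 * th)^-1 * (\sum_(i < n) (B i - A i)) < e / 2.
  have th4 : 0 < 4 * th by apply: mulr_gt0.
  by rewrite ltr_pdivrMl// (_ : 4 * th * (e / 2) = 2 * th * e)//; field.
by rewrite [ltRHS]splitr; exact: ler_ltD.
Qed.

(** A point of [I] smaller than [n] in absolute value lies in a dyadic interval of
   length [2 ^- n] whose endpoints belong to [I]. *)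
Definition dyadic_adapted (I : set R) := forall (n : nat) x, I x -> `|x| < n%:R ->
  exists k, [/\ (k < 2 * n * 2 ^ n)%N, I (dyadic n k), I (dyadic n k.+1) &
    dyadic n k <= x <= dyadic n k.+1].

(** Fatou's lemma, applied to the squared slopes of [g] over the dyadic intervals. *)
Lemma energy_bounded_integral I f g C : dyadic_adapted I -> I 0 ->
  energy_bounded I f C -> factors nu I f g ->
  (\int[nu]_(z in I) (derive1 g (s z) ^+ 2)%:E <= C%:E)%E.
Proof.
move=> Idy I0 IfC [_ fg].
pose K n := (2 * n * 2 ^ n)%N.
pose inI n k := `[< I (dyadic n k) /\ I (dyadic n k.+1) >].
(* Dyadic intervals with an endpoint outside I are replaced by [0, 0]. *)
pose a n k : R := if inI n k then dyadic n k else 0.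
pose b n k : R := if inI n k then dyadic n k.+1 else 0.
pose w n k : R := ((f (b n k) - f (a n k)) / (s (b n k) - s (a n k))) ^+ 2.
pose A n k : set (measurableTypeR R) := `[a n k, b n k]%classic.
pose Phi n (x : measurableTypeR R) : \bar R :=
  (\sum_(k < K n) (w n k)%:E * (\1_(A n k) x)%:E)%E.
have w0 n k : 0 <= w n k by exact: sqr_ge0.
have mA n k : measurable (A n k) by exact: measurable_itv.
have ind0 n k x : (0 <= (\1_(A n k) x : R)%:E)%E by rewrite lee_fin.
have mterm n k : measurable_fun [set: measurableTypeR R]
    (fun x => (w n k)%:E * (\1_(A n k) x)%:E)%E.
  by apply: measurable_funeM; apply/measurable_EFinP; exact: measurable_indic.
have mPhi n : measurable_fun [set: measurableTypeR R] (Phi n).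
  by apply: emeasurable_sum => k; exact: mterm.
have Phi0 n x : (0 <= Phi n x)%E by apply: sume_ge0 => k _; rewrite mule_ge0// lee_fin.
have abI n k : [/\ a n k <= b n k, I (a n k) & I (b n k)].
  rewrite /a /b /inI; case: asboolP => [[? ?]|_]; split => //.
  exact/ltW/lt_dyadicS.
have Phi_int n : (\int[nu]_x Phi n x <= C%:E)%E.
  rewrite /Phi ge0_integral_sum//; last by move=> k x _; rewrite mule_ge0// lee_fin.
  rewrite (eq_bigr (fun k : 'I_(K n) =>
     ((f (b n k) - f (a n k)) ^+ 2 / (s (b n k) - s (a n k)))%:E)).
    rewrite sumEFin lee_fin; apply: IfC => [i _|]; first exact: abI.
    move=> i j _ _ [x [/= xi xj]]; move: xi xj; rewrite /a /b.
    case: (inI n i); case: (inI n j); rewrite !in_itv/=;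
      do ?[by move=> _ /andP[x0 x1]; move: (lt_trans x0 x1); rewrite ltxx
          |by move=> /andP[x0 x1]; move: (lt_trans x0 x1); rewrite ltxx].
    move=> /andP[i1 i2] /andP[j1 j2]; apply/eqP; rewrite eqn_leq.
    apply/andP; split; rewrite leqNgt; apply/negP => /(@le_dyadic R n).
      by move=> /(lt_le_trans j2)/(lt_trans i1); rewrite ltxx.
    by move=> /(lt_le_trans i2)/(lt_trans j1); rewrite ltxx.
  move=> k _; rewrite ge0_integralZl//; [|by apply/measurable_EFinP; exact: measurable_indic|by rewrite lee_fin].
  rewrite integral_indic// setIT.
  have [abk _ _] := abI n k.
  rewrite /A (scale_itvcc hnu)// -EFinM; congr EFin; rewrite /w.
  have [->|sba] := eqVneq (s (b n k) - s (a n k)) 0; first by rewrite !invr0 !mulr0.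
  by field.
have lim_ge x : (((fun z => (derive1 g (s z) ^+ 2)%:E) \_ I) x <=
     limn_einf (Phi ^~ x))%E.
  rewrite /patch; case: ifPn => [/set_mem Ix|_]; last first.
    by apply: (@limn_einf_ge _ _ _ 0%N) => n _; exact: Phi0.
  have [dg|ndg] := pselect (derivable g (s x) 1); last first.
    rewrite derive1_default// expr0n.
    by apply: (@limn_einf_ge _ _ _ 0%N) => n _; exact: Phi0.
  set d := derive1 g (s x).
  apply/lee_addgt0Pr => e e0.
  pose e' := e / (2 * `|d| + 1).
  have d1 : 0 < 2 * `|d| + 1 by rewrite ltr_wpDl// mulr_ge0.
  have e'0 : 0 < e' by rewrite divr_gt0.
  have [r r0 Hr] := derive1_straddle dg e'0.
  have /cvgrPdist_lt/(_ _ r0)[q /= q0 Hq] := continuous_scale hnu (x := x).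
  have [N1 HN1] := dyadic_small q0.
  pose N := maxn N1 (Num.bound `|x|).
  rewrite -leeBlDr//; apply: (@limn_einf_ge _ _ _ N) => n Nn.
  have xn : `|x| < n%:R.
    apply: (lt_le_trans (archi_boundP _)) => //.
    by rewrite ler_nat (leq_trans _ Nn)// /N leq_maxr.
  have [k [kK Ik Ik1 /andP[kx xk]]] := Idy n x Ix xn.
  have nq : dyadic n k.+1 - dyadic n k < q.
    by rewrite dyadicS addrC addKr; apply: HN1; rewrite (leq_trans _ Nn)// /N leq_maxl.
  have ink : inI n k by apply/asboolP.
  apply: (@le_trans _ _ (w n k)%:E); last first.
    rewrite /Phi (bigD1 (Ordinal kK))//= indicE mem_set; last first.
      by rewrite /A /a /b ink /= in_itv/= kx xk.
    rewrite mule1 leeDl//; apply: sume_ge0 => j _.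
    by rewrite mule_ge0// lee_fin.
  rewrite -EFinB lee_fin /w /a /b ink !fg//.
  have := Hr (s (dyadic n k)) (s (dyadic n k.+1)) (le_scale hnu kx) (le_scale hnu xk)
    (lt_scale hnu (lt_dyadicS _ _)).
  have /(_ _) H1 := Hq (dyadic n k); have /(_ _) H2 := Hq (dyadic n k.+1).
  rewrite -/d => H; have {H} : `|(g (s (dyadic n k.+1)) - g (s (dyadic n k))) /
       (s (dyadic n k.+1) - s (dyadic n k)) - d| <= e'.
    apply: H.
      apply: (le_lt_trans (ler_norm _)); apply: H1.
      by rewrite /ball/= ger0_norm ?subr_ge0//; move: nq kx xk; lra.
    apply: (le_lt_trans (ler_norm _)); rewrite distrC; apply: H2.
    by rewrite /ball/= distrC ger0_norm ?subr_ge0//; move: nq kx xk; lra.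
  move: (_ / _) => t td.
  rewrite -subr_ge0 (_ : _ - _ = (t - d) ^+ 2 + (2 * d * (t - d) + e)); last by ring.
  rewrite addr_ge0 ?sqr_ge0// addrC -lerBlDr sub0r.
  have : `|2 * d * (t - d)| <= 2 * `|d| * e'.
    by rewrite !normrM ger0_norm// ler_wpM2l// mulr_ge0.
  have : 2 * `|d| * e' <= e.
    rewrite /e' mulrA ler_pdivrMr// mulrDr mulr1 (mulrC _ e) lerDl ltW//.
  by move=> h1 h2; apply: le_trans h1; apply: le_trans h2; rewrite -normrN ler_norm.
rewrite integral_mkcond.
apply: (@le_trans _ _ (\int[nu]_x limn_einf (Phi ^~ x))%E).
  apply: ge0_le_lower_integral => // x _.
  by rewrite /patch; case: ifP => // _; rewrite lee_fin sqr_ge0.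
apply: (le_trans (fatou _ _ _ _)) => //.
by apply: limn_einf_le => N; exists N.
Qed.

Lemma dyadic_adapted_setT : dyadic_adapted setT.
Proof.
move=> n x _; rewrite ltr_norml => /andP[nx xn].
have [||k [/andP[_ kn] kx xk]] := @cell_co R (dyadic n) 0 (2 * n * 2 ^ n) x (leq0n _).
- by rewrite dyadic0 ltW.
- by rewrite dyadic_last.
by exists k; rewrite kx (ltW xk).
Qed.

Lemma dyadic_adapted_Gpos : dyadic_adapted Gpos.
Proof.
move=> n x; rewrite /Gpos /= in_itv/= andbT ltr_norml => x0 /andP[nx xn].
have [|||k [/andP[nk kn] kx xk]] := @cell_co R (dyadic n) (n * 2 ^ n) (2 * n * 2 ^ n) x.
- by rewrite leq_mul2r leq_pmull ?orbT.
- by rewrite dyadic_mid.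
- by rewrite dyadic_last.
exists k; rewrite kx (ltW xk) kn /= !in_itv/= !andbT -(dyadic_mid n).
by rewrite !le_dyadic// (leq_trans nk).
Qed.

Lemma dyadic_adapted_Gneg : dyadic_adapted Gneg.
Proof.
move=> n x; rewrite /Gneg /= in_itv/= ltr_norml => x0 /andP[nx xn].
have [||k [/andP[nk kn] kx xk]] := @cell_oc R (dyadic n) 0 (n * 2 ^ n) x (leq0n _).
- by rewrite dyadic0.
- by rewrite dyadic_mid.
exists k; rewrite (ltW kx) xk /= !in_itv/= -(dyadic_mid n).
split => //; last exact: le_dyadic; last by rewrite le_dyadic// ltnW.
by rewrite (leq_trans kn)// leq_mul2r leq_pmull ?orbT.
Qed.

End bounded_energy.

(** * Gluing, and versions of elements of L^2 *)

Section increments.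
Context {R : realType}.

(** The sum of the increments of a nondecreasing function over disjoint intervals
   is at most its total increment. *)
Lemma disjoint_increments_le (Q : R -> R) (n : nat) (a b : nat -> R) (lo hi : R) :
  lo <= hi ->
  (forall x y, lo <= x -> x <= y -> y <= hi -> Q x <= Q y) ->
  (forall i, (i < n)%N -> [/\ lo <= a i, a i <= b i & b i <= hi]) ->
  trivIset `I_n (fun i => `]a i, b i[%classic) ->
  \sum_(i < n) (Q (b i) - Q (a i)) <= Q hi - Q lo.
Proof.
elim: n a b lo hi => [|n ih] a b lo hi lohi Qnd ab tab.
  by rewrite big_ord0 subr_ge0 Qnd.
have [loa le_ab bhi] := ab n (ltnSn n).
have tab' : trivIset `I_n (fun i => `]a i, b i[%classic).
  by move=> i j i_n j_n; apply: tab; exact: ltnW.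
have ab' i : (i < n)%N -> [/\ lo <= a i, a i <= b i & b i <= hi].
  by move=> i_n; apply: ab; exact: ltnW.
rewrite big_ord_recr/=; move: le_ab; rewrite le_eqVlt => /predU1P[->|abn].
  by rewrite subrr addr0; exact: ih.
(* Each of the other intervals is degenerate or lies on one side of the interval
   numbered n; the induction hypothesis is used on both sides of it. *)
have split_i i : (i < n)%N -> [\/ a i = b i, b i <= a n | b n <= a i].
  move=> i_n; have [_ + _] := ab' i i_n; rewrite le_eqVlt => /predU1P[->|abi].
    by constructor 1.
  have [|anbi] := leP (b i) (a n); first by constructor 2.
  have [|aibn] := leP (b n) (a i); first by constructor 3.
  pose x := (Num.max (a i) (a n) + Num.min (b i) (b n)) / 2.
  have mm : Num.max (a i) (a n) < Num.min (b i) (b n).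
    by rewrite gt_max !lt_min abi aibn anbi abn.
  have /andP[] : (Num.max (a i) (a n) < x) && (x < Num.min (b i) (b n)).
    by rewrite /x !midf_lt.
  rewrite gt_max lt_min => /andP[x1 x2] /andP[x3 x4].
  have : i = n.
    apply: tab => /=; [exact: ltnW|by []|].
    by exists x; rewrite /= !in_itv/= x1 x2 x3 x4.
  by move=> ien; move: i_n; rewrite ien ltnn.
pose al i := Num.min (a i) (a n); pose bl i := Num.min (b i) (a n).
pose ar i := Num.max (a i) (b n); pose br i := Num.max (b i) (b n).
have Hl : \sum_(i < n) (Q (bl i) - Q (al i)) <= Q (a n) - Q lo.
  apply: ih => //.
  - by move=> x y lox xy yan; rewrite Qnd// (le_trans yan)// (le_trans (ltW abn)).
  - move=> i /ab'[loi abi bihi]; rewrite /al /bl; split.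
    + by rewrite le_min loi.
    + by rewrite le_min !ge_min abi lexx orbT.
    + by rewrite ge_min lexx orbT.
  - move=> i j i_n j_n [x [xi xj]]; apply: tab' => //; exists x.
    move: xi xj; rewrite /al /bl /= !in_itv/= !gt_min !lt_min.
    move=> /andP[h1 /andP[h2 h3]] /andP[h4 /andP[h5 _]]; rewrite h2 h5 !andbT.
    have h6 : (a n < x) = false by rewrite ltNge (ltW h3).
    by move: h1 h4; rewrite h6 !orbF.
have Hr : \sum_(i < n) (Q (br i) - Q (ar i)) <= Q hi - Q (b n).
  apply: ih => //.
  - by move=> x y bx xy yhi; rewrite Qnd// (le_trans _ bx)// (le_trans loa)// ltW.
  - move=> i /ab'[loi abi bihi]; rewrite /ar /br; split.
    + by rewrite le_max lexx orbT.
    + by rewrite ge_max !le_max abi lexx orbT.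
    + by rewrite ge_max bihi.
  - move=> i j i_n j_n [x [xi xj]]; apply: tab' => //; exists x.
    move: xi xj; rewrite /ar /br /= !in_itv/= !gt_max !lt_max.
    move=> /andP[/andP[h1 h2] h3] /andP[/andP[h4 _] h5]; rewrite h1 h4 /=.
    have h6 : (x < b n) = false by rewrite ltNge (ltW h2).
    by move: h3 h5; rewrite h6 !orbF.
have : \sum_(i < n) (Q (b i) - Q (a i)) <=
    \sum_(i < n) (Q (bl i) - Q (al i)) + \sum_(i < n) (Q (br i) - Q (ar i)).
  rewrite -big_split/=; apply: ler_sum => i _; rewrite /al /bl /ar /br.
  have [_ abi _] := ab' i (ltn_ord i).
  have [->|bia|bai] := split_i i (ltn_ord i); first by rewrite !subrr addr0.
  - have aia := le_trans abi bia; have bib := le_trans bia (ltW abn).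
    by rewrite !min_l// !max_r ?subrr ?addr0// (le_trans abi).
  - have bb := le_trans bai abi; have anai := le_trans (ltW abn) bai.
    by rewrite !min_r ?subrr ?add0r ?max_l// (le_trans anai).
by move: Hl Hr; lra.
Qed.

(** The Cauchy-Schwarz inequality
   (A1 B1)^1/2 + (A2 B2)^1/2 <= ((A1 + A2) (B1 + B2))^1/2. *)
Lemma sqr_add_le (a b A1 B1 A2 B2 : R) : 0 <= A1 -> 0 <= B1 -> 0 <= A2 -> 0 <= B2 ->
  a ^+ 2 <= A1 * B1 -> b ^+ 2 <= A2 * B2 ->
  (a + b) ^+ 2 <= (A1 + A2) * (B1 + B2).
Proof.
move=> A10 B10 A20 B20 aAB bAB.
have uv0 : 0 <= A1 * B2 + A2 * B1 by rewrite addr_ge0// mulr_ge0.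
have : 2 * (a * b) <= A1 * B2 + A2 * B1.
  rewrite leNgt; apply/negP => h.
  have : (A1 * B2 + A2 * B1) ^+ 2 < (2 * (a * b)) ^+ 2 by rewrite ltr_pXn2r ?nnegrE// ltW// (le_lt_trans uv0).
  have : (a * b) ^+ 2 <= (A1 * B1) * (A2 * B2).
    by rewrite exprMn ler_pM ?sqr_ge0.
  have : 0 <= (A1 * B2 - A2 * B1) ^+ 2 by exact: sqr_ge0.
  by lra.
by move: aAB bAB; lra.
Qed.

End increments.

Section controlled_theory.
Context {R : realType}.
Variable nu : {measure set (measurableTypeR R) -> \bar R}.
Hypothesis hnu : scrM nu.
Local Notation s := (scale nu).

Lemma controlled_nondecreasing I f Q x y : controlled nu I f Q ->
  I x -> I y -> x <= y -> Q x <= Q y.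
Proof.
move=> fQ Ix Iy; rewrite le_eqVlt => /predU1P[->//|xy].
have := le_trans (sqr_ge0 _) (fQ x y Ix Iy (ltW xy)).
by rewrite pmulr_rge0 ?subr_ge0// subr_gt0 (lt_scale hnu).
Qed.

Lemma controlled_term I f Q x y : controlled nu I f Q -> I x -> I y -> x <= y ->
  (f y - f x) ^+ 2 / (s y - s x) <= Q y - Q x.
Proof.
move=> fQ Ix Iy; rewrite le_eqVlt => /predU1P[->|xy].
  by rewrite !subrr expr0n mul0r.
by rewrite ler_pdivrMr ?subr_gt0 ?(lt_scale hnu)// mulrC fQ// ltW.
Qed.

Lemma controlled_energy_bounded I f Q C x0 : is_interval I -> I x0 ->
  controlled nu I f Q -> (forall x y, I x -> I y -> x <= y -> Q y - Q x <= C) ->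
  energy_bounded nu I f C.
Proof.
move=> Iitv Ix0 fQ QC n a b ab tab.
have [lo [hi [Ilo Ihi lohi ablh]]] : exists lo hi, [/\ I lo, I hi, lo <= hi &
    forall i, (i < n)%N -> [/\ lo <= a i, a i <= b i & b i <= hi]].
  elim: n ab {tab} => [|n ih] ab; first by exists x0, x0; split.
  have [i i_n|lo [hi [Ilo Ihi lohi ablh]]] := ih.
    by apply: ab; exact: ltnW.
  have [abn Ian Ibn] := ab n (ltnSn n).
  exists (Num.min lo (a n)), (Num.max hi (b n)); split.
  - by rewrite /Num.min; case: ifP.
  - by rewrite /Num.max; case: ifP.
  - by rewrite ge_min le_max lohi.
  - move=> i; rewrite ltnS leq_eqVlt => /predU1P[->|/ablh[loi abi bihi]].
      by rewrite ge_min le_max !lexx !orbT.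
    by rewrite ge_min le_max loi bihi.
apply: (@le_trans _ _ (Q hi - Q lo)); last exact: QC.
apply: (@le_trans _ _ (\sum_(i < n) (Q (b i) - Q (a i)))).
  apply: ler_sum => i _; have [abi Iai Ibi] := ab i (ltn_ord i).
  exact: controlled_term fQ _ _ _.
apply: (@disjoint_increments_le _ Q n a b lo hi) => // x y lox xy yhi.
apply: (controlled_nondecreasing fQ) => //.
  by apply: (Iitv lo hi) => //; rewrite lox (le_trans xy).
by apply: (Iitv lo hi) => //; rewrite yhi (le_trans lox).
Qed.

Lemma controlled_trans (f Q : R -> R) x y z : x <= y -> y <= z -> Q x <= Q y -> Q y <= Q z ->
  (f y - f x) ^+ 2 <= (s y - s x) * (Q y - Q x) ->
  (f z - f y) ^+ 2 <= (s z - s y) * (Q z - Q y) ->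
  (f z - f x) ^+ 2 <= (s z - s x) * (Q z - Q x).
Proof.
move=> xy yz Qxy Qyz fxy fyz.
have -> : f z - f x = (f y - f x) + (f z - f y) by ring.
have -> : s z - s x = (s y - s x) + (s z - s y) by ring.
have -> : Q z - Q x = (Q y - Q x) + (Q z - Q y) by ring.
by apply: sqr_add_le => //; rewrite subr_ge0// (le_scale hnu).
Qed.

Lemma controlled_glue (I : set R) (a : R) (f Q : R -> R) : I a ->
  controlled nu (I `&` [set x | x <= a]) f Q ->
  controlled nu (I `&` [set x | a <= x]) f Q -> controlled nu I f Q.
Proof.
move=> Ia fl fr x y Ix Iy xy.
have [ya|/ltW ay] := leP y a; first by apply: fl => //; split => //=; exact: le_trans ya.
have [ax|/ltW xa] := leP a x; first by apply: fr => //; split => //=; exact: le_trans xy.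
have lx : (I `&` [set x | x <= a]) x by [].
have la : (I `&` [set x | x <= a]) a by split => /=.
have ra : (I `&` [set x | a <= x]) a by split => /=.
have ry : (I `&` [set x | a <= x]) y by [].
apply: (controlled_trans xa ay); [| |exact: fl|exact: fr].
  exact: (controlled_nondecreasing fl).
exact: (controlled_nondecreasing fr).
Qed.

Lemma controlled_osc (f Q : R -> R) (C : R) : controlled nu setT f Q ->
  (forall x y : R, x <= y -> Q y - Q x <= C) ->
  forall x y : R, (f y - f x) ^+ 2 <= C * `|s y - s x|.
Proof.
move=> fQ QC x y.
have key (u v : R) : u <= v -> (f v - f u) ^+ 2 <= C * `|s v - s u|.
  move=> uv; apply: (le_trans (fQ _ _ _ _ uv)) => //.
  rewrite mulrC ger0_norm ?subr_ge0 ?(le_scale hnu)//.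
  by rewrite ler_wpM2r ?subr_ge0 ?(le_scale hnu)// QC.
have [xy|yx] := leP x y; first exact: key.
by rewrite distrC -sqrrN opprB; apply: key; exact: ltW.
Qed.

(** An interval that contains the origin in its interior is cut there; by the
   Cauchy-Schwarz inequality this can only increase the sum. *)
Lemma energy_bounded_glue f Cp Cm : energy_bounded nu Gpos f Cp ->
  energy_bounded nu Gneg f Cm -> energy_bounded nu setT f (Cp + Cm).
Proof.
move=> fp fm n a b ab tab.
pose ap i := Num.max (a i) 0; pose bp i := Num.max (b i) 0.
pose am i := Num.min (a i) 0; pose bm i := Num.min (b i) 0.
have abE i : (i < n)%N -> a i <= b i by move=> /ab[].
have {}fp := fp n ap bp; have {}fm := fm n am bm.
have mx x y : x <= y -> Num.max x 0 <= Num.max y 0 :> R.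
  by move=> xy; rewrite ge_max !le_max xy lexx orbT.
have mn x y : x <= y -> Num.min x 0 <= Num.min y 0 :> R.
  by move=> xy; rewrite le_min !ge_min xy lexx orbT.
apply: (@le_trans _ _ (\sum_(i < n) (f (bp i) - f (ap i)) ^+ 2 / (s (bp i) - s (ap i)) +
    \sum_(i < n) (f (bm i) - f (am i)) ^+ 2 / (s (bm i) - s (am i)))); last first.
  apply: lerD; [apply: fp|apply: fm].
  - move=> i /abE abi; rewrite /Gpos /= !in_itv/= !andbT /ap /bp.
    by rewrite mx// !le_max lexx !orbT.
  - move=> i j i_n j_n [x [xi xj]]; apply: tab => //; exists x.
    move: xi xj; rewrite /ap /bp /= !in_itv/= !gt_max !lt_max.
    move=> /andP[/andP[h1 h2] h3] /andP[/andP[h4 _] h5]; rewrite h1 h4 /=.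
    have h6 : (x < 0) = false by rewrite ltNge (ltW h2).
    by move: h3 h5; rewrite h6 !orbF.
  - move=> i /abE abi; rewrite /Gneg /= !in_itv/= /am /bm.
    by rewrite mn// !ge_min lexx !orbT.
  - move=> i j i_n j_n [x [xi xj]]; apply: tab => //; exists x.
    move: xi xj; rewrite /am /bm /= !in_itv/= !gt_min !lt_min.
    move=> /andP[h1 /andP[h2 h3]] /andP[h4 /andP[h5 _]]; rewrite h2 h5 !andbT.
    have h6 : (0 < x) = false by rewrite ltNge (ltW h3).
    by move: h1 h4; rewrite h6 !orbF.
rewrite -big_split/=; apply: ler_sum => i _.
have abi := abE i (ltn_ord i); rewrite /ap /bp /am /bm.
have /orP[a0|a0] : (0 <= a i) || (a i < 0) by case: leP.
  have b0 := le_trans a0 abi.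
  by rewrite !max_l// !min_r// !subrr expr0n mul0r addr0.
have /orP[b0|b0] : (b i <= 0) || (0 < b i) by case: leP.
  by rewrite (min_l b0) (max_r b0) (min_l (ltW a0)) (max_r (ltW a0)) !subrr expr0n mul0r add0r.
rewrite (min_r (ltW b0)) (max_l (ltW b0)) (min_l (ltW a0)) (max_r (ltW a0)).
have sa := lt_scale hnu a0; have sb := lt_scale hnu b0.
have -> : f (b i) - f (a i) = (f (b i) - f 0) + (f 0 - f (a i)) by ring.
have -> : s (b i) - s (a i) = (s (b i) - s 0) + (s 0 - s (a i)) by ring.
move: sa sb; rewrite -subr_gt0 -[s 0 < _]subr_gt0.
move: (s _ - s _) (s _ - s _) (f _ - f _) (f _ - f _) => A B u v A0 B0.
have E (w D : R) : 0 < D -> w <= D * (w / D).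
  by move=> D0; rewrite mulrCA mulfV ?gt_eqF// mulr1.
rewrite ler_pdivrMr ?addr_gt0// [leRHS]mulrC.
by apply: sqr_add_le; rewrite ?E ?divr_ge0 ?sqr_ge0// ?ltW.
Qed.

Lemma ac_wrt_continuous I f x : ac_wrt nu I f -> I x -> forall e : R, 0 < e ->
  exists2 d : R, 0 < d & forall y, I y -> `|y - x| < d -> `|f y - f x| < e.
Proof.
move=> [g [gac fg]] Ix e /gac[d d0 Hd].
have /cvgrPdist_lt/(_ _ d0)[r /= r0 Hr] := continuous_scale hnu (x := x).
exists r => // y Iy yxr; rewrite !fg//.
have sd : `|s x - s y| < d by apply: Hr; rewrite /ball/= distrC.
have key u v : I u -> I v -> u <= v -> `|s v - s u| < d -> `|g (s v) - g (s u)| < e.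
  move=> Iu Iv uv svu; have := Hd 1%N (fun=> s u) (fun=> s v).
  rewrite !big_ord1; apply.
  - by move=> _ _; split; [exact: (le_scale hnu)|exists u|exists v].
  - by move=> [|i] [|j].
  - exact: le_lt_trans (ler_norm _) svu.
have [xy|yx] := leP x y; first by apply: key => //; rewrite distrC.
by rewrite distrC; apply: key => //; exact: ltW.
Qed.

End controlled_theory.

Section versions.
Context {R : realType}.
Variables (m nu : {measure set (measurableTypeR R) -> \bar R}).
Hypotheses (hm : scrM m) (hnu : scrM nu).
Implicit Types (u : L2 m) (f : R -> R).

(** Each point of [I] is approached from within the interior of [I]: continuous
   functions on [I] that agree almost everywhere on it agree on it. *)
Definition regular_set (I : set R) := forall x (d : R), I x -> 0 < d ->
  exists U : set R, [/\ open U, U !=set0, U `<=` I & forall y, U y -> `|y - x| < d].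

Lemma regular_setT : regular_set setT.
Proof.
move=> x d _ d0; exists (ball x d); split => //.
- exact: ball_open.
- by exists x; exact: ballxx.
- by move=> y; rewrite /ball/= distrC.
Qed.

Lemma regular_Gpos : regular_set Gpos.
Proof.
move=> x d; rewrite /Gpos /= in_itv/= andbT => x0 d0.
exists `]x, x + d[%classic; split.
- exact: interval_open.
- by exists (x + d / 2); rewrite /= in_itv/=; apply/andP; split; lra.
- by move=> y; rewrite /= !in_itv/= andbT => /andP[/ltW/(le_trans x0)].
- by move=> y /=; rewrite in_itv/= => /andP[xy yd]; rewrite ltr_norml; apply/andP; split; lra.
Qed.

Lemma regular_Gneg : regular_set Gneg.
Proof.
move=> x d; rewrite /Gneg /= in_itv/= => x0 d0.
exists `]x - d, x[%classic; split.
- exact: interval_open.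
- by exists (x - d / 2); rewrite /= in_itv/=; apply/andP; split; lra.
- by move=> y; rewrite /= !in_itv/= => /andP[_ /ltW/le_trans]; apply.
- by move=> y /=; rewrite in_itv/= => /andP[xy yd]; rewrite ltr_norml; apply/andP; split; lra.
Qed.

Lemma ac_version_unique I u f f' : regular_set I -> ac_version nu I u f ->
  ac_version nu I u f' -> forall x, I x -> f x = f' x.
Proof.
move=> Ireg [uf fac] [uf' f'ac] x Ix.
apply/eqP; rewrite -subr_eq0 -normr_le0; apply/ler_addgt0Pr => e e0; rewrite add0r.
have e20 : 0 < e / 2 by rewrite divr_gt0.
have [d d0 Hd] := ac_wrt_continuous hnu fac Ix e20.
have [d' d'0 Hd'] := ac_wrt_continuous hnu f'ac Ix e20.
have dd0 : 0 < Num.min d d' by rewrite lt_min d0.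
have [U [oU U0 UI Ud]] := Ireg x _ Ix dd0.
have [y Uy [h1 h2]] : exists2 y, U y & (I y -> u y = f y) /\ (I y -> u y = f' y).
  apply: contrapT => H.
  have [N [mN N0 HN]] := uf; have [N' [mN' N'0 HN']] := uf'.
  have UN : U `<=` N `|` N'.
    move=> y Uy; apply: contrapT => /not_orP[yN yN']; apply: H; exists y => //.
    by split; apply: contrapT => /= ?; [apply: yN; exact: HN|apply: yN'; exact: HN'].
  have [_ /(_ _ oU U0) + _] := hm; apply/negP; rewrite -leNgt.
  have mU : measurable (U : set (measurableTypeR R)) by exact: open_measurable.
  apply: (@le_trans _ _ (m (N `|` N'))).
    by apply: le_measure; rewrite ?inE//; exact: measurableU.
  by rewrite (null_set_setU mN mN' N0 N'0).
have Iy := UI _ Uy.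
have := Ud _ Uy; rewrite lt_min => /andP[/(Hd _ Iy) fy /(Hd' _ Iy) f'y].
have fE : f y = f' y by rewrite -h1// h2.
have -> : f x - f' x = (f' y - f' x) - (f y - f x) by rewrite fE; ring.
by rewrite (le_trans (ler_normB _ _))// [leRHS]splitr lerD// ltW.
Qed.

Lemma versionP I u f : ac_version nu I u f -> ac_version nu I u (version nu I u).
Proof. by move=> uf; rewrite /version; exact: (getPex (ex_intro _ f uf)). Qed.

Lemma versionE I u f : regular_set I -> ac_version nu I u f ->
  forall x, I x -> version nu I u x = f x.
Proof. by move=> Ireg uf; apply: (ac_version_unique Ireg _ uf); exact: versionP uf. Qed.

Lemma eq_dwrt I f f' : (forall x, I x -> f x = f' x) -> dwrt nu I f = dwrt nu I f'.
Proof.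
move=> ff'; apply/funext => x; rewrite /dwrt.
suff -> : factors nu I f = factors nu I f' by [].
apply/funext => g; apply/propext; split => -[gac fg]; split => // y Iy.
  by rewrite -ff'// fg.
by rewrite ff'// fg.
Qed.

Lemma energy_versionE I u f : regular_set I -> ac_version nu I u f ->
  energy nu I (version nu I u) (version nu I u) =
  2^-1 * fine (\int[nu]_(x in I) (dwrt nu I f x ^+ 2)%:E)%E.
Proof.
move=> Ireg uf; rewrite /energy (eq_dwrt (versionE Ireg uf)) /Rintegral.
by under eq_integral do rewrite -expr2.
Qed.

Lemma version_controlled I u f : is_interval I -> regular_set I ->
  ac_version nu I u f -> finite_energy nu I f ->
  exists2 Q, controlled nu I f Q & forall x, I x ->
    0 <= Q x <= 2 * energy nu I (version nu I u) (version nu I u).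
Proof.
move=> Iitv Ireg uf ffin; rewrite (energy_versionE Ireg uf) mulVKf//.
have [_ [g fg]] := uf.
have fg' : factors nu I f (get (factors nu I f)) by exact: (getPex (ex_intro _ g fg)).
exact: (factors_controlled hnu Iitv fg').
Qed.

Lemma energy_bounded_version I u f C : dyadic_adapted I -> I 0 -> regular_set I ->
  {ae m, forall x, I x -> u x = f x} -> energy_bounded nu I f C ->
  [/\ ac_version nu I u f, finite_energy nu I f &
   energy nu I (version nu I u) (version nu I u) <= C / 2].
Proof.
move=> Idy I0 Ireg uf fC.
have fac := energy_bounded_factors hnu fC.
have ufac : ac_version nu I u f by [].
have [g fg] := fac.
have fg' : factors nu I f (get (factors nu I f)) by exact: (getPex (ex_intro _ g fg)).
have fint := energy_bounded_integral hnu Idy I0 fC fg'.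
split => //; first by rewrite /finite_energy (le_lt_trans fint)// ltry.
rewrite (energy_versionE Ireg ufac) mulrC ler_pM2r//.
rewrite -lee_fin fineK// ge0_fin_numE; first by rewrite (le_lt_trans fint)// ltry.
by apply: integral_ge0 => x _; rewrite lee_fin sqr_ge0.
Qed.

End versions.

(** * The regularized measures *)

Section Tshift_theory.
Context {R : realType}.
Implicit Types e x y z : R.

Lemma Tshift_cases e (z : R) : (0 <= z /\ (Tshift e z : R) = z + e) \/
  (z < 0 /\ (Tshift e z : R) = z - e).
Proof. by rewrite /Tshift; case: (leP 0 z); [left|right]. Qed.

Lemma Tshift_pos e (x y z : R) : 0 < e -> 0 <= x ->
  (x + e < (Tshift e z : R) <= y + e) = (x < z <= y).
Proof.
move=> e0; have H : z < 0 -> 0 <= x -> (x + e < z - e <= y + e) = (x < z <= y).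
  by move=> z0 x0; apply/idP/idP => /andP[h1 h2]; apply/andP; split; lra.
move=> x0; have [[z0 ->]|[z0 ->]] := Tshift_cases e z; last exact: H.
by rewrite ltrD2r lerD2r.
Qed.

Lemma Tshift_neg e (x y z : R) : 0 < e -> y <= 0 ->
  (x - e < (Tshift e z : R) < y - e) = (x < z < y).
Proof.
move=> e0; have H : 0 <= z -> y <= 0 -> (x - e < z + e < y - e) = (x < z < y).
  by move=> z0 x0; apply/idP/idP => /andP[h1 h2]; apply/andP; split; lra.
move=> y0; have [[z0 ->]|[z0 ->]] := Tshift_cases e z; first exact: H.
by rewrite !ltrD2r.
Qed.

Lemma Tshift_mid e (z : R) : 0 < e -> (- e < (Tshift e z : R) < e) = false.
Proof.
move=> e0; have H1 : 0 <= z -> (- e < z + e < e) = false.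
  by move=> z0; apply/negbTE/negP => /andP[h1 h2]; lra.
have H2 : z < 0 -> (- e < z - e < e) = false.
  by move=> z0; apply/negbTE/negP => /andP[h1 h2]; lra.
by have [[z0 ->]|[z0 ->]] := Tshift_cases e z; [exact: H1|exact: H2].
Qed.

Lemma Tshift_ge0 e (z : R) : 0 < e -> (0 <= (Tshift e z : R)) = (0 <= z).
Proof.
move=> e0; have H1 : 0 <= z -> (0 <= z + e) = (0 <= z) by move=> z0; apply/idP/idP; lra.
have H2 : z < 0 -> (0 <= z - e) = (0 <= z) by move=> z0; apply/idP/idP; lra.
by have [[z0 ->]|[z0 ->]] := Tshift_cases e z; [exact: H1|exact: H2].
Qed.

Lemma Tshift_le0 e (z : R) : 0 < e -> ((Tshift e z : R) <= 0) = (z < 0).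
Proof.
move=> e0; have H1 : 0 <= z -> (z + e <= 0) = (z < 0) by move=> z0; apply/idP/idP; lra.
have H2 : z < 0 -> (z - e <= 0) = (z < 0) by move=> z0; apply/idP/idP; lra.
by have [[z0 ->]|[z0 ->]] := Tshift_cases e z; [exact: H1|exact: H2].
Qed.

Lemma Tshift_preimage_pos e x y : 0 < e -> 0 <= x -> Tshift e @^-1` `]x + e, y + e]%classic = `]x, y]%classic.
Proof.
by move=> e0 x0; apply/seteqP; split => z; rewrite /= !in_itv/= Tshift_pos.
Qed.

Lemma Tshift_preimage_neg e x y : 0 < e -> y <= 0 -> Tshift e @^-1` `]x - e, y - e[%classic = `]x, y[%classic.
Proof.
by move=> e0 x0; apply/seteqP; split => z; rewrite /= !in_itv/= Tshift_neg.
Qed.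

Lemma Tshift_preimage_mid e : 0 < e -> Tshift e @^-1` `]- e, e[%classic = set0.
Proof. move=> e0; by apply/seteqP; split => // z; rewrite /= in_itv/= Tshift_mid. Qed.

End Tshift_theory.

Section regularized_theory.
Context {R : realType}.
Variables (lambda gamma : {measure set (measurableTypeR R) -> \bar R}) (e : R).
Hypothesis hl : scrM lambda.
Hypothesis hg : finite_full_atomless_on `]- e, e[%classic gamma.
Local Notation L := (regularized e lambda gamma).

Lemma regularizedE (A : set (measurableTypeR R)) :
  L A = (lambda (Tshift e @^-1` A) + gamma A)%E.
Proof. exact: measure_addE. Qed.

Lemma gamma_outside (A : set (measurableTypeR R)) : measurable A ->
  A `<=` ~` `]- e, e[%classic -> gamma A = 0%E.
Proof.
move=> mA AI; case: hg => g0 _ _ _; apply: subset_measure0 g0 => //.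
by apply: measurableC; exact: measurable_itv.
Qed.

Lemma gamma_finite : (gamma setT < +oo)%E.
Proof.
case: hg => g0 gI _ _.
rewrite -(setvU (`]- e, e[%classic : set (measurableTypeR R))) measureU//.
- by rewrite [X in (X + _)%E]g0 add0e.
- by apply: measurableC; exact: measurable_itv.
- exact: setICl.
Qed.

Lemma regularized_scrM : 0 < e -> scrM L.
Proof.
move=> e0.
have mT (A : set (measurableTypeR R)) : measurable A ->
    measurable (Tshift e @^-1` A : set (measurableTypeR R)).
  by move=> mA; rewrite -(setTI (_ @^-1` _)); exact: measurable_Tshift.
have mI : measurable (`]- e, e[%classic : set (measurableTypeR R)).
  exact: measurable_itv.
split.
- move=> K Kc.
  have [M [_ HM]] := compact_bounded Kc.
  have mK : measurable (K : set (measurableTypeR R)) by exact: compact_measurable.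
  pose r := M + 1 + e.
  have KM x : K x -> `|x| <= M + 1 by apply: HM; rewrite ltrDl.
  rewrite regularizedE lte_add_pinfty//.
    apply: (@le_lt_trans _ _ (lambda `[- r, r]%classic)); last exact: scrM_segment.
    apply: le_measure; rewrite ?inE; [exact: mT|exact: measurable_itv|].
    move=> z /= /KM; rewrite ler_norml /Tshift in_itv/= /r.
    by case: (leP 0 z) => /= z0 /andP[h1 h2]; apply/andP; split; lra.
  apply: le_lt_trans gamma_finite; apply: le_measure; rewrite ?inE//.
- move=> U oU U0; rewrite regularizedE.
  have mU : measurable (U : set (measurableTypeR R)) by exact: open_measurable.
  have [[x [Ux xI]]|UI] := pselect (U `&` `]- e, e[%classic !=set0).
    apply: (@lt_le_trans _ _ (gamma U)); last by rewrite leeDr.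
    case: hg => _ _ /(_ (U `&` `]- e, e[%classic)) h _.
    apply: (@lt_le_trans _ _ (gamma (U `&` `]- e, e[%classic))).
      apply: h; [apply: openI => //; exact: interval_open|exact: subIsetr|by exists x].
    by apply: le_measure; rewrite ?inE//; exact: measurableI.
  have [x Ux] := U0.
  have [y Uy xe] : exists2 y, U y & e < y \/ y < - e.
    have xI : ~ `]- e, e[%classic x by move=> xI; apply: UI; exists x.
    have /nbhs_ballP[r /= r0 rU] : nbhs x U by exact: open_nbhs_nbhs.
    have {xI} : x <= - e \/ e <= x.
      case: (leP x (- e)) => h; first by left.
      by case: (leP e x) => h'; [right|exfalso; apply: xI; rewrite /= in_itv/= h h'].
    move=> [xe|ex].
      exists (x - r / 2); last by right; lra.
      by apply: rU; rewrite /ball/= opprB addrC subrK ger0_norm; lra.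
    exists (x + r / 2); last by left; lra.
    by apply: rU; rewrite /ball/= opprD addrA subrr add0r normrN ger0_norm; lra.
  have /nbhs_ballP[r /= r0 rU] : nbhs y U by exact: open_nbhs_nbhs.
  apply: (@lt_le_trans _ _ (lambda (Tshift e @^-1` U))); last by rewrite leeDl.
  case: hl => _ hop _; case: xe => [ey|ye].
    apply: (@lt_le_trans _ _ (lambda `]Num.max 0 (y - e - r), y - e + r[%classic)).
      apply: hop; first exact: interval_open.
      exists (y - e); rewrite /= in_itv/= gt_max; apply/andP; split; last by lra.
      by apply/andP; split; lra.
    apply: le_measure; rewrite ?inE; [exact: measurable_itv|exact: mT|].
    move=> z; rewrite /= in_itv/= gt_max => /andP[/andP[z0 h1] h2].
    rewrite /Tshift (ltW z0); apply: rU; rewrite /ball/= ltr_norml.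
    by apply/andP; split; lra.
  apply: (@lt_le_trans _ _ (lambda `]y + e - r, Num.min 0 (y + e + r)[%classic)).
    apply: hop; first exact: interval_open.
    exists (y + e); rewrite /= in_itv/= lt_min; apply/andP; split; first by lra.
    by apply/andP; split; lra.
  apply: le_measure; rewrite ?inE; [exact: measurable_itv|exact: mT|].
  move=> z; rewrite /= in_itv/= lt_min => /andP[h1 /andP[z0 h2]].
  rewrite /Tshift leNgt z0 /=; apply: rU; rewrite /ball/= ltr_norml.
  by apply/andP; split; lra.
- move=> x; rewrite regularizedE; case: hg => _ _ _ ->; rewrite adde0.
  have [x0|x0] := leP 0 x.
    apply/eqP; rewrite eq_le measure_ge0 andbT.
    rewrite -(scrM_set1 hl (x - e)); apply: le_measure; rewrite ?inE.
    + by apply: mT; exact: measurable_set1.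
    + exact: measurable_set1.
    + by move=> z /=; have [[z0 ->]|[z0 ->]] := Tshift_cases e z => h; lra.
  apply/eqP; rewrite eq_le measure_ge0 andbT.
  rewrite -(scrM_set1 hl (x + e)); apply: le_measure; rewrite ?inE.
  + by apply: mT; exact: measurable_set1.
  + exact: measurable_set1.
  + by move=> z /=; have [[z0 ->]|[z0 ->]] := Tshift_cases e z => h; lra.
Qed.

Lemma regularized_scale_pos (x y : R) : 0 < e -> 0 <= x -> x <= y ->
  scale L (y + e) - scale L (x + e) = scale lambda y - scale lambda x.
Proof.
move=> e0 x0 xy; have hL := regularized_scrM e0; apply: EFin_inj.
rewrite -(scale_itvoc hL) ?lerD2r// regularizedE Tshift_preimage_pos//.
rewrite gamma_outside ?adde0 ?(scale_itvoc hl)//.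
move=> z; rewrite /= !in_itv/= => /andP[h1 h2] /andP[h3 h4].
by have : x + e < e := lt_trans h1 h4; lra.
Qed.

Lemma regularized_scale_neg (x y : R) : 0 < e -> y <= 0 -> x <= y ->
  scale L (y - e) - scale L (x - e) = scale lambda y - scale lambda x.
Proof.
move=> e0 x0 xy; have hL := regularized_scrM e0; apply: EFin_inj.
rewrite -(scale_itvoo hL) ?lerD2r// regularizedE Tshift_preimage_neg//.
rewrite gamma_outside ?adde0 ?(scale_itvoo hl)//.
move=> z; rewrite /= !in_itv/= => /andP[h1 h2] /andP[h3 h4].
by have : - e < y - e := lt_trans h3 h2; lra.
Qed.

Lemma regularized_scale_mid : 0 < e ->
  (scale L e - scale L (- e))%:E = gamma `]- e, e[%classic.
Proof.
move=> e0; have hL := regularized_scrM e0; rewrite -(scale_itvoo hL); last by lra.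
by rewrite regularizedE (Tshift_preimage_mid e0) measure0 add0e.
Qed.

Lemma regularized_Gpos : 0 < e -> (L Gpos < +oo)%E = (lambda Gpos < +oo)%E.
Proof.
move=> e0; have -> : L Gpos = (lambda Gpos + gamma Gpos)%E.
  rewrite regularizedE; congr (lambda _ + _)%E.
  by apply/seteqP; split => z; rewrite /Gpos /= !in_itv/= !andbT (Tshift_ge0 _ e0).
have gf : (gamma Gpos < +oo)%E.
  by apply: le_lt_trans gamma_finite; apply: le_measure; rewrite ?inE//; exact: measurable_itv.
apply/idP/idP => h; last by rewrite lte_add_pinfty.
by apply: le_lt_trans h; rewrite leeDl.
Qed.

Lemma regularized_Gneg : 0 < e -> (L Gneg < +oo)%E = (lambda Gneg < +oo)%E.
Proof.
move=> e0; have lE : lambda Gneg = lambda `]-oo, (0 : R)[%classic.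
  have -> : Gneg = `]-oo, (0 : R)[%classic `|` [set (0 : R)].
    by apply/seteqP; split => z; rewrite /Gneg /= !in_itv/= le_eqVlt;
      [move=> /predU1P[->|]; [right|left]|move=> [->|->]; rewrite ?eqxx ?orbT].
  rewrite measureU//.
  - by rewrite [X in (_ + X)%E](scrM_set1 hl) adde0.
  - by apply/seteqP; split => // z [/=]; rewrite in_itv/= => /[swap] ->; rewrite ltxx.
have -> : L Gneg = (lambda `]-oo, (0 : R)%R[%classic + gamma Gneg)%E.
  rewrite regularizedE; congr (lambda _ + _)%E.
  by apply/seteqP; split => z; rewrite /Gneg /= !in_itv/= (Tshift_le0 _ e0).
have gf : (gamma Gneg < +oo)%E.
  by apply: le_lt_trans gamma_finite; apply: le_measure; rewrite ?inE//; exact: measurable_itv.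
rewrite lE; apply/idP/idP => h; last by rewrite lte_add_pinfty.
by apply: le_lt_trans h; rewrite leeDl.
Qed.

End regularized_theory.

(** * Weak convergence in L^2 *)

Section weak_convergence.
Context {R : realType}.
Variable m : {measure set (measurableTypeR R) -> \bar R}.
Local Notation borelR := (measurableTypeR R).
Implicit Types (B E : set borelR) (u v : L2 m).

Lemma Lnorm2_sqr (g : borelR -> R) :
  ('N[m]_2%:E[EFin \o g] `^ 2 = \int[m]_x (g x ^+ 2)%:E)%E.
Proof.
rewrite powR_Lnorm//; apply: eq_integral => x _ /=.
by rewrite powR_mulrn// real_normK// num_real.
Qed.

Lemma L2_mem (g : borelR -> R) : measurable_fun setT g ->
  (\int[m]_x (g x ^+ 2)%:E < +oo)%E -> g \in Lfun m 2%:E.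
Proof.
move=> mg gfin; rewrite inE; apply/andP; split; first by rewrite inE.
rewrite inE /= /finite_norm (@lty_poweRy _ _ 2)//.
by rewrite Lnorm2_sqr.
Qed.

(** The element of L^2 given by a function of finite norm. *)
Definition L2_of (g : borelR -> R) (hg : g \in Lfun m 2%:E) : L2 m :=
  Lfun_Sub (lee1n 2) hg.

Lemma L2_measurable u : measurable_fun setT (u : borelR -> R).
Proof. exact: measurable_funP. Qed.

Lemma L2_Lfun u : (u : borelR -> R) \in Lfun m 2%:E.
Proof. exact: LfunP. Qed.

Lemma indic_L2 B : measurable B -> (m B < +oo)%E ->
  (\1_B : borelR -> R) \in Lfun m 2%:E.
Proof.
move=> mB Bfin; apply: L2_mem; first exact: measurable_indic.
rewrite (eq_integral (fun x => (\1_B x)%:E)).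
  by rewrite integral_indic// setIT.
by move=> x _; rewrite indicE; case: (x \in B); rewrite ?expr1n ?expr0n.
Qed.

Lemma L2_integrable_on B u : measurable B -> (m B < +oo)%E ->
  m.-integrable B (EFin \o u).
Proof.
move=> mB Bfin.
have /Lfun1_integrable := Lfun2_mul_Lfun1 (L2_Lfun u) (indic_L2 mB Bfin).
move=> /(integrableS measurableT mB (@subsetT _ _)).
apply: eq_integrable => // x xB.
by rewrite /= indicE xB mulr1.
Qed.

Lemma Rintegral_indic_mul B u : measurable B ->
  \int[m]_x (u x * \1_B x) = \int[m]_(x in B) u x.
Proof.
move=> mB; rewrite /Rintegral [in RHS]integral_mkcond; congr fine.
apply: eq_integral => x _; rewrite /patch indicE.
by case: (x \in B); rewrite ?mulr1 ?mulr0.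
Qed.

Lemma weak_cvg_on (u_ : nat -> L2 m) u B : weak_cvg u_ u ->
  measurable B -> (m B < +oo)%E ->
  \int[m]_(x in B) u_ n x @[n --> \oo] --> \int[m]_(x in B) u x.
Proof.
move=> uu mB Bfin; rewrite -(Rintegral_indic_mul u mB).
have -> : (fun n => \int[m]_(x in B) u_ n x) = (fun n => \int[m]_x (u_ n x * \1_B x)).
  by apply/funext => n; rewrite Rintegral_indic_mul.
exact: (uu (L2_of (indic_L2 mB Bfin))).
Qed.

(** If [u_ n] is close to the number [a n] on some set of positive finite
   measure, for all large [n], and this for any prescribed precision, then
   weak convergence of [u_] forces [a] to converge. *)
Lemma average_cvg (u_ : nat -> L2 m) u (f : nat -> R -> R) (a : nat -> R) :
  weak_cvg u_ u ->
  (forall n, {ae m, forall x, u_ n x = f n x}) ->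
  (forall e : R, 0 < e -> exists B : set borelR, [/\ measurable B, (0 < m B < +oo)%E &
     \forall n \near \oo, forall x, B x -> `|f n x - a n| <= e]) ->
  cvgn a.
Proof.
move=> uu uf H; apply: cauchy_cvg; apply: cauchy_exP => e e0.
have e20 : 0 < e / 2 by rewrite divr_gt0.
have [B [mB /andP[B0 Bfin] HB]] := H _ e20.
have mBf : m B \is a fin_num by rewrite ge0_fin_numE.
have b0 : 0 < fine (m B) by rewrite fine_gt0// B0.
exists (\int[m]_(x in B) u x / fine (m B)).
have be0 : 0 < fine (m B) * (e / 2) by rewrite mulr_gt0.
have /cvgrPdist_lt/(_ _ be0) uB := weak_cvg_on uu mB Bfin.
suff : \forall n \near \oo, ball (\int[m]_(x in B) u x / fine (m B)) e (a n) by [].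
near=> n.
have Bn : forall x, B x -> `|f n x - a n| <= e / 2 by near: n.
have un : `|\int[m]_(x in B) u x - \int[m]_(x in B) u_ n x| < fine (m B) * (e / 2).
  by near: n.
have cint : m.-integrable B (EFin \o cst (a n)).
  apply/integrableP; split; first exact/measurable_EFinP/measurable_cst.
  by rewrite /= integral_cst// -(fineK mBf) ltry.
have uint := L2_integrable_on (u_ n) mB Bfin.
have an : `|\int[m]_(x in B) u_ n x - a n * fine (m B)| <= e / 2 * fine (m B).
  rewrite -Rintegral_cst// -RintegralB//.
  apply: (le_trans (le_normr_Rintegral _ _)) => //.
    have -> : EFin \o (fun x => u_ n x - a n) = ((EFin \o u_ n) \- (EFin \o cst (a n)))%E.
      by apply/funext.
    exact: integrableB.
  rewrite -lee_fin EFinM (fineK mBf).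
  have <- : (\int[m]_(x in B) (cst (e / 2)%:E x) = (e / 2)%:E * m B)%E by rewrite integral_cst.
  rewrite /Rintegral fineK; last first.
    rewrite ge0_fin_numE; last by apply: integral_ge0 => x _; rewrite lee_fin.
    apply: (@le_lt_trans _ _ (\int[m]_(x in B) (cst (e / 2)%:E x))%E); last first.
      by rewrite integral_cst// -(fineK mBf) ltry.
    apply: ae_ge0_le_integral => //.
    - by apply/measurable_EFinP; apply: measurableT_comp => //; apply: measurable_funB => //; apply: measurable_funTS; exact: L2_measurable.
    - by move=> x _; rewrite lee_fin ltW.
    - by apply: filterS (uf n) => x ux Bx; rewrite ux lee_fin Bn.
  apply: ae_ge0_le_integral => //.
  - by apply/measurable_EFinP; apply: measurableT_comp => //; apply: measurable_funB => //; apply: measurable_funTS; exact: L2_measurable.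
  - by move=> x _; rewrite lee_fin ltW.
  - by apply: filterS (uf n) => x ux Bx; rewrite ux lee_fin Bn.
rewrite /ball/=.
have -> : \int[m]_(x in B) u x / fine (m B) - a n =
  (\int[m]_(x in B) u x - \int[m]_(x in B) u_ n x +
   (\int[m]_(x in B) u_ n x - a n * fine (m B))) / fine (m B).
  by field; rewrite gt_eqF.
rewrite normrM normfV (gtr0_norm b0) ltr_pdivrMr//.
rewrite (le_lt_trans (ler_normD _ _))//.
have -> : e * fine (m B) = fine (m B) * (e / 2) + e / 2 * fine (m B) by field.
exact: ltr_leD.
Unshelve. all: by end_near. Qed.

(** A weak limit coincides with the pointwise limit wherever the latter
   exists and the convergence is dominated. *)
Lemma weak_limit_ae (u_ : nat -> L2 m) u (f_ : nat -> R -> R) (f : R -> R) E (M : R) :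
  weak_cvg u_ u -> (forall n, {ae m, forall x, u_ n x = f_ n x}) ->
  (forall n, measurable_fun setT (f_ n : borelR -> R)) ->
  measurable E -> (m E < +oo)%E ->
  (forall x, E x -> f_ n x @[n --> \oo] --> f x) ->
  (\forall n \near \oo, forall x, E x -> `|f_ n x| <= M) ->
  {ae m, forall x, E x -> u x = f x}.
Proof.
move=> uu uf mf mE Efin ff [N _ fM].
have fM' n x : (N <= n)%N -> E x -> `|f_ n x| <= M by move=> /fM; apply.
have mfE : measurable_fun E (f : borelR -> R).
  apply/measurable_EFinP; apply: (emeasurable_fun_cvg (fun n => (EFin \o f_ n) : borelR -> \bar R)).
    by move=> n; apply/measurable_EFinP; exact: measurable_funTS.
  by move=> x Ex; apply: cvg_EFin; [by apply: nearW|exact: ff].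
suff : ae_eq m E (EFin \o u) (EFin \o f).
  by apply: filterS => x H Ex; apply: EFin_inj; exact: H.
apply: integral_ae_eq => //.
- exact: L2_integrable_on.
- exact/measurable_EFinP.
move=> A AE mA.
have Afin : (m A < +oo)%E by apply: le_lt_trans Efin; apply: le_measure; rewrite ?inE.
have Mint : m.-integrable A (cst M%:E).
  apply/integrableP; split; first exact: measurable_cst.
  rewrite integral_cst//; move: Afin; rewrite -ge0_fin_numE// => /fineK <-.
  exact: ltry.
have dc : (\int[m]_(x in A) (f_ (n + N)%N x)%:E @[n --> \oo] --> \int[m]_(x in A) (f x)%:E)%E.
  apply: (@dominated_cvg _ _ _ m A mA (fun n x => (f_ (n + N)%N x)%:E) (fun x => (f x)%:E) (cst M%:E)) => //.
  - by move=> n; apply/measurable_EFinP; exact: measurable_funTS.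
  - move=> x /AE Ex; apply: cvg_EFin; first by apply: nearW.
    by have := ff x Ex; rewrite -(cvg_shiftn N).
  - move=> n x /AE Ex; rewrite -[leLHS]/(EFin `|f_ (n + N)%N x|) lee_fin.
    by apply: fM' => //; exact: leq_addl.
have fu n : (\int[m]_(x in A) (f_ (n + N)%N x)%:E = \int[m]_(x in A) (u_ (n + N)%N x)%:E)%E.
  apply: ae_eq_integral => //.
  - by apply/measurable_EFinP; exact: measurable_funTS.
  - by apply/measurable_EFinP; apply: measurable_funTS; exact: L2_measurable.
  - by apply: filterS (uf (n + N)%N) => x ux _; rewrite ux.
have wc := weak_cvg_on uu mA Afin.
have wc' : (\int[m]_(x in A) (u_ (n + N)%N x)%:E @[n --> \oo] --> \int[m]_(x in A) (u x)%:E)%E.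
  have ufin (v : L2 m) : (\int[m]_(x in A) (v x)%:E)%E \is a fin_num.
    by apply: integrable_fin_num => //; exact: L2_integrable_on.
  rewrite -(fineK (ufin u)); apply: cvg_EFin; first by apply: nearW.
  by have := wc; rewrite -(cvg_shiftn N).
move: dc; under eq_cvg do rewrite fu; move=> dc.
exact: (cvg_unique _ wc' dc).
Qed.

End weak_convergence.

(** * Weak limits of functions of bounded energy *)

Section real_lemmas.
Context {R : realType}.

Lemma norm_le_sqr (v e : R) : 0 <= e -> v ^+ 2 <= e ^+ 2 -> `|v| <= e.
Proof. by move=> e0 ve; rewrite -(@ler_pXn2r _ 2)// ?nnegrE// real_normK// num_real. Qed.

Lemma cvg_sqr (T : Type) (F : set_system T) (FF : Filter F) (f : T -> R) (l : R) :
  f x @[x --> F] --> l -> f x ^+ 2 @[x --> F] --> l ^+ 2.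
Proof. by move=> fl; rewrite expr2; under eq_fun do rewrite expr2; exact: cvgM. Qed.

Lemma norm_le1 (v K : R) : v ^+ 2 <= K -> `|v| <= 1 + K.
Proof.
move=> vK; have K0 : 0 <= K := le_trans (sqr_ge0 _) vK.
apply: norm_le_sqr; first by rewrite addr_ge0.
by apply: (le_trans vK); have := sqr_ge0 K; lra.
Qed.

Lemma controlled_measurable (nu : {measure set (measurableTypeR R) -> \bar R})
    (f Q : R -> R) (C : R) : scrM nu -> controlled nu setT f Q ->
  (forall x y : R, x <= y -> Q y - Q x <= C) ->
  measurable_fun setT (f : measurableTypeR R -> R).
Proof.
move=> hnu fQ QC; have f_osc := controlled_osc hnu fQ QC.
have C0 : 0 <= C by have := QC 0 0 (lexx 0); rewrite subrr.
suff fc : continuous f.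
  by move=> mT Y mY; exact: (continuous_measurable_fun fc mT mY).
suff H (x : R) : f y @[y --> x] --> f x by exact: H.
apply/cvgrPdist_le => e e0.
have C1 : 0 < C + 1 by rewrite ltr_wpDl.
have d0 : 0 < e ^+ 2 / (C + 1) by rewrite divr_gt0 ?exprn_gt0.
have /cvgrPdist_lt/(_ _ d0) sc := continuous_scale hnu (x := x).
apply: filterS sc => y /= yx; apply: norm_le_sqr; first exact: ltW.
apply: (le_trans (f_osc _ _)).
apply: (@le_trans _ _ ((C + 1) * (e ^+ 2 / (C + 1)))); last first.
  by rewrite mulrC divfK// gt_eqF.
by apply: ler_pM => //; [rewrite lerDl|exact: ltW].
Qed.

(** Increments dominated by those of a bounded function, and a null limit at
   infinity, both uniformly along the sequence: the pointwise limit vanishes at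
   infinity. *)
Lemma tail_vanish (H : nat -> R -> R) (F S : R -> R) (C B : R) : 0 <= C ->
  (forall t t', 0 <= t -> t <= t' -> S t <= S t' <= B) ->
  (forall n t t', 0 <= t -> t <= t' -> (H n t' - H n t) ^+ 2 <= C * (S t' - S t)) ->
  (forall n, H n t @[t --> +oo] --> (0 : R)) ->
  (forall t, 0 <= t -> H n t @[n --> \oo] --> F t) ->
  F t @[t --> +oo] --> (0 : R).
Proof.
move=> C0 SB HS H0 HF.
pose A := [set S t | t in [set t | 0 <= t]].
have supA : has_sup A.
  split; first by exists (S 0), 0 => /=.
  by exists B => _ [t t0 <-]; have /andP[] := SB t t t0 (lexx _).
have Ssup t : 0 <= t -> S t <= sup A.
  by move=> t0; apply: ub_le_sup; [case: supA|exists t].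
have Hn n t : 0 <= t -> (H n t) ^+ 2 <= C * (sup A - S t).
  move=> t0.
  have : (H n t' - H n t) ^+ 2 @[t' --> +oo] --> (0 - H n t) ^+ 2.
    by apply: cvg_sqr; apply: cvgB; [exact: H0|exact: cvg_cst].
  rewrite sub0r sqrrN => /(@cvgr_to_le _ _ _ _ _ _ (C * (sup A - S t))); apply.
  near=> t'; have tt' : t <= t' by near: t'; apply: nbhs_pinfty_ge; exact: num_real.
  apply: (le_trans (HS n t t' t0 tt')).
  by rewrite ler_wpM2l// lerB// Ssup// (le_trans t0).
have Fn t : 0 <= t -> (F t) ^+ 2 <= C * (sup A - S t).
  move=> t0; have : (H n t) ^+ 2 @[n --> \oo] --> (F t) ^+ 2.
    by apply: cvg_sqr; exact: HF.
  move=> /(@cvgr_to_le _ _ _ _ _ _ (C * (sup A - S t))); apply.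
  by apply: nearW => n; exact: Hn.
apply/cvgrPdist_le => e e0.
have C1 : 0 < C + 1 by rewrite ltr_wpDl.
have d0 : 0 < e ^+ 2 / (C + 1) by rewrite divr_gt0 ?exprn_gt0.
have [_ [t0 /= t00 <-] St0] := sup_adherent d0 supA.
near=> t.
have tt : t0 <= t by near: t; apply: nbhs_pinfty_ge; exact: num_real.
rewrite sub0r normrN; apply: norm_le_sqr; first exact: ltW.
apply: (le_trans (Fn t (le_trans t00 tt))).
apply: (@le_trans _ _ ((C + 1) * (e ^+ 2 / (C + 1)))); last first.
  by rewrite mulrC divfK// gt_eqF.
apply: ler_pM => //; rewrite ?subr_ge0 ?Ssup ?(le_trans t00)// ?lerDl//.
have /andP[St _] := SB t0 t t00 tt.
rewrite lerBlDr -lerBlDl (le_trans _ St)// ltW//.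
Unshelve. all: by end_near. Qed.

End real_lemmas.

Section limit_of_bounded_energy.
Context {R : realType}.
Variables (m lambda : {measure set (measurableTypeR R) -> \bar R}).
Hypotheses (hm : scrM m) (hl : scrM lambda).
Variables (gamma : nat -> {measure set (measurableTypeR R) -> \bar R}) (eps : nat -> R).
Hypotheses (eps_gt0 : forall n, 0 < eps n) (eps_cvg0 : eps @ \oo --> (0 : R)).
Hypothesis hg : forall n, finite_full_atomless_on `]- eps n, eps n[%classic (gamma n).
Local Notation L n := (regularized (eps n) lambda (gamma n)).
Local Notation s := (scale lambda).
Variables (f Q : nat -> R -> R) (C : R).
Hypothesis fQ : forall n, controlled (L n) setT (f n) (Q n).
Hypothesis Q_bnd : forall n x, 0 <= Q n x <= C.

Let hL n : scrM (L n).
Proof. exact: regularized_scrM. Qed.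

(** The half-lines are the sets [0 <= sigma * x], with [sigma] equal to 1 or
   -1; [h sigma n] is [f n] transported to one of them by [T_eps^-1]. *)
Let h (sigma : R) n x := f n (x + sigma * eps n).

Let Q_nd n x y : x <= y -> Q n x <= Q n y.
Proof. by move=> xy; apply: (controlled_nondecreasing (hL n) (fQ n)). Qed.

Let C_ge0 : 0 <= C.
Proof. by have /andP[h1 h2] := Q_bnd 0 0; exact: le_trans h2. Qed.

Let Q_osc n (x y : R) : x <= y -> Q n y - Q n x <= C.
Proof.
move=> xy; have /andP[h1 h2] := Q_bnd n x; have /andP[h3 h4] := Q_bnd n y.
by rewrite lerBlDr (le_trans h4)// lerDl.
Qed.

Let f_osc n x y : (f n y - f n x) ^+ 2 <= C * `|scale (L n) y - scale (L n) x|.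
Proof. exact: (controlled_osc (hL n) (fQ n) (Q_osc n)). Qed.

Let shift n (sigma x y : R) : sigma = 1 \/ sigma = -1 -> 0 <= sigma * x -> 0 <= sigma * y ->
  scale (L n) (y + sigma * eps n) - scale (L n) (x + sigma * eps n) = s y - s x.
Proof.
move=> [->|->]; rewrite ?mul1r ?mulN1r ?oppr_ge0 => x0 y0.
  have [xy|/ltW yx] := leP x y; first exact: regularized_scale_pos.
  by apply: oppr_inj; rewrite !opprB; exact: regularized_scale_pos.
have [xy|/ltW yx] := leP x y; first exact: regularized_scale_neg.
by apply: oppr_inj; rewrite !opprB; exact: regularized_scale_neg.
Qed.

Let h_osc sigma n x y : sigma = 1 \/ sigma = -1 -> 0 <= sigma * x -> 0 <= sigma * y ->
  (h sigma n y - h sigma n x) ^+ 2 <= C * `|s y - s x|.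
Proof. by move=> sg x0 y0; rewrite -(shift n sg x0 y0); exact: f_osc. Qed.

(** The functions [h sigma n] are equicontinuous at every point of the half-line. *)
Let h_near sigma x : sigma = 1 \/ sigma = -1 -> 0 <= sigma * x ->
  forall e : R, 0 < e -> exists2 r : R, 0 < r & forall n y, 0 <= sigma * y ->
    `|y - x| <= r -> `|h sigma n y - h sigma n x| <= e.
Proof.
move=> sg x0 e e0; have C1 : 0 < C + 1 by rewrite ltr_wpDl.
have d0 : 0 < e ^+ 2 / (C + 1) by rewrite divr_gt0 ?exprn_gt0.
have /cvgrPdist_lt/(_ _ d0)[r /= r0 Hr] := continuous_scale hl (x := x).
exists (r / 2) => [|n y y0 yx]; first by rewrite divr_gt0.
apply: norm_le_sqr; first exact: ltW.
apply: (le_trans (h_osc n sg x0 y0)).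
apply: (@le_trans _ _ ((C + 1) * (e ^+ 2 / (C + 1)))); last first.
  by rewrite mulrC divfK// gt_eqF.
apply: ler_pM => //; first by rewrite lerDl.
apply: ltW; rewrite distrC; apply: Hr; rewrite /ball/= distrC (le_lt_trans yx)//.
by rewrite ltr_pdivrMr// ltr_pMr// ltr1n.
Qed.

Variables (u_ : nat -> L2 m) (u : L2 m).
Hypothesis uu : weak_cvg u_ u.
Hypothesis uf : forall n, {ae m, forall x, u_ n x = f n x}.

Let eps_small (r : R) : 0 < r -> \forall n \near \oo, eps n <= r.
Proof.
move=> r0; have /cvgrPdist_le/(_ _ r0) := eps_cvg0.
apply: filterS => n; rewrite sub0r normrN; apply: le_trans; exact: ler_norm.
Qed.

Let h_cvg sigma x : sigma = 1 \/ sigma = -1 -> 0 <= sigma * x -> cvgn (h sigma ^~ x).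
Proof.
move=> sg x0; apply: (average_cvg uu uf) => e e0.
have [r r0 Hr] := h_near sg x0 e0.
(* The points of [c - d, c + d] lie between r / 2 and r beyond x: moved back by
   eps n <= r / 2, they stay on the half-line and within r of x. *)
pose c := x + sigma * (3 / 4 * r); pose d := r / 4.
have d0 : 0 < d by rewrite divr_gt0.
exists `[c - d, c + d]%classic; split.
- exact: measurable_itv.
- rewrite (scrM_segment hm) andbT.
  apply: (@lt_le_trans _ _ (m `]c - d, c + d[%classic)); last first.
    by apply: le_measure; rewrite ?inE; [exact: measurable_itv..|exact: subset_itv_oo_cc].
  case: hm => _ + _; apply; first exact: interval_open.
  by exists c; rewrite /= in_itv/= ltrDl gtrBl d0.
- have r20 : 0 < r / 2 by rewrite divr_gt0.
  apply: filterS (eps_small r20) => n en y; rewrite /= in_itv/= => /andP[y1 y2].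
  have -> : f n y = h sigma n (y - sigma * eps n) by rewrite /h subrK.
  have e1 := eps_gt0 n.
  apply: Hr; move: y1 y2 x0; rewrite /c /d; case: sg => ->; rewrite ?mul1r ?mulN1r.
  + by move=> y1 y2 x0; lra.
  + by move=> y1 y2 x0; lra.
  + by move=> y1 y2 x0; rewrite ler_norml; apply/andP; split; lra.
  + by move=> y1 y2 x0; rewrite ler_norml; apply/andP; split; lra.
Qed.

Let F sigma x : R := lim (h sigma ^~ x @ \oo).

Let hF sigma x : sigma = 1 \/ sigma = -1 -> 0 <= sigma * x ->
  h sigma n x @[n --> \oo] --> F sigma x.
Proof. exact: h_cvg. Qed.

Let f_cvg sigma x : sigma = 1 \/ sigma = -1 -> 0 < sigma * x ->
  f n x @[n --> \oo] --> F sigma x.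
Proof.
move=> sg x0; have x0' := ltW x0.
apply/cvgrPdist_le => e e0; have e20 : 0 < e / 2 by rewrite divr_gt0.
have [r r0 Hr] := h_near sg x0' e20.
have /cvgrPdist_le/(_ _ e20) hFe := hF sg x0'.
near=> n.
have en : eps n <= r by near: n; exact: eps_small.
have en' : eps n <= sigma * x by near: n; exact: eps_small.
have e1 := eps_gt0 n.
have -> : f n x = h sigma n (x - sigma * eps n) by rewrite /h subrK.
have Hn : `|h sigma n (x - sigma * eps n) - h sigma n x| <= e / 2.
  apply: Hr; last first.
    by rewrite addrAC subrr add0r normrN; case: sg => ->; rewrite ?mul1r ?mulN1r ?normrN gtr0_norm.
  by move: en'; case: sg => ->; rewrite ?mul1r ?mulN1r; lra.
have Fn : `|F sigma x - h sigma n x| <= e / 2 by near: n.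
rewrite -(subrKA (h sigma n x)) (le_trans (ler_normD _ _))// [leRHS]splitr lerD//.
by rewrite distrC.
Unshelve. all: by end_near. Qed.

Let mf n : measurable_fun setT (f n : measurableTypeR R -> R).
Proof. exact: (controlled_measurable (hL n) (fQ n) (Q_osc n)). Qed.

Let F_ae sigma : sigma = 1 \/ sigma = -1 ->
  {ae m, forall x, 0 <= sigma * x -> u x = F sigma x}.
Proof.
(* The segments E k exhaust the half-line without the origin, which has no mass. *)
move=> sg; pose a (k : nat) : R := k.+1%:R^-1; pose b (k : nat) : R := k.+1%:R.
pose E k : set (measurableTypeR R) :=
  `[sigma * ((b k + a k) / 2) - (b k - a k) / 2, sigma * ((b k + a k) / 2) + (b k - a k) / 2]%classic.
have EP k x : E k x <-> a k <= sigma * x <= b k.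
  rewrite /E /= in_itv/=; case: sg => ->; rewrite ?mul1r ?mulN1r.
    by split => /andP[h1 h2]; apply/andP; split; lra.
  by split => /andP[h1 h2]; apply/andP; split; lra.
have a0 k : 0 < a k by rewrite invr_gt0.
have sg0 : 0 <= sigma * 0 by rewrite mulr0.
have H k : {ae m, forall x, E k x -> u x = F sigma x}.
  pose K := s (b k) - s (- b k).
  apply: (@weak_limit_ae _ _ _ _ f (F sigma) (E k) (`|F sigma 0| + 1 + (1 + C * K)) uu uf mf).
  - exact: measurable_itv.
  - exact: (scrM_segment hm).
  - by move=> x /EP/andP[ax _]; apply: f_cvg => //; exact: lt_le_trans ax.
  have /cvgrPdist_le/(_ _ ltr01) h0 := hF sg sg0.
  near=> n => x /EP/andP[ax xb].
  have en : eps n <= a k by near: n; exact: eps_small.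
  have -> : f n x = h sigma n (x - sigma * eps n) by rewrite /h subrK.
  have e1 := eps_gt0 n.
  set y := x - sigma * eps n.
  have y0 : 0 <= sigma * y /\ (- b k <= y <= b k).
    move: en ax xb; rewrite /y; case: sg => ->; rewrite ?mul1r ?mulN1r => h1 h2 h3.
      by split; [lra|apply/andP; split; lra].
    by split; [lra|apply/andP; split; lra].
  have h1 : `|h sigma n y - h sigma n 0| <= 1 + C * K.
    apply: norm_le1; apply: (le_trans (h_osc n sg sg0 y0.1)).
    have b0 : 0 <= b k by rewrite ler0n.
    rewrite ler_wpM2l// ler_norml /K; have /andP[y1 y2] := y0.2.
    have s1 := le_scale hl y1; have s2 := le_scale hl y2.
    have s3 := le_scale hl b0; have s4 : s (- b k) <= s 0 by apply: (le_scale hl); rewrite oppr_le0.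
    by apply/andP; split; lra.
  have h2 : `|F sigma 0 - h sigma n 0| <= 1 by near: n.
  have h3 : `|h sigma n 0| <= `|F sigma 0| + 1.
    have -> : h sigma n 0 = F sigma 0 - (F sigma 0 - h sigma n 0) by rewrite subKr.
    by apply: (le_trans (ler_normB _ _)); rewrite lerD2l.
  have -> : h sigma n y = h sigma n 0 + (h sigma n y - h sigma n 0) by rewrite addrC subrK.
  by apply: (le_trans (ler_normD _ _)); exact: lerD.
have all : {ae m, forall x k, E k x -> u x = F sigma x} by exact/ae_foralln.
have N0 : {ae m, forall x : measurableTypeR R, x != 0}.
  exists [set 0]; split; [exact: measurable_set1|exact: (scrM_set1 hm)|].
  by move=> x /= /negP; rewrite negbK => /eqP.
apply: filterS2 all N0 => x Hx x0 sx0.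
have {}x0 : 0 < sigma * x.
  rewrite lt_neqAle sx0 andbT eq_sym mulf_neq0//.
  by case: sg => ->; rewrite ?oppr_eq0 oner_eq0.
pose k := maxn (Num.bound (sigma * x)) (Num.bound (sigma * x)^-1).
apply: (Hx k); apply/EP; rewrite /a /b; apply/andP; split.
  rewrite -[leRHS]invrK lef_pV2 ?posrE ?invr_gt0//.
  apply: (le_trans (ltW (archi_boundP _))); first by rewrite invr_ge0 ltW.
  by rewrite ler_nat ltnW// ltnS leq_maxr.
apply: (le_trans (ltW (archi_boundP _))); first exact: ltW.
by rewrite ler_nat ltnW// ltnS leq_maxl.
Unshelve. all: by end_near. Qed.

Let gap n : (f n (eps n) - f n (- eps n)) ^+ 2 <=
  fine (gamma n `]- eps n, eps n[%classic) * (Q n (eps n) - Q n (- eps n)).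
Proof.
rewrite -(regularized_scale_mid hl (hg n) (eps_gt0 n)) /=.
by apply: fQ => //; have := eps_gt0 n; lra.
Qed.

Let h_bounded n : energy_bounded lambda Gpos (h 1 n) (C - Q n (eps n)) /\
  energy_bounded lambda Gneg (h (-1) n) (Q n (- eps n)).
Proof.
have p1 : (1 : R) = 1 \/ (1 : R) = -1 by left.
have m1 : (-1 : R) = 1 \/ (-1 : R) = -1 by right.
split.
- apply: (@controlled_energy_bounded _ _ hl Gpos _ (fun x => Q n (x + 1 * eps n)) _ 0).
  + exact: interval_is_interval.
  + by rewrite /Gpos /= in_itv/= lexx.
  + move=> x y; rewrite /Gpos /= !in_itv/= !andbT => x0 y0 xy.
    rewrite -(shift n p1) ?mul1r//; apply: (le_trans (fQ n _ _ _)) => //.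
      by rewrite lerD2r.
    by rewrite !mul1r.
  + move=> x y; rewrite /Gpos /= !in_itv/= !andbT => x0 y0 xy.
    have /andP[_ h1] := Q_bnd n (y + 1 * eps n).
    have h2 : Q n (eps n) <= Q n (x + 1 * eps n) by apply: Q_nd; rewrite mul1r lerDr.
    by lra.
- apply: (@controlled_energy_bounded _ _ hl Gneg _ (fun x => Q n (x + -1 * eps n)) _ 0).
  + exact: interval_is_interval.
  + by rewrite /Gneg /= in_itv/= lexx.
  + move=> x y; rewrite /Gneg /= !in_itv/= => x0 y0 xy.
    rewrite -(shift n m1) ?mulN1r ?oppr_ge0//; apply: (le_trans (fQ n _ _ _)) => //.
      by rewrite lerD2r.
    by rewrite !mulN1r.
  + move=> x y; rewrite /Gneg /= !in_itv/= => x0 y0 xy.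
    have /andP[h1 _] := Q_bnd n (x + -1 * eps n).
    have h2 : Q n (y + -1 * eps n) <= Q n (- eps n) by apply: Q_nd; rewrite mulN1r gerDr.
    by lra.
Qed.

(** The sum that occurs in [energy_bounded], for [lambda]. *)
Let en (g : R -> R) N (a b : nat -> R) :=
  \sum_(i < N) (g (b i) - g (a i)) ^+ 2 / (s (b i) - s (a i)).

Let en_cvg sigma N (a b : nat -> R) : sigma = 1 \/ sigma = -1 ->
  (forall i, (i < N)%N -> 0 <= sigma * a i /\ 0 <= sigma * b i) ->
  en (h sigma n) N a b @[n --> \oo] --> en (F sigma) N a b.
Proof.
move=> sg; rewrite /en; elim: N => [|N ih] ab.
  by rewrite big_ord0; under eq_fun do rewrite big_ord0; exact: cvg_cst.
rewrite big_ord_recr/=; under eq_fun do rewrite big_ord_recr/=.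
apply: cvgD; first by apply: ih => i iN; apply: ab; exact: ltnW.
apply: cvgMr_tmp; apply: cvg_sqr.
have [a0 b0] := ab N (ltnSn N).
by apply: cvgB; exact: hF.
Qed.

(** The families of intervals on the two half-lines and the gap between them
   share the bound [C]; the supremum over the families on the positive half-line
   separates the two half-lines. *)
Let energy_limit (J_ : nat -> R) J : J_ n @[n --> \oo] --> J ->
  (forall n, J_ n <= Q n (eps n) - Q n (- eps n)) ->
  exists Cp Cm, [/\ Cp + Cm + J <= C, energy_bounded lambda Gpos (F 1) Cp &
    energy_bounded lambda Gneg (F (-1)) Cm].
Proof.
move=> JJ Jle.
have p1 : (1 : R) = 1 \/ (1 : R) = -1 by left.
have m1 : (-1 : R) = 1 \/ (-1 : R) = -1 by right.
pose fam (I : set R) N (a b : nat -> R) :=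
  (forall i, (i < N)%N -> [/\ a i <= b i, I (a i) & I (b i)]) /\
  trivIset `I_N (fun i => `]a i, b i[%classic).
have key N a b N' a' b' : fam Gpos N a b -> fam Gneg N' a' b' ->
    en (F 1) N a b + en (F (-1)) N' a' b' + J <= C.
  move=> [ab tab] [ab' tab'].
  have : en (h 1 n) N a b + en (h (-1) n) N' a' b' + J_ n @[n --> \oo] -->
         en (F 1) N a b + en (F (-1)) N' a' b' + J.
    apply: cvgD => //; apply: cvgD; apply: en_cvg => // i iN.
      have [_] := ab i iN; rewrite /Gpos /= !in_itv/= !andbT => h1 h2.
      by rewrite !mul1r.
    have [_] := ab' i iN; rewrite /Gneg /= !in_itv/= => h1 h2.
    by rewrite !mulN1r !oppr_ge0.
  move=> /(@cvgr_to_le _ _ _ _ _ _ C); apply; apply: nearW => n.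
  have [/(_ N a b ab tab) h1 /(_ N' a' b' ab' tab') h2] := h_bounded n.
  have h3 := Jle n.
  by rewrite /en; move: h1 h2 h3; lra.
have e0 (I : set R) : fam I 0 (fun=> 0) (fun=> 0).
  by split => // i j; rewrite /= ltn0.
pose A := [set x | exists N a b, fam Gpos N a b /\ x = en (F 1) N a b].
have supA : has_sup A.
  split; first by exists (en (F 1) 0 (fun=> 0) (fun=> 0)), 0%N, (fun=> 0), (fun=> 0).
  exists (C - J) => _ [N [a [b [abf ->]]]].
  have := key _ _ _ _ _ _ abf (e0 _); rewrite {2}/en big_ord0 addr0.
  by rewrite lerBrDr.
exists (sup A), (C - J - sup A); split; first by rewrite (_ : sup A + (C - J - sup A) + J = C)//; ring.
- by move=> N a b ab tab; apply: ub_le_sup; [case: supA|exists N, a, b].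
- move=> N' a' b' ab' tab'; rewrite lerBrDr -lerBrDl; apply: ge_sup.
    by case: supA.
  move=> _ [N [a [b [abf ->]]]].
  have := key _ _ _ _ _ _ abf (conj ab' tab').
  rewrite -[X in _ <= _ - X]/(en (F (-1)) N' a' b').
  by move: (en _ _ _ _) (en _ _ _ _) => x y; lra.
Qed.

Let cvg_shift_pinfty (g : R -> R) (c l : R) : g x @[x --> +oo] --> l ->
  g (x + c) @[x --> +oo] --> l.
Proof.
move=> gl; apply: (cvg_comp (fun x => x + c) g) gl.
apply/cvgryPge => A; near=> x; rewrite -lerBlDr.
by near: x; apply: nbhs_pinfty_ge; exact: num_real.
Unshelve. all: by end_near. Qed.

Let vanish_pos : (forall n, vanishes_at_pinfty (L n) (f n)) ->
  vanishes_at_pinfty lambda (F 1).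
Proof.
move=> fv lfin.
have p1 : (1 : R) = 1 \/ (1 : R) = -1 by left.
apply: (@tail_vanish _ (h 1) (F 1) s C (fine (lambda Gpos))) => //.
- move=> t t' t0 tt'; rewrite (le_scale hl)//=.
  rewrite /scale (le_trans t0 tt'); apply: fine_le.
  + by rewrite ge0_fin_numE// (scrM_segment hl).
  + by rewrite ge0_fin_numE.
  + apply: le_measure; rewrite ?inE; [exact: measurable_itv..|].
    by move=> x; rewrite /Gpos /= !in_itv/= andbT => /andP[].
- move=> n t t' t0 tt'; have t'0 := le_trans t0 tt'.
  have := h_osc n p1 (x := t) (y := t'); rewrite !mul1r => /(_ t0 t'0).
  by rewrite ger0_norm// subr_ge0 (le_scale hl).
- move=> n; apply: cvg_shift_pinfty; apply: fv.
  by rewrite (regularized_Gpos _ (hg n)).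
- by move=> t t0; apply: hF => //; rewrite mul1r.
Qed.

Let vanish_neg : (forall n, vanishes_at_ninfty (L n) (f n)) ->
  vanishes_at_ninfty lambda (F (-1)).
Proof.
move=> fv lfin.
have m1 : (-1 : R) = 1 \/ (-1 : R) = -1 by right.
apply/cvgNy_compNP.
apply: (@tail_vanish _ (fun n t => h (-1) n (- t)) (fun t => F (-1) (- t))
   (fun t => - s (- t)) C (fine (lambda Gneg))) => //.
- move=> t t' t0 tt'; rewrite lerN2 (le_scale hl) ?lerN2//=.
  have t'0 := le_trans t0 tt'.
  have -> : - s (- t') = fine (lambda `[- t', 0]%classic).
    by rewrite (scale_itvcc hl) ?oppr_le0//= (scale0 hl) sub0r.
  apply: fine_le.
  + by rewrite ge0_fin_numE// (scrM_segment hl).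
  + by rewrite ge0_fin_numE.
  + apply: le_measure; rewrite ?inE; [exact: measurable_itv..|].
    by move=> x; rewrite /Gneg /= !in_itv/= => /andP[].
- move=> n t t' t0 tt'; have t'0 := le_trans t0 tt'.
  have := h_osc n m1 (x := - t) (y := - t'); rewrite !mulrNN !mul1r => /(_ t0 t'0).
  have -> : - s (- t') - - s (- t) = s (- t) - s (- t') by ring.
  by rewrite distrC ger0_norm// subr_ge0 (le_scale hl)// lerN2.
- move=> n; have fn0 : f n x @[x --> -oo] --> (0 : R).
    by apply: fv; rewrite (regularized_Gneg hl (hg n)).
  have := cvg_shift_pinfty (eps n) ((cvgNy_compNP _ _).1 fn0).
  apply: cvg_trans; apply: near_eq_cvg; apply: nearW => t /=.
  by rewrite /h mulN1r opprD.
- by move=> t t0; apply: hF => //; rewrite mulrNN mul1r.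
Qed.

(** Functions of uniformly bounded energy with respect to the regularized
   measures which converge weakly in L^2: the limit has versions on the two
   half-lines, with the energy bound and boundary conditions that result. *)
Lemma bounded_energy_limit : exists Fp Fm : R -> R,
  [/\ {ae m, forall x, Gpos x -> u x = Fp x} /\ {ae m, forall x, Gneg x -> u x = Fm x},
      f n (eps n) @[n --> \oo] --> Fp 0 /\ f n (- eps n) @[n --> \oo] --> Fm 0,
      (forall n, (f n (eps n) - f n (- eps n)) ^+ 2 <=
         fine (gamma n `]- eps n, eps n[%classic) * (Q n (eps n) - Q n (- eps n))),
      forall (J_ : nat -> R) J, J_ n @[n --> \oo] --> J ->
        (forall n, J_ n <= Q n (eps n) - Q n (- eps n)) ->
        exists Cp Cm, [/\ Cp + Cm + J <= C, energy_bounded lambda Gpos Fp Cp &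
          energy_bounded lambda Gneg Fm Cm] &
      ((forall n, vanishes_at_pinfty (L n) (f n)) -> vanishes_at_pinfty lambda Fp) /\
      ((forall n, vanishes_at_ninfty (L n) (f n)) -> vanishes_at_ninfty lambda Fm)].
Proof.
have p1 : (1 : R) = 1 \/ (1 : R) = -1 by left.
have m1 : (-1 : R) = 1 \/ (-1 : R) = -1 by right.
exists (F 1), (F (-1)); split => //.
- split.
    have := F_ae p1; apply: filterS; first exact: (ae_filter_ringOfSetsType m).
    move=> x H; rewrite /Gpos /= in_itv/= andbT => x0.
    by apply: H; rewrite mul1r.
  have := F_ae m1; apply: filterS; first exact: (ae_filter_ringOfSetsType m).
  move=> x H; rewrite /Gneg /= in_itv/= => x0.
  by apply: H; rewrite mulN1r oppr_ge0.
- split.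
    have := hF p1 (x := 0); rewrite mulr0 => /(_ (lexx _)).
    by under eq_cvg do rewrite /h add0r mul1r.
  have := hF m1 (x := 0); rewrite mulr0 => /(_ (lexx _)).
  by under eq_cvg do rewrite /h add0r mulN1r.
Qed.

End limit_of_bounded_energy.

(** * Distance between a function and its translates *)

Section recovery_tools.
Context {R : realType}.
Local Notation borelR := (measurableTypeR R).

Variable m : {measure set borelR -> \bar R}.

Lemma ge0_integral_cells_le (A : nat -> set borelR) (g : borelR -> R) (c : nat -> R) (M S : R) :
  (forall k, measurable (A k)) -> trivIset setT A -> measurable_fun setT g ->
  (forall x, 0 <= g x) -> (forall k, (m (A k) <= M%:E)%E) -> (forall k, 0 <= c k) ->
  (forall k, {ae m, forall x, A k x -> g x <= c k}) ->
  (forall N, \sum_(k < N) c k <= S) ->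
  (\int[m]_(x in \bigcup_k A k) (g x)%:E <= (S * M)%:E)%E.
Proof.
move=> mA tA mg g0 mAM c0 gc cS.
have mgD D : measurable_fun D (EFin \o g) by apply/measurable_EFinP; exact: measurable_funTS.
rewrite ge0_integral_bigcup//; last by move=> x _; rewrite lee_fin.
have cell0 k : (0 <= \int[m]_(x in A k) (g x)%:E)%E.
  by apply: integral_ge0 => x _; rewrite lee_fin.
have M0 : 0 <= M by rewrite -lee_fin (le_trans _ (mAM 0)).
apply: lime_le; first by apply: is_cvg_nneseries => k _ _; exact: cell0.
apply: nearW => N; rewrite big_mkord.
apply: (@le_trans _ _ (\sum_(k < N) (c k * M)%:E)%E); last first.
  by rewrite sumEFin lee_fin -mulr_suml ler_wpM2r.
apply: lee_sum => k _.
apply: (@le_trans _ _ (\int[m]_(x in A k) (cst (c k)%:E x))%E).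
  apply: ae_ge0_le_integral => //.
  - by move=> x _; rewrite lee_fin.
  - by move=> x _; rewrite lee_fin.
by rewrite integral_cst// EFinM lee_wpmul2l// lee_fin.
Qed.

(** Each increment [q k.+1 - q k] is counted at most twice, whence the factor 2. *)
Lemma sum_double_increments (q : nat -> R) (K : R) N :
  (forall k, q k <= q k.+1) -> (forall k, q k - q 0%N <= K) ->
  \sum_(k < N) (q k.+2 - q k) <= 2 * K.
Proof.
move=> qnd qK; have -> : \sum_(k < N) (q k.+2 - q k) = (q N.+1 - q 0%N) + (q N - q 1%N).
  elim: N => [|N ih]; first by rewrite big_ord0; ring.
  by rewrite big_ord_recr/= ih; ring.
have := qK N.+1; have := qK N; have := qnd 0%N; lra.
Qed.

End recovery_tools.

Section shift_estimate.
Context {R : realType}.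
Local Notation borelR := (measurableTypeR R).
Variables (m lambda : {measure set borelR -> \bar R}).
Hypotheses (hm : scrM m) (hl : scrM lambda).
Local Notation s := (scale lambda).

Lemma cells_trivIset (e : R) : 0 < e ->
  trivIset setT (fun k : nat => `]k.+1%:R * e, k.+2%:R * e]%classic : set borelR).
Proof.
move=> e0 i j _ _ [x []]; rewrite /= !in_itv/= => /andP[h1 h2] /andP[h3 h4].
have := lt_le_trans h1 h4; have := lt_le_trans h3 h2.
by rewrite !ltr_pM2r// !ltr_nat; lia.
Qed.

Lemma cells_bigcup (e : R) : 0 < e ->
  \bigcup_k `]k.+1%:R * e, k.+2%:R * e]%classic = `]e, +oo[%classic.
Proof.
move=> e0; apply/seteqP; split => x /=.
  move=> [k _] /=; rewrite !in_itv/= andbT => /andP[+ _]; apply: le_lt_trans.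
  by rewrite ler_peMl ?(ltW e0)// ler1n.
rewrite in_itv/= andbT => ex.
have [k xk kmin] : exists2 k, x <= k.+2%:R * e & forall j, x <= j.+2%:R * e -> (k <= j)%N.
  have ex_k : exists k, x <= k.+2%:R * e.
    exists (Num.bound (x / e)); rewrite -ler_pdivrMr//.
    have xe : 0 <= x / e by rewrite divr_ge0 ?(ltW e0)// (le_trans (ltW e0))// ltW.
    by rewrite (le_trans (ltW (archi_boundP xe)))// ler_nat ltnW// ltnW.
  by case: (ex_minnP ex_k) => k h1 h2; exists k.
exists k => //=; rewrite in_itv/= xk andbT.
case: k xk kmin => [|k] xk kmin; first by rewrite mul1r.
by rewrite ltNge; apply/negP => /kmin; rewrite ltnn.
Qed.

Variables (e Mm Ml K : R).
Hypothesis e_gt0 : 0 < e.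
Hypothesis m_cell : forall x, (m `[x, (x + e)%R]%classic <= Mm%:E)%E.
Hypothesis l_cell : forall x, s (x + e) - s x <= Ml.

Let ck (k : nat) : k.+1%:R * e = k%:R * e + e.
Proof. by rewrite -natr1 mulrDl mul1r. Qed.

Let ck_ge0 (k : nat) : 0 <= k%:R * e.
Proof. by rewrite mulr_ge0// ltW. Qed.

Let ck_nd (k l : nat) : (k <= l)%N -> k%:R * e <= l%:R * e.
Proof. by move=> kl; rewrite ler_pM2r// ler_nat. Qed.

(** For [x] in the cell numbered [k], both [x - e] and [x] lie between [k * e] and
   [k.+2 * e], and the increments of [Q] over these intervals add up to at most
   [2 * K]; each cell has mass at most [Mm]. *)
Lemma shift_estimate_pos (f Q : R -> R) (g : borelR -> R) :
  controlled lambda Gpos f Q -> (forall x, 0 <= x -> Q x - Q 0 <= K) ->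
  measurable_fun setT g -> (forall x, 0 <= g x) ->
  {ae m, forall x : borelR, (e : R) < x -> g x <= (f (x - e) - f x) ^+ 2} ->
  (\int[m]_(x in `]e, +oo[%classic) (g x)%:E <= (Ml * (2 * K) * Mm)%:E)%E.
Proof.
move=> fQ QK mg g0 gf.
have P x : 0 <= x -> Gpos x by move=> x0; rewrite /Gpos /= in_itv/= andbT.
have Qnd x y : 0 <= x -> x <= y -> Q x <= Q y.
  by move=> x0 xy; apply: (controlled_nondecreasing hl fQ) => //; apply: P => //; exact: le_trans xy.
rewrite -(cells_bigcup e_gt0).
have Ml0 : 0 <= Ml by apply: (le_trans _ (l_cell 0)); rewrite subr_ge0 (le_scale hl)// lerDl ltW.
apply: (ge0_integral_cells_le (c := fun k => Ml * (Q (k.+2%:R * e) - Q (k%:R * e)))) => //.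
- exact: cells_trivIset.
- move=> k; apply: le_trans (m_cell (k.+1%:R * e)).
  apply: le_measure; rewrite ?inE; [exact: measurable_itv..|].
  by move=> x /=; rewrite !in_itv/= -ck => /andP[/ltW -> ->].
- by move=> k; rewrite mulr_ge0// subr_ge0 Qnd// ck_nd// leqW.
- move=> k; apply: filterS gf => x gx; rewrite /= in_itv/= => /andP[kx xk].
  have ex : e < x by apply: le_lt_trans kx; rewrite ck lerDr.
  apply: (le_trans (gx ex)).
  have e0 := e_gt0.
  have xe0 : 0 <= x - e by rewrite subr_ge0 ltW.
  have xx : x - e <= x by rewrite gerBl ltW.
  rewrite -sqrrN opprB; apply: (le_trans (fQ _ _ _ _ xx)); [exact: P|by apply: P; exact: le_trans xx|].
  apply: ler_pM; rewrite ?subr_ge0 ?(le_scale hl) ?Qnd//.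
    by have := l_cell (x - e); rewrite subrK.
  apply: lerB; apply: Qnd => //; first exact: le_trans xx.
  by rewrite lerBrDr -ck ltW.
- move=> N; rewrite -mulr_sumr ler_wpM2l//.
  apply: (sum_double_increments (q := fun k => Q (k%:R * e))) => k.
    by rewrite Qnd// ck_nd.
  by rewrite mul0r QK.
Qed.

Lemma shift_estimate_neg (f Q : R -> R) (g : borelR -> R) :
  controlled lambda Gneg f Q -> (forall x, x <= 0 -> Q 0 - Q x <= K) ->
  measurable_fun setT g -> (forall x, 0 <= g x) ->
  {ae m, forall x : borelR, (x : R) < - e -> g x <= (f (x + e) - f x) ^+ 2} ->
  (\int[m]_(x in `]-oo, (- e)%R[%classic) (g x)%:E <= (Ml * (2 * K) * Mm)%:E)%E.
Proof.
move=> fQ QK mg g0 gf.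
have P x : x <= 0 -> Gneg x by move=> x0; rewrite /Gneg /= in_itv/=.
have Qnd x y : y <= 0 -> x <= y -> Q x <= Q y.
  by move=> y0 xy; apply: (controlled_nondecreasing hl fQ) => //; apply: P => //; exact: le_trans y0.
have cellE (k : nat) : `[- (k.+2%:R * e), - (k.+1%:R * e)[%classic =
    -%R @^-1` `]k.+1%:R * e, k.+2%:R * e]%classic.
  by apply/seteqP; split => x; rewrite /= !in_itv/= ltrNr lerNl andbC.
have -> : `]-oo, - e[%classic = \bigcup_k `[- (k.+2%:R * e), - (k.+1%:R * e)[%classic.
  have -> : (fun k : nat => `[- (k.+2%:R * e), - (k.+1%:R * e)[%classic) =
      (fun k : nat => -%R @^-1` `]k.+1%:R * e, k.+2%:R * e]%classic) by apply/funext.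
  rewrite -preimage_bigcup (cells_bigcup e_gt0).
  by apply/seteqP; split => x; rewrite /= !in_itv/= andbT ltrNr.
have Ml0 : 0 <= Ml by apply: (le_trans _ (l_cell 0)); rewrite subr_ge0 (le_scale hl)// lerDl ltW.
apply: (ge0_integral_cells_le (c := fun k => Ml * (Q (- (k%:R * e)) - Q (- (k.+2%:R * e))))) => //.
- move=> i j _ _ [x []]; rewrite !cellE => h1 h2.
  by apply: (cells_trivIset e_gt0) => //; exists (- x).
- move=> k; apply: le_trans (m_cell (- (k.+2%:R * e))).
  apply: le_measure; rewrite ?inE; [exact: measurable_itv..|].
  move=> x /=; rewrite !in_itv/= => /andP[-> /ltW xk]; rewrite (le_trans xk)//.
  by rewrite (ck k.+1) opprD subrK.
- by move=> k; rewrite mulr_ge0// subr_ge0 Qnd ?oppr_le0// lerN2 ck_nd// leqW.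
- move=> k; apply: filterS gf => x gx; rewrite /= in_itv/= => /andP[kx xk].
  have ex : x < - e by apply: lt_le_trans xk _; rewrite lerN2 ck lerDr.
  apply: (le_trans (gx ex)).
  have xe0 : x + e <= 0 by rewrite -lerBrDr sub0r ltW.
  have xx : x <= x + e by rewrite lerDl ltW.
  apply: (le_trans (fQ _ _ _ _ xx)); [by apply: P; exact: le_trans xe0|exact: P|].
  apply: ler_pM; rewrite ?subr_ge0 ?(le_scale hl) ?Qnd//.
  apply: lerB; apply: Qnd; rewrite ?oppr_le0//; last exact: le_trans xx xe0.
  by move: xk; rewrite ck opprD ltrBrDr => /ltW.
- move=> N; rewrite -mulr_sumr ler_wpM2l//.
  have -> : \sum_(i < N) (Q (- (i%:R * e)) - Q (- (i.+2%:R * e))) =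
      \sum_(i < N) ((- Q (- (i.+2%:R * e))) - (- Q (- (i%:R * e)))).
    by apply: eq_bigr => i _; rewrite opprK addrC.
  apply: (sum_double_increments (q := fun k => - Q (- (k%:R * e)))) => k.
    by rewrite lerN2 Qnd ?oppr_le0// lerN2 ck_nd.
  by rewrite mul0r oppr0 opprK addrC QK// oppr_le0.
Qed.

End shift_estimate.

(** * Recovery sequences *)

Section recovery_step.
Context {R : realType}.
Local Notation borelR := (measurableTypeR R).
Variables (m lambda : {measure set borelR -> \bar R}).
Hypotheses (hm : scrM m) (hl : scrM lambda).
Local Notation s := (scale lambda).
Variables (fp fm Qp Qm : R -> R) (K : R).
Hypotheses (fQp : controlled lambda Gpos fp Qp) (fQm : controlled lambda Gneg fm Qm).
Hypothesis QK : forall x y : R, 0 <= x -> y <= 0 -> (Qp x - Qp 0) + (Qm 0 - Qm y) <= K.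
Variable u : L2 m.
Hypotheses (ufp : {ae m, forall x, Gpos x -> u x = fp x})
  (ufm : {ae m, forall x, Gneg x -> u x = fm x}).
Hypotheses (vfp : vanishes_at_pinfty lambda fp) (vfm : vanishes_at_ninfty lambda fm).

Let J := fp 0 - fm 0.
Let Pp (x : R) : 0 <= x -> Gpos x.
Proof. by move=> x0; rewrite /Gpos /= in_itv/= andbT. Qed.
Let Pm (x : R) : x <= 0 -> Gneg x.
Proof. by move=> x0; rewrite /Gneg /= in_itv/=. Qed.

Let QpK (x : R) : 0 <= x -> 0 <= Qp x - Qp 0 <= K.
Proof.
move=> x0; have := QK x0 (lexx 0); rewrite subrr addr0 => ->; rewrite andbT subr_ge0.
by apply: (controlled_nondecreasing hl fQp) => //; exact: Pp.
Qed.
Let QmK (x : R) : x <= 0 -> 0 <= Qm 0 - Qm x <= K.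
Proof.
move=> x0; have := QK (lexx 0) x0; rewrite subrr add0r => ->; rewrite andbT subr_ge0.
by apply: (controlled_nondecreasing hl fQm) => //; exact: Pm.
Qed.
Let K_ge0 : 0 <= K.
Proof. by have /andP[h1 h2] := QpK (lexx 0); exact: le_trans h2. Qed.

Variables (gamma : {measure set borelR -> \bar R}) (e : R).
Hypothesis e_gt0 : 0 < e.
Hypothesis hg : finite_full_atomless_on `]- e, e[%classic gamma.
Local Notation L := (regularized e lambda gamma).
Let G := fine (gamma `]- e, e[%classic).

Let hL : scrM L.
Proof. exact: regularized_scrM. Qed.

Let sG : scale L e - scale L (- e) = G.
Proof. by rewrite /G -(regularized_scale_mid hl hg e_gt0). Qed.

Let e_nee : - e < e.
Proof. by have := e_gt0; lra. Qed.

Let G_gt0 : 0 < G.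
Proof. by rewrite -sG subr_gt0 (lt_scale hL). Qed.

(** The two branches are moved apart by [T_e], and joined by the function which is
   affine in the scale of the regularized measure; this scale increases by [G]
   over the gap. *)
Definition bridge (x : R) : R :=
  if e <= x then fp (x - e) else if x <= - e then fm (x + e)
  else fm 0 + J / G * (scale L x - scale L (- e)).

(** A function that controls [bridge] and vanishes at [- e], made of [Qp], [Qm] and
   the integral of the squared derivative over the gap, which is [J ^+ 2 / G]
   for the whole gap. *)
Definition bridge_energy (x : R) : R :=
  if e <= x then Qp (x - e) - Qp 0 + J ^+ 2 / G else if x <= - e then Qm (x + e) - Qm 0
  else (J / G) ^+ 2 * (scale L x - scale L (- e)).

Let bridge_mid (x : R) : - e <= x <= e -> bridge x = fm 0 + J / G * (scale L x - scale L (- e)) /\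
  bridge_energy x = (J / G) ^+ 2 * (scale L x - scale L (- e)).
Proof.
move=> /andP[ex xe]; rewrite /bridge /bridge_energy.
have G0 : G != 0 by rewrite gt_eqF.
have [ex'|_] := leP e x.
  have -> : x = e by apply/eqP; rewrite eq_le xe ex'.
  rewrite sG !subrr add0r; split; last by field.
  by rewrite /J; field.
have [xe'|_] := leP x (- e); last by [].
have -> : x = - e by apply/eqP; rewrite eq_le ex xe'.
by rewrite !subrr addNr !mulr0 addr0 subrr.
Qed.

Let bridge_neg (x : R) : x <= - e -> bridge x = fm (x + e) /\ bridge_energy x = Qm (x + e) - Qm 0.
Proof.
move=> xe; rewrite /bridge /bridge_energy xe.
by have -> : (e <= x) = false by rewrite leNgt (le_lt_trans xe).
Qed.

Let bridge_pos (x : R) : e <= x -> bridge x = fp (x - e) /\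
  bridge_energy x = Qp (x - e) - Qp 0 + J ^+ 2 / G.
Proof. by move=> ex; rewrite /bridge /bridge_energy ex. Qed.

Lemma bridge_controlled : controlled L setT bridge bridge_energy.
Proof.
have ee := ltW e_nee.
apply: (controlled_glue hL (a := - e)) => //.
  move=> x y [_ /= xe] [_ /= ye] xy.
  have [-> ->] := bridge_neg xe; have [-> ->] := bridge_neg ye.
  have x0 : x + e <= 0 by rewrite -lerBrDr sub0r.
  have y0 : y + e <= 0 by rewrite -lerBrDr sub0r.
  have := @regularized_scale_neg _ _ _ _ hl hg (x + e) (y + e) e_gt0 y0.
  rewrite lerD2r !addrK => -> //.
  have -> : Qm (y + e) - Qm 0 - (Qm (x + e) - Qm 0) = Qm (y + e) - Qm (x + e) by ring.
  by apply: fQm; [exact: Pm|exact: Pm|rewrite lerD2r].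
apply: (controlled_glue hL (a := e)) => //.
  move=> x y [[_ /= ex] /= xe] [[_ /= ey] /= ye] xy.
  have [-> ->] := bridge_mid (introT andP (conj ex xe)).
  have [-> ->] := bridge_mid (introT andP (conj ey ye)).
  by rewrite le_eqVlt; apply/orP; left; apply/eqP; ring.
move=> x y [_ /= ex] [_ /= ey] xy.
have [-> ->] := bridge_pos ex; have [-> ->] := bridge_pos ey.
have x0 : 0 <= x - e by rewrite subr_ge0.
have y0 : 0 <= y - e by rewrite subr_ge0.
have := @regularized_scale_pos _ _ _ _ hl hg (x - e) (y - e) e_gt0 x0.
rewrite lerD2r !subrK => -> //.
have -> : Qp (y - e) - Qp 0 + J ^+ 2 / G - (Qp (x - e) - Qp 0 + J ^+ 2 / G) =
  Qp (y - e) - Qp (x - e) by ring.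
by apply: fQp; [exact: Pp|exact: Pp|rewrite lerD2r].
Qed.

Lemma bridge_energy_le (x y : R) : x <= y -> bridge_energy y - bridge_energy x <= K + J ^+ 2 / G.
Proof.
move=> xy; pose x' := Num.min x (- e); pose y' := Num.max y e.
have nd a b : a <= b -> bridge_energy a <= bridge_energy b.
  by move=> ab; apply: (controlled_nondecreasing hL bridge_controlled).
have x'e : x' <= - e by rewrite /x' ge_min lexx orbT.
have y'e : e <= y' by rewrite /y' le_max lexx orbT.
apply: (@le_trans _ _ (bridge_energy y' - bridge_energy x')).
  by apply: lerB; apply: nd; rewrite /x' /y' ?le_max ?ge_min lexx.
have [_ ->] := bridge_neg x'e; have [_ ->] := bridge_pos y'e.
have x0 : x' + e <= 0 by rewrite -lerBrDr sub0r.
have y0 : 0 <= y' - e by rewrite subr_ge0.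
by have := QK y0 x0; lra.
Qed.

Lemma bridge_measurable : measurable_fun setT (bridge : borelR -> R).
Proof. exact: (controlled_measurable hL bridge_controlled bridge_energy_le). Qed.

Lemma bridge_vanishes : vanishes_at_pinfty L bridge /\ vanishes_at_ninfty L bridge.
Proof.
split.
  rewrite /vanishes_at_pinfty (regularized_Gpos lambda hg e_gt0) => /vfp fp0.
  apply/cvgrPdist_lt => d d0; have /cvgrPdist_lt/(_ _ d0)[A [Ar HA]] := fp0.
  exists (Num.max e (A + e)); split; first exact: num_real.
  move=> x; rewrite gt_max => /andP[/ltW ex Ax]; have [-> _] := bridge_pos ex.
  by apply: HA; rewrite ltrBrDr.
rewrite /vanishes_at_ninfty (regularized_Gneg hl hg e_gt0) => /vfm fm0.
apply/cvgrPdist_lt => d d0; have /cvgrPdist_lt/(_ _ d0)[A [Ar HA]] := fm0.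
exists (Num.min (- e) (A - e)); split; first exact: num_real.
move=> x; rewrite lt_min => /andP[/ltW xe xA]; have [-> _] := bridge_neg xe.
by apply: HA; rewrite -ltrBrDr.
Qed.

(** A bound on the squared difference between [bridge] and the original branches
   on the gap, the same for all [e <= 1]. *)
Definition bridge_bound : R :=
  (`|fm 0| + `|J| + (`|fp 0| + `|fm 0| + (1 + (s 1 - s (- 1)) * K))) ^+ 2.

Lemma bridge_near0 (x : R) : e <= 1 -> - e <= x <= e ->
  (0 <= x -> (bridge x - fp x) ^+ 2 <= bridge_bound) /\
  (x <= 0 -> (bridge x - fm x) ^+ 2 <= bridge_bound).
Proof.
move=> e1 xe; have [-> _] := bridge_mid xe; have /andP[ex xe'] := xe.
have h1 : `|fm 0 + J / G * (scale L x - scale L (- e))| <= `|fm 0| + `|J|.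
  apply: (le_trans (ler_normD _ _)); rewrite lerD2l normrM normrM normfV -mulrA.
  rewrite ler_piMr// (gtr0_norm G_gt0) mulrC ler_pdivrMr// mul1r.
  rewrite ger0_norm ?subr_ge0 ?(le_scale hL)// -sG lerB// (le_scale hL)//.
have sub v w z b : `|v| <= b -> (w - z) ^+ 2 <= (s 1 - s (-1)) * K ->
    `|z| <= `|fp 0| + `|fm 0| -> (v - w) ^+ 2 <=
    (b + (`|fp 0| + `|fm 0| + (1 + (s 1 - s (- 1)) * K))) ^+ 2.
  move=> vb /norm_le1 wz z0; rewrite -(real_normK (num_real (v - w))).
  rewrite ler_sqr ?nnegrE//; last first.
    by rewrite addr_ge0 ?(le_trans _ vb)// addr_ge0 ?(le_trans _ z0)// (le_trans _ wz).
  apply: (le_trans (ler_normB _ _)); apply: lerD => //.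
  have -> : w = z + (w - z) by ring.
  apply: (le_trans (ler_normD _ _)); exact: lerD.
have s11 : 0 <= s 1 - s (-1) by rewrite subr_ge0 (le_scale hl)// (le_trans lerN10).
split => x0; rewrite /bridge_bound.
- apply: (sub _ _ (fp 0)) => //; last by rewrite lerDl.
  apply: (le_trans (fQp _ _ _)); [exact: Pp|exact: Pp|by []|].
  have /andP[q0 qK] := QpK x0.
  apply: ler_pM => //; first by rewrite subr_ge0 (le_scale hl).
  by apply: lerB; apply: (le_scale hl) => //; exact: le_trans e1.
- apply: (sub _ _ (fm 0)) => //; last by rewrite lerDr.
  rewrite -sqrrN opprB; apply: (le_trans (fQm _ _ _)); [exact: Pm|exact: Pm|by []|].
  have /andP[q0 qK] := QmK x0.
  apply: ler_pM => //; first by rewrite subr_ge0 (le_scale hl).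
  apply: lerB; apply: (le_scale hl) => //.
  by apply: le_trans ex; rewrite lerN2.
Qed.

(** The first term comes from the translation of the branches, the second one from
   the gap. *)
Lemma bridge_distance (Mm Ml : R) : e <= 1 ->
  (forall x, (m `[x, (x + e)%R]%classic <= Mm%:E)%E) ->
  (forall x, s (x + e) - s x <= Ml) ->
  (\int[m]_x ((bridge x - u x) ^+ 2)%:E <=
   (4 * K * (Ml * Mm) + bridge_bound * (scale m e - scale m (- e)))%:E)%E.
Proof.
move=> e1 mM sM.
pose g (x : borelR) : R := (bridge x - u x) ^+ 2.
have mg : measurable_fun setT g.
  apply: measurable_funX; apply: measurable_funB; first exact: bridge_measurable.
  exact: L2_measurable.
have g0 x : 0 <= g x by exact: sqr_ge0.
have mgD D : measurable_fun D (EFin \o g) by apply/measurable_EFinP; exact: measurable_funTS.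
have e0 := e_gt0.
have Ip : (\int[m]_(x in `]e, +oo[%classic) (g x)%:E <= (Ml * (2 * K) * Mm)%:E)%E.
  apply: (shift_estimate_pos hl e_gt0 mM sM fQp _ mg g0).
    by move=> x /QpK/andP[].
  have := ufp; apply: filterS; first exact: (ae_filter_ringOfSetsType m).
  move=> x ux ex; have x0 : 0 <= x by rewrite (le_trans (ltW e0))// ltW.
  by rewrite /g ux; [have [-> _] := bridge_pos (ltW ex)|exact: Pp].
have Im : (\int[m]_(x in `]-oo, (- e)%R[%classic) (g x)%:E <= (Ml * (2 * K) * Mm)%:E)%E.
  apply: (shift_estimate_neg hl e_gt0 mM sM fQm _ mg g0).
    by move=> x /QmK/andP[].
  have := ufm; apply: filterS; first exact: (ae_filter_ringOfSetsType m).
  move=> x ux ex.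
  have x0 : x <= 0 by rewrite (le_trans (ltW ex))// oppr_le0 ltW.
  by rewrite /g ux; [have [-> _] := bridge_neg (ltW ex)|exact: Pm].
have I0 : (\int[m]_(x in `[(- e)%R, e]%classic) (g x)%:E <=
    (bridge_bound * (scale m e - scale m (- e)))%:E)%E.
  apply: (@le_trans _ _ (\int[m]_(x in `[(- e)%R, e]%classic) (cst bridge_bound%:E x))%E).
    2: by rewrite integral_cst ?EFinM ?(scale_itvcc hm (ltW e_nee))//; exact: measurable_itv.
  apply: ae_ge0_le_integral => //.
  - by move=> x _; rewrite lee_fin.
  - by move=> x _; rewrite lee_fin sqr_ge0.
  - have := ufm; have := ufp; apply: filterS2; first exact: (ae_filter_ringOfSetsType m).
    move=> x up um; rewrite /= in_itv/= => xe; rewrite lee_fin.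
    have [b1 b2] := bridge_near0 e1 xe; rewrite /g.
    have [x0|/ltW x0] := leP 0 x; first by rewrite up ?b1//; exact: Pp.
    by rewrite um ?b2//; exact: Pm.
have -> : [set: borelR] = (`]-oo, (- e)%R[ `|` `[(- e)%R, e]) `|` `]e, +oo[.
  apply/seteqP; split => // x _; rewrite /= !in_itv/= andbT.
  have [xe|ex] := ltP x (- e); first by left; left.
  by have [xe|ex'] := leP x e; [left; right|right].
rewrite ge0_integral_setU//=.
- rewrite ge0_integral_setU//=.
  + apply: (@le_trans _ _ ((Ml * (2 * K) * Mm)%:E + (bridge_bound * (scale m e - scale m (- e)))%:E + (Ml * (2 * K) * Mm)%:E)%E).
      by apply: leeD => //; exact: leeD.
    rewrite -!EFinD lee_fin le_eqVlt; apply/orP; left; apply/eqP; ring.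
  + by move=> x _; rewrite lee_fin sqr_ge0.
  + rewrite disj_set2E; apply/eqP; rewrite -subset0 => x [/=].
    by rewrite !in_itv/= => h /andP[]; rewrite leNgt h.
- exact: measurableU.
- by move=> x _; rewrite lee_fin sqr_ge0.
- rewrite disj_set2E; apply/eqP; rewrite -subset0 => x [/= [|]]; rewrite !in_itv/= andbT.
    by move=> h1 h2; have := lt_trans (lt_trans e_nee h2) h1; rewrite ltxx.
  by move=> /andP[_]; rewrite leNgt => /negP.
Qed.

Lemma recovery_step (Mm Ml : R) : e <= 1 ->
  (forall x, (m `[x, (x + e)%R]%classic <= Mm%:E)%E) ->
  (forall x, s (x + e) - s x <= Ml) ->
  exists v : L2 m, [/\
    (\int[m]_x ((v - u) x ^+ 2)%:E <=
      (4 * K * (Ml * Mm) + bridge_bound * (scale m e - scale m (- e)))%:E)%E,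
    v \in form_dom (form_line m L) &
    form_val (form_line m L) v v <= (K + J ^+ 2 / G) / 2].
Proof.
move=> e1 mM sM; have dist := bridge_distance e1 mM sM.
have md : measurable_fun setT (fun x : borelR => bridge x - u x).
  by apply: measurable_funB; [exact: bridge_measurable|exact: L2_measurable].
have dL : (fun x : borelR => bridge x - u x) \in Lfun m 2%:E.
  by apply: L2_mem => //; exact: le_lt_trans dist (ltry _).
pose v : L2 m := L2_of dL + u.
have vE x : v x = bridge x by rewrite /v /= subrK.
have vb : energy_bounded L setT bridge (K + J ^+ 2 / G).
  apply: (@controlled_energy_bounded _ _ hL setT _ bridge_energy _ 0) => //.
    exact: bridge_controlled.
  by move=> x y _ _; exact: bridge_energy_le.
have [vac vfin ven] : [/\ ac_version L setT v bridge, finite_energy L setT bridge &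
    energy L setT (version L setT v) (version L setT v) <= (K + J ^+ 2 / G) / 2].
  apply: (energy_bounded_version hm hL (dyadic_adapted_setT) _ regular_setT _ vb) => //.
  by apply: nearW => x _; exact: vE.
have [vp vn] := bridge_vanishes.
exists v; split => //; last by rewrite inE; exists bridge.
apply: le_trans dist; rewrite le_eqVlt; apply/orP; left; apply/eqP.
by apply: eq_integral => x _; rewrite /v /= addrK.
Qed.

End recovery_step.

Section recovery_sequence.
Context {R : realType}.
Local Notation borelR := (measurableTypeR R).
Variables (m lambda : {measure set borelR -> \bar R}).
Hypotheses (hm : scrM m) (hl : scrM lambda).

Lemma max_mass_gt0 (nu : {measure set borelR -> \bar R}) (e : R) : scrM nu -> 0 < e ->
  (0 < max_mass e nu)%E.
Proof.
move=> [_ nuU _] e0; apply: (@lt_le_trans _ _ (nu `]0, e[%classic)).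
  apply: nuU; first exact: interval_open.
  by exists (e / 2); rewrite /= in_itv/=; apply/andP; split; lra.
apply: (@le_trans _ _ (nu `[0, 0 + e]%classic)).
  rewrite add0r; apply: le_measure; rewrite ?inE; [exact: measurable_itv..|].
  exact: subset_itv_oo_cc.
by apply: ereal_sup_ubound; exists 0.
Qed.

Lemma max_mass_le (nu : {measure set borelR -> \bar R}) (e x : R) :
  max_mass e nu \is a fin_num -> (nu `[x, (x + e)%R]%classic <= (fine (max_mass e nu))%:E)%E.
Proof. by move=> /fineK ->; apply: ereal_sup_ubound; exists x. Qed.

Lemma Lnorm2_le (v : borelR -> R) (b : R) : (\int[m]_x (v x ^+ 2)%:E <= b%:E)%E ->
  ('N[m]_2%:E[EFin \o v] <= (Num.sqrt b)%:E)%E.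
Proof.
rewrite -Lnorm2_sqr; have := Lnorm_ge0 m 2%:E (EFin \o v).
case: ('N[m]_2%:E[EFin \o v])%E => [r| |//].
  rewrite poweR_EFin !lee_fin => r0; rewrite powR_mulrn// => rb.
  by rewrite -[r](ger0_norm r0) -sqrtr_sqr ler_wsqrtr.
by rewrite poweRyr.
Qed.

Variables (gamma : nat -> {measure set borelR -> \bar R}) (eps : nat -> R).
Hypotheses (eps_gt0 : forall n, 0 < eps n) (eps_cvg0 : eps @ \oo --> (0 : R)).
Hypothesis hg : forall n, finite_full_atomless_on `]- eps n, eps n[%classic (gamma n).
Hypothesis mass_cvg0 :
  (max_mass (eps n) lambda * max_mass (eps n) m)%E @[n --> \oo] --> 0%E.
Local Notation L n := (regularized (eps n) lambda (gamma n)).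

(** As the suprema are positive, they are finite once their product is. *)
Let near_finite : \forall n \near \oo,
  max_mass (eps n) lambda \is a fin_num /\ max_mass (eps n) m \is a fin_num.
Proof.
move/fine_cvgP : mass_cvg0 => [+ _]; apply: filterS => n.
have l0 := max_mass_gt0 hl (eps_gt0 n); have m0 := max_mass_gt0 hm (eps_gt0 n).
rewrite !ge0_fin_numE ?mule_ge0 ?(ltW l0) ?(ltW m0)//.
case: (max_mass (eps n) lambda) l0 => [a| |//] l0; last by rewrite gt0_mulye.
case: (max_mass (eps n) m) m0 => [b| |//] m0; last by rewrite gt0_muley.
by rewrite !ltry.
Qed.

Let mass_fine_cvg0 :
  fine (max_mass (eps n) lambda) * fine (max_mass (eps n) m) @[n --> \oo] --> (0 : R).
Proof.
have /fine_cvg := mass_cvg0; apply: cvg_trans; apply: near_eq_cvg.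
by apply: filterS near_finite => n [h1 h2] /=; rewrite fineM.
Qed.

Variables (fp fm Qp Qm : R -> R) (K : R).
Hypotheses (fQp : controlled lambda Gpos fp Qp) (fQm : controlled lambda Gneg fm Qm).
Hypothesis QK : forall x y : R, 0 <= x -> y <= 0 -> (Qp x - Qp 0) + (Qm 0 - Qm y) <= K.
Variable u : L2 m.
Hypotheses (ufp : {ae m, forall x, Gpos x -> u x = fp x})
  (ufm : {ae m, forall x, Gneg x -> u x = fm x}).
Hypotheses (vfp : vanishes_at_pinfty lambda fp) (vfm : vanishes_at_ninfty lambda fm).

Lemma recovery_sequence : exists2 u_ : nat -> L2 m, strong_cvg u_ u &
  \forall n \near \oo, u_ n \in form_dom (form_line m (L n)) /\
    form_val (form_line m (L n)) (u_ n) (u_ n) <=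
    (K + (fp 0 - fm 0) ^+ 2 / fine (gamma n `]- eps n, eps n[%classic)) / 2.
Proof.
pose b n := 4 * K * (fine (max_mass (eps n) lambda) * fine (max_mass (eps n) m)) +
  bridge_bound lambda fp fm K * (scale m (eps n) - scale m (- eps n)).
(* Any choice will do for the finitely many n that are not good. *)
pose good n := eps n <= 1 /\
  (max_mass (eps n) lambda \is a fin_num /\ max_mass (eps n) m \is a fin_num).
have step n : exists v : L2 m, good n ->
  [/\ (\int[m]_x ((v - u) x ^+ 2)%:E <= (b n)%:E)%E, v \in form_dom (form_line m (L n)) &
    form_val (form_line m (L n)) v v <=
    (K + (fp 0 - fm 0) ^+ 2 / fine (gamma n `]- eps n, eps n[%classic)) / 2].
  have [[e1 [lf mf]]|ng] := pselect (good n); last by exists u.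
  have [||v Hv] := recovery_step hm hl fQp fQm QK ufp ufm vfp vfm (eps_gt0 n) (hg n)
      (Mm := fine (max_mass (eps n) m)) (Ml := fine (max_mass (eps n) lambda)) e1.
  - by move=> x; exact: max_mass_le.
  - move=> x; rewrite -lee_fin -(scale_itvcc hl); last by rewrite lerDl ltW.
    exact: max_mass_le.
  by exists v.
have [u_ Hu] := choice step.
have ngood : \forall n \near \oo, good n.
  have near1 : \forall n \near \oo, eps n <= 1.
    have /cvgrPdist_le/(_ _ ltr01) := eps_cvg0; apply: filterS => n.
    by rewrite sub0r normrN; apply: le_trans; exact: ler_norm.
  by apply: filterS2 near1 near_finite => n h1 h2; split.
exists u_; last by apply: filterS ngood => n /Hu[_ h1 h2]; split.
have b0 : b n @[n --> \oo] --> (0 : R).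
  rewrite -[0]addr0; apply: cvgD.
    by rewrite -[X in _ --> X](mulr0 (4 * K)); apply: cvgMl_tmp.
  rewrite -[X in _ --> X](mulr0 (bridge_bound lambda fp fm K)); apply: cvgMl_tmp.
  rewrite -[0](subrr (scale m 0)); apply: cvgB.
    exact: (cvg_comp eps (scale m) eps_cvg0 (continuous_scale hm (x := 0))).
  have Ne0 : - eps n @[n --> \oo] --> (0 : R) by rewrite -[X in _ --> X]oppr0; exact: cvgN.
  exact: (cvg_comp (fun n => - eps n) (scale m) Ne0 (continuous_scale hm (x := 0))).
have sb0 : (Num.sqrt (b n))%:E @[n --> \oo] --> 0%E.
  apply: cvg_EFin; first by apply: nearW.
  rewrite -[X in _ --> X]sqrtr0; apply: continuous_cvg => //.
  exact: sqrt_continuous.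
apply: (squeeze_cvge _ _ sb0); last exact: cvg_cst.
apply: filterS ngood => n /Hu[h1 _ _]; rewrite Lnorm_ge0/=.
exact: Lnorm2_le.
Qed.

End recovery_sequence.

(** * Mosco convergence *)

Section mosco_tools.
Context {R : realType}.
Local Notation borelR := (measurableTypeR R).

Lemma lee_real_upper (x y : \bar R) :
  (forall c : R, (y < c%:E)%E -> (x <= c%:E)%E) -> (x <= y)%E.
Proof.
case: y => [r| |] H; last 1 first.
- case: x H => [x H|H|//].
    have := H (x - 1)%R (ltNyr _); by rewrite lee_fin lerBrDr gerDl ler10.
  by have := H 0 (ltNyr _); rewrite leye_eq.
- apply/lee_addgt0Pr => e e0; rewrite -EFinD; apply: H.
  by rewrite lte_fin ltrDl.
- exact: leey.
Qed.

Lemma limn_esup_le_near (v : nat -> R) (a : R) (w : (\bar R)^nat) :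
  v n @[n --> \oo] --> a -> (\forall n \near \oo, (w n <= (v n)%:E)%E) ->
  (limn_esup w <= a%:E)%E.
Proof.
move=> va wv; apply/lee_addgt0Pr => e e0.
have /cvgrPdist_le/(_ _ e0) va' := va.
have [N _ HN] : \forall n \near \oo, (w n <= a%:E + e%:E)%E.
  apply: filterS2 va' wv => n h1 h2; apply: (le_trans h2).
  rewrite -EFinD lee_fin -lerBlDl; apply: le_trans h1.
  by rewrite distrC; exact: ler_norm.
by apply: (@limn_esup_le _ _ _ N) => n Nn; exact: HN.
Qed.

Lemma cvg_extraction (phi : nat -> nat) : (forall n, (n <= phi n)%N) ->
  phi n @[n --> \oo] --> \oo.
Proof.
move=> phin; apply/cvgnyPge => A; exists A => // n /= An; exact: leq_trans (phin n).
Qed.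

Lemma form_ext_le (V : Type) (A : bform R V) (u : V) (c : R) :
  (form_ext A u <= c%:E)%E <-> form_dom A u /\ form_val A u u <= c.
Proof.
rewrite /form_ext; case: ifPn; rewrite ?notin_setE ?inE => h.
  by rewrite lee_fin; split => [|[]].
by split => [|[]//]; rewrite leye_eq.
Qed.

Lemma gap_mass_gt0 (g : {measure set borelR -> \bar R}) (e : R) : 0 < e ->
  finite_full_atomless_on `]- e, e[%classic g ->
  g `]- e, e[%classic \is a fin_num /\ 0 < fine (g `]- e, e[%classic).
Proof.
move=> e0 [_ gfin gU _].
have g0 : (0 < g `](- e)%R, e[%classic)%E.
  apply: gU; [exact: interval_open|by []|].
  by exists 0; rewrite /= in_itv/= oppr_lt0 e0.
by split; [rewrite ge0_fin_numE|rewrite fine_gt0// g0].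
Qed.

End mosco_tools.

Section mosco.
Context {R : realType}.
Local Notation borelR := (measurableTypeR R).
Variables (m lambda : {measure set borelR -> \bar R}).
Hypotheses (hm : scrM m) (hl : scrM lambda).
Variables (gamma : nat -> {measure set borelR -> \bar R}) (eps : nat -> R).
Hypotheses (eps_gt0 : forall n, 0 < eps n) (eps_cvg0 : eps @ \oo --> (0 : R)).
Hypothesis hg : forall n, finite_full_atomless_on `]- eps n, eps n[%classic (gamma n).
Local Notation L n := (regularized (eps n) lambda (gamma n)).
Local Notation G n := (fine (gamma n `]- eps n, eps n[%classic)).

(** Along a subsequence [phi] whose energies stay below [c], [a n] and [b n] are
   the values at the two ends of the gap, and [d n] is the part of the bound
   [2 * c] that is spent on the gap.  The weak limit has branches [Fp] and [Fm],
   to which the limit of what has been spent on the gap is not available. *)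
Lemma liminf_limits (u_ : nat -> L2 m) (u : L2 m) (c : R) : weak_cvg u_ u ->
  (limn_einf (fun n => form_ext (form_line m (L n)) (u_ n)) < c%:E)%E ->
  exists (phi : nat -> nat) (a b d : nat -> R) (Fp Fm : R -> R),
  [/\ (forall n, (n <= phi n)%N),
      [/\ {ae m, forall x, Gpos x -> u x = Fp x}, {ae m, forall x, Gneg x -> u x = Fm x},
          vanishes_at_pinfty lambda Fp & vanishes_at_ninfty lambda Fm],
      a n @[n --> \oo] --> Fp 0 /\ b n @[n --> \oo] --> Fm 0,
      forall n, (a n - b n) ^+ 2 <= G (phi n) * d n /\ 0 <= d n <= 2 * c &
      forall (J_ : nat -> R) (J : R), J_ n @[n --> \oo] --> J -> (forall n, J_ n <= d n) ->
        exists Cp Cm, [/\ Cp + Cm + J <= 2 * c, energy_bounded lambda Gpos Fp Cp &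
          energy_bounded lambda Gneg Fm Cm]].
Proof.
move=> uu /limn_einf_lt lt_c.
have /choice[phi Hphi] : forall n, exists k, (n <= k)%N /\
    (form_ext (form_line m (L k)) (u_ k) < c%:E)%E.
  by move=> n; have [k nk uk] := lt_c n; exists k.
have phin n : (n <= phi n)%N by case: (Hphi n).
have phioo := cvg_extraction phin.
have hLn k : scrM (L k) by exact: regularized_scrM.
have Hf n : exists fQ : (R -> R) * (R -> R), [/\ controlled (L (phi n)) setT fQ.1 fQ.2,
    (forall x, 0 <= fQ.2 x <= 2 * c), {ae m, forall x, u_ (phi n) x = fQ.1 x},
    vanishes_at_pinfty (L (phi n)) fQ.1 & vanishes_at_ninfty (L (phi n)) fQ.1].
  have [_ /ltW/form_ext_le[[f [uf ffin fp fn]] uc]] := Hphi n.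
  have [Q fQ Qe] := version_controlled hm (hLn _) (fun x y _ _ z _ => I) regular_setT uf ffin.
  exists (f, Q); split => //=.
    move=> x; have /andP[-> /le_trans->//] := Qe x I.
    by rewrite ler_pM2l.
  have [uf' _] := uf; move: uf'; apply: filterS; first exact: (ae_filter_ringOfSetsType m).
  by move=> x; exact.
have [fQ HfQ] := choice Hf.
have uu' : weak_cvg (u_ \o phi) u.
  by move=> v; exact: (cvg_comp phi (fun n => \int[m]_x (u_ n x * v x)) phioo (uu v)).
have eps0' : (eps \o phi) @ \oo --> (0 : R) by exact: (cvg_comp phi eps phioo eps_cvg0).
have [|||||Fp [Fm [[Fpae Fmae] [Fpc Fmc] gap en [vp vn]]]] := @bounded_energy_limit _ m lambda hm hl
  (gamma \o phi) (eps \o phi) _ eps0' _ (fun n => (fQ n).1) (fun n => (fQ n).2) (2 * c)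
  _ _ (u_ \o phi) u uu' _.
- by move=> n; exact: eps_gt0.
- by move=> n; exact: hg.
- by move=> n; have [] := HfQ n.
- by move=> n; have [] := HfQ n.
- by move=> n; have [] := HfQ n.
exists phi, (fun n => (fQ n).1 (eps (phi n))), (fun n => (fQ n).1 (- eps (phi n))),
  (fun n => (fQ n).2 (eps (phi n)) - (fQ n).2 (- eps (phi n))), Fp, Fm; split => //.
- split => //; [apply: vp|apply: vn] => n; by have [] := HfQ n.
- move=> n; split; first exact: gap.
  have [fQn Qn _ _ _] := HfQ n.
  have ee : - eps (phi n) <= eps (phi n) by have := eps_gt0 (phi n); lra.
  rewrite subr_ge0 (controlled_nondecreasing (hLn _) fQn)//=.
  have /andP[h1 h2] := Qn (eps (phi n)); have /andP[h3 h4] := Qn (- eps (phi n)).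
  by rewrite lerBlDr (le_trans h2)// lerDl.
Qed.

Section recovery.
Hypothesis mass_cvg0 :
  (max_mass (eps n) lambda * max_mass (eps n) m)%E @[n --> \oo] --> 0%E.

Lemma recovery_limsup (fp fm Qp Qm : R -> R) (K a : R) (u : L2 m) :
  controlled lambda Gpos fp Qp -> controlled lambda Gneg fm Qm ->
  (forall x y : R, 0 <= x -> y <= 0 -> (Qp x - Qp 0) + (Qm 0 - Qm y) <= K) ->
  {ae m, forall x, Gpos x -> u x = fp x} -> {ae m, forall x, Gneg x -> u x = fm x} ->
  vanishes_at_pinfty lambda fp -> vanishes_at_ninfty lambda fm ->
  (fp 0 - fm 0) ^+ 2 / G n @[n --> \oo] --> a ->
  exists2 u_ : nat -> L2 m, strong_cvg u_ u &
    (limn_esup (fun n => form_ext (form_line m (L n)) (u_ n)) <= ((K + a) / 2)%:E)%E.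
Proof.
move=> fQp fQm QK up um vp vm Ga.
have [u_ uu un] := recovery_sequence hm hl eps_gt0 eps_cvg0 hg mass_cvg0 fQp fQm QK up um vp vm.
exists u_ => //.
apply: (@limn_esup_le_near _ (fun n => (K + (fp 0 - fm 0) ^+ 2 / G n) / 2)).
  by apply: cvgMr_tmp; apply: cvgD => //; exact: cvg_cst.
apply: filterS un => n [h1 h2]; apply/form_ext_le; split => //.
by move: h1; rewrite inE.
Qed.

End recovery.

(** Outside the domain the constant sequence is a recovery sequence. *)
Lemma recovery_reduction (A_ : nat -> bform R (L2 m)) (A : bform R (L2 m)) :
  (forall u, form_dom A u -> exists2 u_ : nat -> L2 m, strong_cvg u_ u &
    (limn_esup (fun n => form_ext (A_ n) (u_ n)) <= (form_val A u u)%:E)%E) ->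
  forall u, exists2 u_ : nat -> L2 m, strong_cvg u_ u &
    (limn_esup (fun n => form_ext (A_ n) (u_ n)) <= form_ext A u)%E.
Proof.
move=> H u; rewrite /form_ext; case: ifPn => [|_]; first by rewrite inE => /H.
exists (fun=> u); last exact: leey.
rewrite /strong_cvg subrr.
have -> : ('N[m]_2%:E[EFin \o (0%R : L2 m)])%E = 0%E.
  by have -> : EFin \o (0%R : L2 m) = cst 0%E by []; rewrite Lnorm0.
exact: cvg_cst.
Qed.

End mosco.

Lemma oscillations_le (R : realType) (E1 E2 p p0 n n0 : R) :
  p <= 2 * E1 -> 0 <= p0 -> 0 <= n -> n0 <= 2 * E2 -> (p - p0) + (n0 - n) <= 2 * (E1 + E2).
Proof. by move=> h1 h2 h3 h4; rewrite mulrDr lerD// lerBlDr ler_wpDr. Qed.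

Lemma half_sum_le (R : realType) (E1 E2 Cp Cm c : R) :
  E1 <= Cp / 2 -> E2 <= Cm / 2 -> Cp + Cm <= 2 * c -> E1 + E2 <= c.
Proof. by move=> h1 h2 h3; rewrite (le_trans (lerD h1 h2))// -mulrDl ler_pdivrMr// mulrC. Qed.

Lemma snapping_term (R : realType) (g j : R) : g != 0 -> 2 / g / 4 * (j * j) = j ^+ 2 / g / 2.
Proof. by move=> g0; field. Qed.

Section limit_forms.
Context {R : realType}.
Local Notation borelR := (measurableTypeR R).
Variables (m lambda : {measure set borelR -> \bar R}).
Hypotheses (hm : scrM m) (hl : scrM lambda).

Let Gpos0 : Gpos (0 : R).
Proof. by rewrite /Gpos /= in_itv/= lexx. Qed.

Let Gneg0 : Gneg (0 : R).
Proof. by rewrite /Gneg /= in_itv/= lexx. Qed.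

Lemma form_pos_data (u : L2 m) : form_dom (form_pos m lambda) u ->
  exists fp Qp : R -> R, [/\ controlled lambda Gpos fp Qp,
    forall x, 0 <= x -> 0 <= Qp x <= 2 * form_val (form_pos m lambda) u u,
    {ae m, forall x, Gpos x -> u x = fp x}, vanishes_at_pinfty lambda fp &
    version lambda Gpos u 0 = fp 0].
Proof.
move=> [f [uf ffin fv]].
have [Q fQ Qe] := version_controlled hm hl (@interval_is_interval _ _) regular_Gpos uf ffin.
exists f, Q; split => //.
- by move=> x x0; apply: Qe; rewrite /Gpos /= in_itv/= andbT.
- exact: uf.1.
- exact: (versionE hm hl regular_Gpos uf).
Qed.

Lemma form_neg_data (u : L2 m) : form_dom (form_neg m lambda) u ->
  exists fm Qm : R -> R, [/\ controlled lambda Gneg fm Qm,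
    forall x, x <= 0 -> 0 <= Qm x <= 2 * form_val (form_neg m lambda) u u,
    {ae m, forall x, Gneg x -> u x = fm x}, vanishes_at_ninfty lambda fm &
    version lambda Gneg u 0 = fm 0].
Proof.
move=> [f [uf ffin fv]].
have [Q fQ Qe] := version_controlled hm hl (@interval_is_interval _ _) regular_Gneg uf ffin.
exists f, Q; split => //.
- exact: uf.1.
- exact: (versionE hm hl regular_Gneg uf).
Qed.

Lemma form_pos_bounded (u : L2 m) (Fp : R -> R) (C : R) :
  {ae m, forall x, Gpos x -> u x = Fp x} -> vanishes_at_pinfty lambda Fp ->
  energy_bounded lambda Gpos Fp C ->
  [/\ form_dom (form_pos m lambda) u, form_val (form_pos m lambda) u u <= C / 2 &
    version lambda Gpos u 0 = Fp 0].
Proof.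
move=> uF vF FC.
have [uac ufin uC] := energy_bounded_version hm hl dyadic_adapted_Gpos Gpos0 regular_Gpos uF FC.
split => //; first by exists Fp.
exact: (versionE hm hl regular_Gpos uac).
Qed.

Lemma form_neg_bounded (u : L2 m) (Fm : R -> R) (C : R) :
  {ae m, forall x, Gneg x -> u x = Fm x} -> vanishes_at_ninfty lambda Fm ->
  energy_bounded lambda Gneg Fm C ->
  [/\ form_dom (form_neg m lambda) u, form_val (form_neg m lambda) u u <= C / 2 &
    version lambda Gneg u 0 = Fm 0].
Proof.
move=> uF vF FC.
have [uac ufin uC] := energy_bounded_version hm hl dyadic_adapted_Gneg Gneg0 regular_Gneg uF FC.
split => //; first by exists Fm.
exact: (versionE hm hl regular_Gneg uac).
Qed.

(** Two branches which agree at the origin make up one function on the line. *)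
Lemma form_line_bounded (u : L2 m) (Fp Fm : R -> R) (Cp Cm : R) :
  {ae m, forall x, Gpos x -> u x = Fp x} -> {ae m, forall x, Gneg x -> u x = Fm x} ->
  vanishes_at_pinfty lambda Fp -> vanishes_at_ninfty lambda Fm ->
  energy_bounded lambda Gpos Fp Cp -> energy_bounded lambda Gneg Fm Cm ->
  Fp 0 = Fm 0 ->
  form_dom (form_line m lambda) u /\ form_val (form_line m lambda) u u <= (Cp + Cm) / 2.
Proof.
move=> uFp uFm vp vm FCp FCm F0.
pose F x := if 0 <= x then Fp x else Fm x.
have Fpos x : Gpos x -> F x = Fp x by rewrite /Gpos /= in_itv/= andbT /F => ->.
have Fneg x : Gneg x -> F x = Fm x.
  rewrite /Gneg /= in_itv/= /F => x0; have [x0'|//] := leP 0 x.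
  by have -> : x = 0 by apply/eqP; rewrite eq_le x0 x0'.
have F_ae : {ae m, forall x, setT x -> u x = F x}.
  have := uFm; have := uFp; apply: filterS2; first exact: (ae_filter_ringOfSetsType m).
  move=> x up um _; have [x0|/ltW x0] := leP 0 x.
    by rewrite up ?Fpos// /Gpos /= in_itv/= andbT.
  by rewrite um ?Fneg// /Gneg /= in_itv/=.
have FC : energy_bounded lambda setT F (Cp + Cm).
  apply: (energy_bounded_glue hl).
    move=> n a b ab tab; apply: le_trans (FCp n a b ab tab).
    by apply: ler_sum => i _; have [_ /Fpos -> /Fpos ->] := ab i (ltn_ord i).
  move=> n a b ab tab; apply: le_trans (FCm n a b ab tab).
  by apply: ler_sum => i _; have [_ /Fneg -> /Fneg ->] := ab i (ltn_ord i).
have [uac ufin uC] := energy_bounded_version hm hl dyadic_adapted_setT I regular_setT F_ae FC.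
split => //; exists F; split => //.
- move=> /vp; apply: cvg_trans; apply: near_eq_cvg.
  near=> x; apply/esym; apply: Fpos; rewrite /Gpos /= in_itv/= andbT.
  by near: x; apply: nbhs_pinfty_ge; exact: num_real.
- move=> /vm; apply: cvg_trans; apply: near_eq_cvg.
  near=> x; apply/esym; apply: Fneg; rewrite /Gneg /= in_itv/=.
  by near: x; apply: nbhs_ninfty_le; exact: num_real.
Unshelve. all: by end_near. Qed.

Variables (gamma : nat -> {measure set borelR -> \bar R}) (eps : nat -> R).
Hypotheses (eps_gt0 : forall n, 0 < eps n) (eps_cvg0 : eps @ \oo --> (0 : R)).
Hypothesis hg : forall n, finite_full_atomless_on `]- eps n, eps n[%classic (gamma n).
Hypothesis mass_cvg0 :
  (max_mass (eps n) lambda * max_mass (eps n) m)%E @[n --> \oo] --> 0%E.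
Local Notation L n := (regularized (eps n) lambda (gamma n)).
Local Notation G n := (fine (gamma n `]- eps n, eps n[%classic)).

Let G_gt0 n : 0 < G n.
Proof. by have [] := gap_mass_gt0 (eps_gt0 n) (hg n). Qed.

(** [a] is the limit of the squared derivatives of the bridges, integrated over
   the gap; half of it is added to the energy. *)
Let recovery_two_sided (u : L2 m) (a : R) : form_dom (form_two_sided m lambda) u ->
  (jump lambda u) ^+ 2 / G n @[n --> \oo] --> a ->
  exists2 u_ : nat -> L2 m, strong_cvg u_ u &
    (limn_esup (fun n => form_ext (form_line m (L n)) (u_ n)) <=
      (form_val (form_two_sided m lambda) u u + a / 2)%:E)%E.
Proof.
move=> [/form_pos_data[fp [Qp [fQp QpE up vp up0]]] /form_neg_data[fm [Qm [fQm QmE um vm um0]]]].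
rewrite /jump up0 um0 => Ga.
pose K := 2 * form_val (form_two_sided m lambda) u u.
have -> : form_val (form_two_sided m lambda) u u + a / 2 = (K + a) / 2 by rewrite /K; field.
apply: (recovery_limsup hm hl eps_gt0 eps_cvg0 hg mass_cvg0 fQp fQm _ up um vp vm Ga).
move=> x y x0 y0.
have /andP[_ p1] := QpE _ x0; have /andP[p2 _] := QpE _ (lexx 0).
have /andP[n1 _] := QmE _ y0; have /andP[_ n2] := QmE _ (lexx 0).
exact: (@oscillations_le _ _ _ _ _ _ _ p1 p2 n1 n2).
Qed.

Lemma mosco_two_sided : G n @[n --> \oo] --> +oo ->
  Mosco (fun n => form_line m (L n)) (form_two_sided m lambda).
Proof.
move=> Goo; split.
  move=> u_ u uu; apply: lee_real_upper => c.
  move=> /(liminf_limits hm hl eps_gt0 eps_cvg0 hg uu).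
  move=> [phi [a [b [d [Fp [Fm [_ [uFp uFm vp vm] _ gap en]]]]]]].
  have [|Cp [Cm [CC bp bm]]] := en (cst 0) 0 (cvg_cst _).
    by move=> n; have [_ /andP[]] := gap n.
  have [dp Ep _] := form_pos_bounded uFp vp bp; have [dm Em _] := form_neg_bounded uFm vm bm.
  apply/form_ext_le; split => //; move: CC; rewrite addr0 => CC.
  exact: (half_sum_le Ep Em CC).
apply: recovery_reduction => u du.
have -> : form_val (form_two_sided m lambda) u u =
  form_val (form_two_sided m lambda) u u + 0 / 2 by rewrite mul0r addr0.
apply: recovery_two_sided => //.
rewrite -[X in _ --> X](mulr0 ((jump lambda u) ^+ 2)); apply: cvgMl_tmp.
by apply/gtr0_cvgV0 => //; apply: nearW.
Qed.

Lemma mosco_snapping (g : R) : 0 < g -> G n @[n --> \oo] --> g ->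
  Mosco (fun n => form_line m (L n)) (form_snapping m lambda (2 / g)).
Proof.
move=> g0 Gg; have gN0 : g != 0 by rewrite gt_eqF.
split.
  move=> u_ u uu; apply: lee_real_upper => c.
  move=> /(liminf_limits hm hl eps_gt0 eps_cvg0 hg uu).
  move=> [phi [a [b [d [Fp [Fm [phin [uFp uFm vp vm] [aF bF] gap en]]]]]]].
  have Gphi : G (phi n) @[n --> \oo] --> g.
    exact: (cvg_comp phi (fun n => G n) (cvg_extraction phin) Gg).
  have [||Cp [Cm [CC bp bm]]] :=
      en (fun n => (a n - b n) ^+ 2 / G (phi n)) ((Fp 0 - Fm 0) ^+ 2 / g).
  - by apply: cvgM; [apply: cvg_sqr; exact: cvgB|exact: cvgV].
  - by move=> n; have [gp _] := gap n; rewrite ler_pdivrMr// mulrC.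
  have [dp Ep Fp0] := form_pos_bounded uFp vp bp.
  have [dm Em Fm0] := form_neg_bounded uFm vm bm.
  apply/form_ext_le; split => //; rewrite /form_snapping/= /jump Fp0 Fm0.
  rewrite snapping_term//.
  apply: le_trans (lerD (lerD Ep Em) (lexx _)) _.
  by rewrite -!mulrDl ler_pdivrMr// [leRHS]mulrC.
apply: recovery_reduction => u du.
have Gj : (jump lambda u) ^+ 2 / G n @[n --> \oo] --> (jump lambda u) ^+ 2 / g.
  by apply: cvgMl_tmp; exact: cvgV.
have [u_ uu un] := recovery_two_sided du Gj.
exists u_ => //; apply: le_trans un _; rewrite lee_fin -snapping_term//.
Qed.

Lemma mosco_line : G n @[n --> \oo] --> (0 : R) ->
  Mosco (fun n => form_line m (L n)) (form_line m lambda).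
Proof.
move=> G0; split.
  move=> u_ u uu; apply: lee_real_upper => c.
  move=> /(liminf_limits hm hl eps_gt0 eps_cvg0 hg uu).
  move=> [phi [a [b [d [Fp [Fm [phin [uFp uFm vp vm] [aF bF] gap en]]]]]]].
  have [|Cp [Cm [CC bp bm]]] := en (cst 0) 0 (cvg_cst _).
    by move=> n; have [_ /andP[]] := gap n.
  have Gphi : G (phi n) @[n --> \oo] --> (0 : R).
    exact: (cvg_comp phi (fun n => G n) (cvg_extraction phin) G0).
  have F0 : Fp 0 = Fm 0.
    apply/eqP; rewrite -subr_eq0 -sqrf_eq0 eq_le sqr_ge0 andbT.
    have sq : (a n - b n) ^+ 2 @[n --> \oo] --> (Fp 0 - Fm 0) ^+ 2.
      by apply: cvg_sqr; exact: cvgB.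
    have G2c : G (phi n) * (2 * c) @[n --> \oo] --> (0 : R).
      by rewrite -[X in _ --> X](mul0r (2 * c)); exact: cvgMr_tmp.
    apply: (ler_cvg_to sq G2c); apply: nearW => n.
    have [gp /andP[_ dc]] := gap n; apply: (le_trans gp).
    by rewrite ler_wpM2l// ltW.
  have [du uE] := form_line_bounded uFp uFm vp vm bp bm F0.
  apply/form_ext_le; split => //; apply: (le_trans uE).
  by move: CC; rewrite addr0 ler_pdivrMr// mulrC.
apply: recovery_reduction => u [f [uf ffin fp fn]].
have [Q fQ Qe] := version_controlled hm hl (fun x y _ _ z _ => I) regular_setT uf ffin.
have [uf' _] := uf.
have ae_on (I : set R) : {ae m, forall x, I x -> u x = f x}.
  by move: uf'; apply: filterS; [exact: (ae_filter_ringOfSetsType m)|move=> x H _; exact: H].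
have -> : form_val (form_line m lambda) u u = (2 * form_val (form_line m lambda) u u + 0) / 2.
  by field.
apply: (recovery_limsup hm hl eps_gt0 eps_cvg0 hg mass_cvg0 (fp := f) (fm := f) (Qp := Q) (Qm := Q)) => //.
- by move=> x y _ _; exact: fQ.
- by move=> x y _ _; exact: fQ.
- move=> x y _ _; have /andP[_ q1] := Qe x I; have /andP[q2 _] := Qe y I.
  by rewrite addrA subrK lerBlDr ler_wpDr.
- by under eq_fun do rewrite subrr expr0n mul0r; exact: cvg_cst.
Qed.

End limit_forms.

Unset Implicit Arguments.

Theorem theorem4p6 (R : realType)
    (m lambda : {measure set (measurableTypeR R) -> \bar R})
    (hm : scrM m) (hlambda : scrM lambda)
    (eps : nat -> R)
    (eps_gt0 : forall n, 0 < eps n)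
    (eps_noninc : nonincreasing_seq eps)
    (eps_cvg0 : eps @ \oo --> 0)
    (gamma : nat -> {measure set (measurableTypeR R) -> \bar R})
    (hgamma : forall n,
      finite_full_atomless_on `]- eps n, eps n[%classic (gamma n)) :
  let gbar (n : nat) : \bar R := gamma n `]- eps n, eps n[%classic in
  let lambda_ (n : nat) := regularized (eps n) lambda (gamma n) in
  let formn (n : nat) := form_line m (lambda_ n) in
  forall (hgm : (gbar n * max_mass (eps n) m
                 + max_mass (eps n) lambda * max_mass (eps n) m)%E
                @[n --> \oo] --> 0%E)
    (gammabar : \bar R) (hgammabar : gbar @ \oo --> gammabar),
  [/\ gammabar = +oo%E -> Mosco formn (form_two_sided m lambda),
      (0 < gammabar < +oo)%E ->
        Mosco formn (form_snapping m lambda (2 / fine gammabar))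
    & gammabar = 0%E -> Mosco formn (form_line m lambda)].
Proof.
move=> gbar lambda_ formn hgm gammabar hgammabar.
have mass_cvg0 : (max_mass (eps n) lambda * max_mass (eps n) m)%E @[n --> \oo] --> 0%E.
  apply: (squeeze_cvge _ (cvg_cst 0%E) hgm); apply: nearW => n.
  have l0 := ltW (max_mass_gt0 hlambda (eps_gt0 n)).
  have m0 := ltW (max_mass_gt0 hm (eps_gt0 n)).
  by rewrite mule_ge0//= leeDr// mule_ge0.
have gbarE n : gbar n = (fine (gbar n))%:E.
  by have [h _] := gap_mass_gt0 (eps_gt0 n) (hgamma n); rewrite fineK.
have gbar_fine (g : R) : gammabar = g%:E -> fine (gbar n) @[n --> \oo] --> g.
  by move=> gE; rewrite gE in hgammabar; exact: fine_cvg hgammabar.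
split.
- move=> gE; rewrite gE in hgammabar.
  apply: mosco_two_sided => //; apply/cvgeryP.
  by under eq_fun do rewrite -gbarE.
- move=> /andP[]; case: (gammabar) gbar_fine => [g| |]// H; rewrite lte_fin => g0 _.
  by apply: mosco_snapping => //; exact: H.
- by move=> gE; apply: mosco_line => //; exact: gbar_fine.
Qed.
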